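(* Let $\phi_0$ be the determinantal process on $\mathbb{C}$ with kernel $K_0$ and $Z$ a centered complex Gaussian random variable with $E|Z|^2=1$, defined on a common probability space, such that $\phi_0\cap\{Z\}=\varnothing$ almost surely and $\phi:=\phi_0\cup\{Z\}$ is a Ginibre process. Then for every positive integer $k$, $$P\{Z\in\mathcal{N}(\phi)\}\ \ge\ \left[\frac{\int_{\mathbb{C}^k}H(z)\,dz}{\int_{\mathbb{C}^k}\sqrt{H(z)}\,dz}\right]^2,$$ where $\mathcal{N}(\phi)$ and $H$ are defined in the context.
   Context: A point process $\psi\subset\mathbb{C}$ is determinantal with kernel $K$ (with respect to Lebesgue measure $dz$) if for every $k\ge 1$ and every Borel $B\subset\mathbb{C}^k$ the expected number of ordered $k$-tuples of distinct points of $\psi$ lying in $B$ equals $\int_B\det(K(z_i,z_j))_{1\le i,j\le k}\,dz_1\cdots dz_k$. The Ginibre process $\phi$ is the determinantal process with kernel $K(z_1,z_2)=\frac1\pi e^{z_1\overline{z_2}}e^{-\frac12(|z_1|^2+|z_2|^2)}$; $K_0(z_1,z_2)=\frac1\pi(e^{z_1\overline{z_2}}-1)e^{-\frac12(|z_1|^2+|z_2|^2)}$. A centered complex Gaussian $Z$ with $E|Z|^2=1$ has density $\frac1\pi e^{-|z|^2}$. A coupling $(\phi_0,Z)$ as in the claim is known to exist. Let $C(0,\phi)=\{z\in\mathbb{C}:\forall u\in\phi,\ |z|\le|z-u|\}$. $\mathcal{N}(\phi)$ is the set of points $z\in\phi$ such that the bisecting line (perpendicular bisector) of the segment $[0,z]$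 intersects the boundary of $C(0,\phi)$. For $z=(z_1,\dots,z_k)\in\mathbb{C}^k$ let $D(z)=\bigcup_{i=1}^kB(z_i,|z_i|)$, where $B(w,r)$ is the disc of center $w$ and radius $r$, and $$H(z)=(\pi R_{D(z)}(0,0)-1)\prod_{n\ge0}(1-\alpha_n(z)),$$ where $\alpha_n(z)$, $n\ge0$, are the eigenvalues (with multiplicity) of the integral operator with kernel $K$ acting on $L^2(D(z),dv)$ (they lie in $[0,1[$), and $R_{D}$ is the resolvent kernel $R_D(z_1,z_2)=K(z_1,z_2)+\sum_{n\ge2}K_D^{(n)}(z_1,z_2)$, with $K_D^{(1)}=K$ and $K_D^{(n)}(z_1,z_2)=\int_DK(z_1,v)K_D^{(n-1)}(v,z_2)\,dv$. *)

(* Defs.v *)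
From HB Require Import structures.
From mathcomp Require Import all_boot all_order all_algebra.
From mathcomp Require Import all_classical all_reals all_analysis.
From mathcomp Require Import measurable_realfun.
From mathcomp Require Import complex.
Set Implicit Arguments.
Unset Strict Implicit.
Unset Printing Implicit Defensive.
Import Order.TTheory GRing.Theory Num.Theory.
Import numFieldNormedType.Exports.
Local Open Scope classical_set_scope.
Local Open Scope ring_scope.
Local Open Scope complex_scope.

Local Notation normc := (@ComplexField.Normc.normc _).

Section prod_measure.
Context d1 d2 (T1 : measurableType d1) (T2 : measurableType d2) (R : realType).
Variable m1 : {sigma_finite_measure set T1 -> \bar R}.
Variable m2 : {sigma_finite_measure set T2 -> \bar R}.

(* A copy of [m1 \x m2], for which the sigma-finite structure is not shadowed
   by the instances on products of probabilities. *)
Definition prod_measure : set (T1 * T2)%type -> \bar R := (m1 \x m2)%E.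

HB.instance Definition _ := Measure.on prod_measure.

Let prod_measure_sigma_finite : sigma_finite setT prod_measure.
Proof.
have /sigma_finiteP[F [TF ndF Foo]] := sigma_finiteT m1.
have /sigma_finiteP[G [TG ndG Goo]] := sigma_finiteT m2.
exists (fun n => F n `*` G n).
  rewrite -setXTT TF TG predeqE => -[x y]; split.
    move=> [/= [n _ Fnx] [k _ Gky]]; exists (maxn n k) => //; split.
    - by move: x Fnx; exact/subsetPset/ndF/leq_maxl.
    - by move: y Gky; exact/subsetPset/ndG/leq_maxr.
  by move=> [n _ []/= ? ?]; split; exists n.
move=> k; have [? ?] := Foo k; have [? ?] := Goo k.
split; first exact: measurableX.
by rewrite [prod_measure _]product_measure1E// lte_mul_pinfty// ge0_fin_numE.
Qed.

HB.instance Definition _ :=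
  Measure_isSigmaFinite.Build _ _ _ prod_measure prod_measure_sigma_finite.

End prod_measure.

Section transport_measure.
Context d1 d2 (T1 : measurableType d1) (T2 : measurableType d2) (R : realType).
Variables (m : {sigma_finite_measure set T1 -> \bar R}).
Variables (f : T1 -> T2) (g : T2 -> T1).

Definition transport_measure & measurable_fun setT f & measurable_fun setT g &
  cancel f g : set T2 -> \bar R := pushforward m f.

Hypotheses (mf : measurable_fun setT f) (mg : measurable_fun setT g).
Hypothesis fK : cancel f g.

Let mu := transport_measure mf mg fK.

Let mu0 : mu set0 = 0%E.
Proof. by rewrite /mu /transport_measure /pushforward preimage_set0 measure0. Qed.

Let mu_ge0 A : (0 <= mu A)%E.
Proof. exact: measure_ge0. Qed.

Let mu_sigma_additive : semi_sigma_additive mu.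
Proof.
move=> F mF tF mUF; rewrite /mu /transport_measure /pushforward preimage_bigcup.
apply: measure_semi_sigma_additive.
- by move=> n; rewrite -[X in measurable X]setTI; exact: mf.
- apply/trivIsetP => /= i j _ _ ij; rewrite -preimage_setI.
  by move/trivIsetP : tF => /(_ _ _ _ _ ij) ->//; rewrite preimage_set0.
- by rewrite -preimage_bigcup -[X in measurable X]setTI; exact: mf.
Qed.

HB.instance Definition _ := isMeasure.Build _ _ _
  (transport_measure mf mg fK) mu0 mu_ge0 mu_sigma_additive.

Let mu_sigma_finite : sigma_finite setT mu.
Proof.
have [F TF Foo] := sigma_finiteT m.
exists (fun n => g @^-1` F n) => [|n].
  by rewrite -preimage_bigcup -TF preimage_setT.
have [mFn Fn] := Foo n.
split; first by rewrite -[X in measurable X]setTI; exact: mg.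
rewrite /mu /transport_measure /pushforward.
suff -> : f @^-1` (g @^-1` F n) = F n by [].
by apply/seteqP; split => x /=; rewrite fK.
Qed.

HB.instance Definition _ := Measure_isSigmaFinite.Build _ _ _
  (transport_measure mf mg fK) mu_sigma_finite.

End transport_measure.

Section power_measure.
Context d (T : measurableType d) (R : realType).

Definition tuple_cons n (p : T * n.-tuple T) : n.+1.-tuple T :=
  [tuple of p.1 :: p.2].

Definition tuple_uncons n (t : n.+1.-tuple T) : T * n.-tuple T :=
  (thead t, [tuple of behead t]).

Lemma measurable_tuple_cons n : measurable_fun setT (@tuple_cons n).
Proof. exact: (measurable_cons measurable_fst measurable_snd). Qed.

Lemma measurable_tuple_uncons n : measurable_fun setT (@tuple_uncons n).
Proof.
apply: measurable_fun_pair; first exact: measurable_tnth.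
exact: measurable_behead.
Qed.

Lemma tuple_consK n : cancel (@tuple_cons n) (@tuple_uncons n).
Proof. by move=> [x t]; congr pair; apply: val_inj. Qed.

Fixpoint power_measure (m : {sigma_finite_measure set T -> \bar R}) n :
    {sigma_finite_measure set (n.-tuple T) -> \bar R} :=
  match n with
  | 0%N => \d_([tuple] : 0.-tuple T)
  | n'.+1 => transport_measure (prod_measure m (power_measure m n'))
    (@measurable_tuple_cons n') (@measurable_tuple_uncons n') (@tuple_consK n')
  end.

End power_measure.

HB.instance Definition _ (R : rcfType) := NormedModule.copy R[i] R[i]^o.

Section complex_measure.
Variable R : realType.

Definition plane_of_complex (z : R[i]) :
  measurableTypeR R * measurableTypeR R := (complex.Re z, complex.Im z).

Definition complex_of_plane (p : measurableTypeR R * measurableTypeR R) :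
  R[i] := p.1 +i* p.2.

(* The Borel sets of [R[i]] are those of the plane. *)
HB.instance Definition _ :=
  Measurable.copy R[i] (g_sigma_algebra_preimageType plane_of_complex).

Lemma measurable_plane_of_complex : measurable_fun setT plane_of_complex.
Proof. by move=> _ A mA; exists A. Qed.

Lemma measurable_complex_of_plane : measurable_fun setT complex_of_plane.
Proof.
move=> _ _ [A mA <-]; rewrite !setTI.
suff -> : complex_of_plane @^-1` (plane_of_complex @^-1` A) = A by [].
by apply/seteqP; split => -[x y].
Qed.

Lemma complex_of_planeK : cancel complex_of_plane plane_of_complex.
Proof. by case. Qed.

Definition lebesgue_complex : {sigma_finite_measure set R[i] -> \bar R} :=
  transport_measure
    (prod_measure (@lebesgue_measure R) (@lebesgue_measure R))
    measurable_complex_of_plane measurable_plane_of_complex complex_of_planeK.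

End complex_measure.
Arguments lebesgue_complex {R}.

Section point_processes.
Variable R : realType.
Local Notation C := R[i].

Definition locally_finite (A : set C) :=
  forall r : R, finite_set (A `&` [set z | `|z| <= r%:C]).

Section random_sets.
Context d (Omega : measurableType d) (P : probability Omega R).

Definition point_process (psi : Omega -> set C) :=
  (forall w, locally_finite (psi w)) /\
  (forall A : set C, measurable A ->
    measurable_fun setT (fun w => counting (psi w `&` A) : \bar R)).

Definition distinct_tuples k (A : set C) : set (k.-tuple C) :=
  [set t : k.-tuple C | uniq t /\ forall i, A (tnth t i)].

(* The determinant is real for the Hermitian kernels considered below. *)
Definition determinantal (psi : Omega -> set C) (K : C -> C -> C) :=
  point_process psi /\
  forall k (B : set (k.-tuple C)), (0 < k)%N -> measurable B ->
    (\int[P]_w counting (distinct_tuples (psi w) `&` B) =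
     \int[power_measure lebesgue_complex k]_(z in B)
       (complex.Re (\det (\matrix_(i, j) K (tnth z i) (tnth z j))))%:E)%E.

Definition standard_complex_gaussian (Z : {RV P >-> C}) :=
  forall A : set C, measurable A ->
    (distribution P Z A =
     \int[lebesgue_complex]_(z in A) (pi^-1 * expR (- normc z ^+ 2))%:E)%E.

End random_sets.

Definition cexp (z : C) : C :=
  (expR (complex.Re z))%:C * (cos (complex.Im z) +i* sin (complex.Im z)).

Definition ginibre_kernel (z1 z2 : C) : C :=
  (pi^-1)%:C * cexp (z1 * z2^*) *
  (expR (- (normc z1 ^+ 2 + normc z2 ^+ 2) / 2))%:C.

Definition ginibre_kernel0 (z1 z2 : C) : C :=
  (pi^-1)%:C * (cexp (z1 * z2^*) - 1) *
  (expR (- (normc z1 ^+ 2 + normc z2 ^+ 2) / 2))%:C.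

End point_processes.

Section voronoi.
Variable R : realType.
Local Notation C := R[i].

(* [C(0, phi)] *)
Definition cell0 (phi : set C) : set C :=
  [set z | forall u, phi u -> `|z| <= `|z - u|].

Definition boundary (A : set C) : set C := closure A `\` A°.

(* The line through [z / 2] orthogonal to [z]; it is the whole plane in the
   degenerate case [z = 0]. *)
Definition bisector0 (z : C) : set C :=
  [set w | complex.Re ((w - z / 2) * z^*) = 0].

Definition neighbours0 (phi : set C) : set C :=
  [set z | phi z /\ bisector0 z `&` boundary (cell0 phi) !=set0].

End voronoi.

Section integral_operator.
Variable R : realType.
Local Notation C := R[i].
Local Notation mu := (@lebesgue_complex R).

Definition cintegral (D : set C) (f : C -> C) : C :=
  (\int[mu]_(v in D) complex.Re (f v)) +i* (\int[mu]_(v in D) complex.Im (f v)).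

Variable K : C -> C -> C.
Variable D : set C.

(* [iter_kernel n] is the [n.+1]-st iterated kernel [K_D^(n.+1)]. *)
Fixpoint iter_kernel (n : nat) (z1 z2 : C) : C :=
  if n is m.+1 then cintegral D (fun v => K z1 v * iter_kernel m v z2)
  else K z1 z2.

Definition resolvent_kernel (z1 z2 : C) : C :=
  K z1 z2 + limn (fun N => \sum_(1 <= n < N) iter_kernel n z1 z2).

Definition kernel_operator (f : C -> C) (z : C) : C :=
  cintegral D (fun v => K z v * f v).

Definition square_integrable (f : C -> C) :=
  measurable_fun D f /\ (\int[mu]_(v in D) (normc (f v) ^+ 2)%:E < +oo)%E.

Definition ae_eq_on (f g : C -> C) := {ae mu, forall z, D z -> f z = g z}.

Definition eigenfunction (lam : C) (f : C -> C) :=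
  square_integrable f /\ ae_eq_on (kernel_operator f) (fun z => lam * f z).

(* The eigenspace of [lam] in [L^2(D)], whose elements are classes of functions
   modulo a.e. equality, has dimension [m]. *)
Definition multiplicity (lam : C) (m : nat) :=
  exists e : 'I_m -> C -> C,
    [/\ forall i, eigenfunction lam (e i),
        forall c : 'I_m -> C,
          ae_eq_on (fun z => \sum_i c i * e i z) (fun=> 0) ->
          forall i, c i = 0 &
        forall f, eigenfunction lam f ->
          exists c : 'I_m -> C, ae_eq_on f (fun z => \sum_i c i * e i z)].

(* Every nonzero [lam] is listed as many times as its multiplicity. The value 0
   contributes only factors 1 to the product of the [1 - alpha n] and may be
   listed any number of times. *)
Definition eigenvalue_sequence (alpha : nat -> R) :=
  forall lam : C, lam != 0 -> forall m : nat,
    multiplicity lam m <-> ([set n | (alpha n)%:C = lam] #= `I_m)%card.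

End integral_operator.

Section hole.
Variable R : realType.
Local Notation C := R[i].

Definition discs k (z : k.-tuple C) : set C :=
  [set v | exists i, `|v - tnth z i| < `|tnth z i|].

(* [alpha z] lists the eigenvalues of the operator with kernel [ginibre_kernel]
   on [L^2(discs z)]. *)
Definition Hfun k (alpha : k.-tuple C -> nat -> R) (z : k.-tuple C) : R :=
  (pi * complex.Re (resolvent_kernel (@ginibre_kernel R) (discs z) 0 0) - 1) *
  limn (fun N => \prod_(n < N) (1 - alpha z n)).

End hole.

(* Main.v *)
Require Import Defs.
From HB Require Import structures.
From mathcomp Require Import all_boot all_order all_algebra finmap.
From mathcomp Require Import all_classical all_reals all_analysis.
From mathcomp Require Import measurable_realfun.
From mathcomp Require Import complex.
From mathcomp Require Import perm.
From mathcomp Require Import ring lra zify.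
Set Implicit Arguments.
Unset Strict Implicit.
Unset Printing Implicit Defensive.
Import Order.TTheory GRing.Theory Num.Theory.
Import numFieldNormedType.Exports.
Local Open Scope classical_set_scope.
Local Open Scope ring_scope.
Local Open Scope complex_scope.
Local Notation "x ^*" := (Num.conj x) : complex_scope.
Local Notation "x ^*" := (Num.conj x) : ring_scope.
Local Notation Re := complex.Re.
Local Notation Im := complex.Im.
Local Notation normc := (@ComplexField.Normc.normc _).

(* Write D for the union of the discs and F = P(phi /\ D empty). The event that phi0 misses D while
   Z lies in D has probability P(phi0 /\ D empty) - F, and on it some point of a segment [0, z_i] is
   equidistant from 0 and Z and lies in the cell of phi0, so that Z is a neighbour of 0.

   Expanding E (1 - s) ^ #(phi /\ D) in factorial moments gives the Fredholm series
   sum_k (-s)^k e_k with e_k = (1/k!) int_{D^k} det K. Expanding det K along a row shows that the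
   e_k and the traces of the powers of K on L^2(D) are related by Newton's identities, and dividing
   out the eigenvalues one at a time turns the series into the product of the 1 - s lam_n; hence
   F is the product in H. The kernel K_0 is the Schur complement of K at 0, so its determinants are
   pi det K(0, z; 0, z), and Mertens' theorem yields P(phi0 /\ D empty) = F pi R_D(0, 0). Hence
   H(z) is the probability of the event above as soon as F <> 0, and H(z) = 0 otherwise.

   Integrating the indicator of that event over z gives a random variable Y which vanishes off the
   event N that Z is a neighbour of 0, has mean int H and second moment at most (int sqrt H)^2,
   because P(A /\ A') <= sqrt (P A * P A'). The Cauchy-Schwarz inequality concludes. *)

(** * Complex numbers as pairs of reals *)

(** The moments of the process involve [K] on the diagonal, which a kernel known only almost
    everywhere does not determine. The analysis is therefore done with bounded measurable functions
    against a finite measure and with identities that hold at every point; classes in L^2 appear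
    only when the eigenvalues listed by [alpha] are compared with those constructed here. In place
    of Mercer's theorem, [K] is the pointwise limit of uniformly bounded sums of
    [e j z * (e j w)^*], from the Taylor series of the exponential, and this equates the integral of
    [K] over the diagonal with the sum of the eigenvalues. That no eigenvalue exceeds 1 is read off
    the process: for [lam > 1] the product would vanish at [s = 1 / lam < 1], where it equals the
    expectation of a positive variable. An eigenvalue 1 would force [F = 0], which is why that case
    is kept apart. When [F != 0] all eigenvalues are below 1 and the iterated kernels decay
    geometrically; this gives the absolute convergence in Mertens' theorem, the Fredholm series
    being known only to converge. *)

Section complex_algebra.
Variable R : realType.
Local Notation C := R[i].
Implicit Types (x y z : C).

Lemma eqcP z w : Re z = Re w -> Im z = Im w -> z = w.
Proof. by case: z w => [a b] [c e] /= -> ->. Qed.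

Lemma ReD z w : Re (z + w) = Re z + Re w.
Proof. by case: z w => [a b] [c e]. Qed.
Lemma ImD z w : Im (z + w) = Im z + Im w.
Proof. by case: z w => [a b] [c e]. Qed.
Lemma ReN z : Re (- z) = - Re z.
Proof. by case: z. Qed.
Lemma ImN z : Im (- z) = - Im z.
Proof. by case: z. Qed.
Lemma ReB z w : Re (z - w) = Re z - Re w.
Proof. by rewrite ReD ReN. Qed.
Lemma ImB z w : Im (z - w) = Im z - Im w.
Proof. by rewrite ImD ImN. Qed.
Lemma ReM z w : Re (z * w) = Re z * Re w - Im z * Im w.
Proof. by case: z w => [a b] [c e]. Qed.
Lemma ImM z w : Im (z * w) = Re z * Im w + Im z * Re w.
Proof. by case: z w => [a b] [c e] /=. Qed.
Lemma ReJ z : Re (z^*) = Re z.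
Proof. by case: z. Qed.
Lemma ImJ z : Im (z^*) = - Im z.
Proof. by case: z. Qed.
Lemma Re_real (a : R) : Re a%:C = a. Proof. by []. Qed.
Lemma Im_real (a : R) : Im a%:C = 0. Proof. by []. Qed.
Lemma Re_sum (I : Type) (r : seq I) (P : pred I) (F : I -> C) :
  Re (\sum_(i <- r | P i) F i) = \sum_(i <- r | P i) Re (F i).
Proof.
elim: r => [|i r IH]; rewrite ?big_nil// !big_cons; case: ifP => _; rewrite ?ReD IH//.
Qed.
Lemma Im_sum (I : Type) (r : seq I) (P : pred I) (F : I -> C) :
  Im (\sum_(i <- r | P i) F i) = \sum_(i <- r | P i) Im (F i).
Proof.
elim: r => [|i r IH]; rewrite ?big_nil// !big_cons; case: ifP => _; rewrite ?ImD IH//.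
Qed.
Definition ReImE := (ReD, ImD, ReN, ImN, ReM, ImM, ReJ, ImJ).

Lemma cconjD z w : (z + w)^* = z^* + w^*.
Proof. exact: (rmorphD (@conjc R)). Qed.
Lemma cconjB z w : (z - w)^* = z^* - w^*.
Proof. exact: (rmorphB (@conjc R)). Qed.
Lemma cconjM z w : (z * w)^* = z^* * w^*.
Proof. exact: (rmorphM (@conjc R)). Qed.
Lemma cconj_sum (I : Type) (r : seq I) (P : pred I) (F : I -> C) :
  (\sum_(i <- r | P i) F i)^* = \sum_(i <- r | P i) (F i)^*.
Proof. exact: (rmorph_sum (@conjc R)). Qed.

Lemma cconjK z : (z^*)^* = z.
Proof. exact: (@conjcK R). Qed.
Lemma cconj_real (a : R) : (a%:C)^* = a%:C.
Proof. exact: (@conjc_real R). Qed.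

Lemma normcE2 z : normc z ^+ 2 = Re z ^+ 2 + Im z ^+ 2.
Proof. by case: z => a b /=; rewrite sqr_sqrtr// addr_ge0// sqr_ge0. Qed.
Lemma normc_ge0 z : 0 <= normc z.
Proof. by case: z => a b; exact: sqrtr_ge0. Qed.
Lemma normcM z w : normc (z * w) = normc z * normc w.
Proof. exact: ComplexField.Normc.normcM. Qed.
Lemma normcD z w : normc (z + w) <= normc z + normc w.
Proof. exact: le_normcD. Qed.
Lemma normcN z : normc (- z) = normc z.
Proof. by case: z => a b /=; rewrite !sqrrN. Qed.
Lemma normc_distC z w : normc (z - w) = normc (w - z).
Proof. by rewrite -normcN opprB. Qed.
Lemma normc_conj z : normc (z^*) = normc z.
Proof. by case: z => a b /=; rewrite sqrrN. Qed.
Lemma normc_real (a : R) : normc a%:C = `|a|.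
Proof. by rewrite /= expr0n addr0 sqrtr_sqr. Qed.
Lemma normc0 : normc (0 : C) = 0.
Proof. by rewrite -[0]/(0%:C) normc_real normr0. Qed.
Lemma normc1 : normc (1 : C) = 1.
Proof. by rewrite -[1]/(1%:C) normc_real normr1. Qed.
Lemma normc_eq0 z : normc z = 0 -> z = 0.
Proof. exact: ComplexField.Normc.eq0_normc. Qed.
Lemma normc_gt0 z : z != 0 -> 0 < normc z.
Proof.
by move=> z0; rewrite lt_neqAle normc_ge0 andbT eq_sym; apply: contraNneq z0 => /normc_eq0 ->.
Qed.
Lemma normc_Re z : `|Re z| <= normc z.
Proof.
rewrite -sqrtr_sqr -(ger0_norm (normc_ge0 z)) -sqrtr_sqr ler_wsqrtr// normcE2.
by rewrite lerDl sqr_ge0.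
Qed.
Lemma normc_Im z : `|Im z| <= normc z.
Proof.
rewrite -sqrtr_sqr -(ger0_norm (normc_ge0 z)) -sqrtr_sqr ler_wsqrtr// normcE2.
by rewrite lerDr sqr_ge0.
Qed.
Lemma Re_le_normc z : Re z <= normc z.
Proof. exact: le_trans (ler_norm _) (normc_Re z). Qed.
Lemma normc_le_ReIm z : normc z <= `|Re z| + `|Im z|.
Proof.
rewrite -(ger0_norm (normc_ge0 z)) -(@ger0_norm _ (`|Re z| + _)) ?addr_ge0//.
rewrite -ler_sqr ?nnegrE ?addr_ge0// ?normr_ge0// !real_normK ?num_real// normcE2 sqrrD !real_normK ?num_real//.
by rewrite addrAC lerDl mulrn_wge0// mulr_ge0.
Qed.
Lemma mulcJ z : z * z^* = (normc z ^+ 2)%:C.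
Proof. by rewrite normcE2; apply: eqcP; rewrite !ReImE ?Re_real ?Im_real; ring. Qed.
Lemma normcX z n : normc (z ^+ n) = normc z ^+ n.
Proof.
by elim: n => [|n IH]; rewrite ?expr0 ?normc1// !exprS normcM IH.
Qed.
Lemma normc_sum (I : Type) (r : seq I) (P : pred I) (F : I -> C) :
  normc (\sum_(i <- r | P i) F i) <= \sum_(i <- r | P i) normc (F i).
Proof.
elim: r => [|i r IH]; rewrite ?big_nil ?normc0// !big_cons; case: ifP => _ //.
by rewrite (le_trans (normcD _ _))// lerD2l.
Qed.
Lemma normC z : `|z| = (normc z)%:C. Proof. by []. Qed.

End complex_algebra.

(** * Limits of complex sequences *)

Section complex_limits.
Variable R : realType.
Local Notation C := R[i].
Implicit Types (u v : nat -> C) (l : C).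

(** The norm of [R[i]] is itself valued in [R[i]], so radii are complex numbers; being positive they
    are real, which reduces complex limits to limits of the real-valued [normc]. *)
Lemma cvgc_normP u l :
  u @ \oo --> l <-> (fun n => normc (u n - l)) @ \oo --> (0 : R).
Proof.
split=> [/cvgrPdist_lt ul|/cvgrPdist_lt ul].
  apply/cvgrPdist_lt => e e0; have /ul : 0 < e%:C :> C by rewrite ltcR.
  apply: filterS => n; rewrite normC ltcR sub0r normrN.
  by rewrite (ger0_norm (normc_ge0 _)) normc_distC.
apply/cvgrPdist_lt => e e0.
have eE : e = (Re e)%:C by move: e0; rewrite ltcE => /andP[/eqP h _]; apply: eqcP.
have e0' : 0 < Re e by move: e0; rewrite eE ltcR.
have := ul _ e0'; apply: filterS => n.
by rewrite sub0r normrN (ger0_norm (normc_ge0 _)) normc_distC eE normC ltcR.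
Qed.

Lemma cvgc_Re u l : u @ \oo --> l -> (fun n => Re (u n)) @ \oo --> Re l.
Proof.
move=> /cvgc_normP /cvgrPdist_lt ul; apply/cvgrPdist_lt => e /ul.
apply: filterS => n; rewrite sub0r normrN (ger0_norm (normc_ge0 _)).
by apply: le_lt_trans; rewrite normc_distC -ReB normc_Re.
Qed.

Lemma cvgc_Im u l : u @ \oo --> l -> (fun n => Im (u n)) @ \oo --> Im l.
Proof.
move=> /cvgc_normP /cvgrPdist_lt ul; apply/cvgrPdist_lt => e /ul.
apply: filterS => n; rewrite sub0r normrN (ger0_norm (normc_ge0 _)).
by apply: le_lt_trans; rewrite normc_distC -ImB normc_Im.
Qed.

Lemma cvgc_ReIm u l : (fun n => Re (u n)) @ \oo --> Re l ->
  (fun n => Im (u n)) @ \oo --> Im l -> u @ \oo --> l.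
Proof.
move=> ul1 ul2; apply/cvgc_normP.
apply: (@squeeze_cvgr _ _ _ _ (cst 0)
    (fun n => `|Re (u n) - Re l| + `|Im (u n) - Im l|)).
- apply: nearW => n; rewrite normc_ge0/= (le_trans (normc_le_ReIm _))//.
  by rewrite ReB ImB.
- exact: cvg_cst.
rewrite -[X in _ --> X](addr0 0); apply: cvgD.
  by rewrite -(normr0 R); apply: cvg_norm; rewrite -(subrr (Re l)); exact: cvgB (cvg_cst _).
by rewrite -(normr0 R); apply: cvg_norm; rewrite -(subrr (Im l)); exact: cvgB (cvg_cst _).
Qed.

Lemma cvgc_conj u l : u @ \oo --> l -> (fun n => (u n)^*) @ \oo --> (l^*).
Proof.
move=> /cvgc_normP ul; apply/cvgc_normP.
by apply: cvg_trans ul; apply: near_eq_cvg; apply: nearW => n; rewrite -cconjB normc_conj.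
Qed.

Lemma cvgc_normc u l : u @ \oo --> l -> (fun n => normc (u n)) @ \oo --> normc l.
Proof.
move=> /cvgc_normP /cvgrPdist_lt ul; apply/cvgrPdist_lt => e /ul.
apply: filterS => n; rewrite sub0r normrN (ger0_norm (normc_ge0 _)).
apply: le_lt_trans.
have := normcD (l - u n) (u n); have := normcD (u n - l) l.
by rewrite !subrK (normc_distC l) ler_norml => ? ?; apply/andP; split; lra.
Qed.

Lemma cvgc_unique u l l' : u @ \oo --> l -> u @ \oo --> l' -> l = l'.
Proof.
move=> h h'; apply: eqcP.
  by rewrite -(cvg_lim (@Rhausdorff R) (cvgc_Re h)) (cvg_lim (@Rhausdorff R) (cvgc_Re h')).
by rewrite -(cvg_lim (@Rhausdorff R) (cvgc_Im h)) (cvg_lim (@Rhausdorff R) (cvgc_Im h')).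
Qed.

Lemma cvgcD u v l m : u @ \oo --> l -> v @ \oo --> m ->
  (fun n => u n + v n) @ \oo --> l + m.
Proof.
move=> h h'; apply: cvgc_ReIm; under eq_fun do rewrite ReImE; rewrite ReImE.
  by apply: cvgD; exact: cvgc_Re.
by apply: cvgD; exact: cvgc_Im.
Qed.

Lemma cvgcM u v l m : u @ \oo --> l -> v @ \oo --> m ->
  (fun n => u n * v n) @ \oo --> l * m.
Proof.
move=> h h'; apply: cvgc_ReIm; under eq_fun do rewrite ReImE; rewrite ReImE.
  by apply: cvgB; apply: cvgM; (exact: cvgc_Re || exact: cvgc_Im).
by apply: cvgD; apply: cvgM; (exact: cvgc_Re || exact: cvgc_Im).
Qed.

Lemma cvgc_cst l : (fun=> l : C) @ \oo --> l.
Proof. exact: cvg_cst. Qed.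

Lemma cvgcN u l : u @ \oo --> l -> (fun n => - u n) @ \oo --> - l.
Proof.
move=> h; apply: cvgc_ReIm; under eq_fun do rewrite ReImE; rewrite ReImE.
  by apply: cvgN; exact: cvgc_Re.
by apply: cvgN; exact: cvgc_Im.
Qed.

Lemma cvgcB u v l m : u @ \oo --> l -> v @ \oo --> m ->
  (fun n => u n - v n) @ \oo --> l - m.
Proof. by move=> h /cvgcN; exact: cvgcD. Qed.

Lemma cvgc_realP (u : nat -> R) (l : R) :
  u @ \oo --> l <-> (fun n => (u n)%:C) @ \oo --> l%:C.
Proof.
split=> [h|/cvgc_Re//].
by apply: cvgc_ReIm => //; exact: cvg_cst.
Qed.

End complex_limits.

(** * Bounded measurable functions and complex integrals *)

Section bounded_measurable.
Variable R : realType.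
Local Notation C := R[i].

(** Products and bounded pointwise limits stay in this class, and its members are integrable for
    every finite measure, so that no integrability condition has to be carried along. The bound
    holds everywhere, not almost everywhere. *)
Definition bmf d (X : measurableType d) (f : X -> C) :=
  [/\ measurable_fun setT (fun x => Re (f x)),
      measurable_fun setT (fun x => Im (f x)) &
      exists M, forall x, normc (f x) <= M].

Context d (X : measurableType d).
Implicit Types (f g : X -> C).

Lemma bmf_ext f g : f =1 g -> bmf f -> bmf g.
Proof. by move=> /funext ->. Qed.

Lemma bmf_cst c : bmf (fun _ : X => c : C).
Proof. by split; [exact: measurable_cst | exact: measurable_cst | exists (normc c)]. Qed.

Lemma bmfD f g : bmf f -> bmf g -> bmf (fun x => f x + g x).
Proof.
move=> [a b [M hM]] [a' b' [M' hM']]; split.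
- by under eq_fun do rewrite ReD; exact: measurable_funD.
- by under eq_fun do rewrite ImD; exact: measurable_funD.
- by exists (M + M') => x; rewrite (le_trans (normcD _ _))// lerD.
Qed.

Lemma bmfN f : bmf f -> bmf (fun x => - f x).
Proof.
move=> [a b [M hM]]; split.
- by under eq_fun do rewrite ReN; exact: measurableT_comp.
- by under eq_fun do rewrite ImN; exact: measurableT_comp.
- by exists M => x; rewrite normcN.
Qed.

Lemma bmfB f g : bmf f -> bmf g -> bmf (fun x => f x - g x).
Proof. by move=> hf hg; apply: bmfD => //; exact: bmfN. Qed.

Lemma bmfJ f : bmf f -> bmf (fun x => (f x)^*).
Proof.
move=> [a b [M hM]]; split.
- by under eq_fun do rewrite ReJ.
- by under eq_fun do rewrite ImJ; exact: measurableT_comp.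
- by exists M => x; rewrite normc_conj.
Qed.

Lemma bmfM f g : bmf f -> bmf g -> bmf (fun x => f x * g x).
Proof.
move=> [a b [M hM]] [a' b' [M' hM']]; split.
- by under eq_fun do rewrite ReM; apply: measurable_funB; exact: measurable_funM.
- by under eq_fun do rewrite ImM; apply: measurable_funD; exact: measurable_funM.
- by exists (M * M') => x; rewrite normcM ler_pM// normc_ge0.
Qed.

Lemma bmfZ (c : C) f : bmf f -> bmf (fun x => c * f x).
Proof. by move=> hf; apply: bmfM => //; exact: bmf_cst. Qed.

Lemma bmf_sum (I : Type) (r : seq I) (P : pred I) (F : I -> X -> C) :
  (forall i, P i -> bmf (F i)) -> bmf (fun x => \sum_(i <- r | P i) F i x).
Proof.
move=> h; elim: r => [|i r IH].
  by apply: bmf_ext (bmf_cst _) => x; rewrite big_nil.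
have [Pi|nPi] := boolP (P i).
  by apply: bmf_ext (bmfD (h i Pi) IH) => x; rewrite big_cons Pi.
by apply: bmf_ext IH => x; rewrite big_cons (negbTE nPi).
Qed.

Lemma bmf_prod (I : Type) (r : seq I) (P : pred I) (F : I -> X -> C) :
  (forall i, P i -> bmf (F i)) -> bmf (fun x => \prod_(i <- r | P i) F i x).
Proof.
move=> h; elim: r => [|i r IH].
  by apply: bmf_ext (bmf_cst _) => x; rewrite big_nil.
have [Pi|nPi] := boolP (P i).
  by apply: bmf_ext (bmfM (h i Pi) IH) => x; rewrite big_cons Pi.
by apply: bmf_ext IH => x; rewrite big_cons (negbTE nPi).
Qed.

Lemma bmf_comp d' (Y : measurableType d') (h : X -> Y) (f : Y -> C) :
  measurable_fun setT h -> bmf f -> bmf (f \o h).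
Proof.
move=> mh [a b [M hM]]; split; last by exists M => x; exact: hM.
  exact: (measurableT_comp a mh).
exact: (measurableT_comp b mh).
Qed.

Lemma bmf_lim (F : nat -> X -> C) f (M : R) :
  (forall n, bmf (F n)) -> (forall n x, normc (F n x) <= M) ->
  (forall x, F ^~ x @ \oo --> f x) -> bmf f.
Proof.
move=> mF FM Ff; split.
- apply: (@measurable_fun_cvg _ _ _ setT (fun n x => Re (F n x))) => //.
    by move=> n; case: (mF n).
  by move=> x _; exact: cvgc_Re.
- apply: (@measurable_fun_cvg _ _ _ setT (fun n x => Im (F n x))) => //.
    by move=> n; case: (mF n).
  by move=> x _; exact: cvgc_Im.
exists M => x; have := cvgc_normc (Ff x).
move=> h; rewrite -(cvg_lim (@Rhausdorff R) h); apply: limr_le; first exact: cvgP h.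
by apply: nearW => n; exact: FM.
Qed.

Lemma bmf_real (f : X -> R) : measurable_fun setT f ->
  (exists M, forall x, `|f x| <= M) -> bmf (fun x => (f x)%:C).
Proof.
move=> mf [M fM]; split => //.
by exists M => x; rewrite normc_real.
Qed.

End bounded_measurable.

(** * Integrals of complex functions against a finite measure *)

HB.lock Definition cint (R : realType) d (T : measurableType d)
    (nu : {measure set T -> \bar R}) (f : T -> R[i]) : R[i] :=
  (\int[nu]_v Re (f v)) +i* (\int[nu]_v Im (f v)).

Section cint.
Variable R : realType.
Local Notation C := R[i].

Context d (T : measurableType d) (nu : {finite_measure set T -> \bar R}).
Implicit Types (f g : T -> C).

Lemma bmf_intRe f : bmf f -> nu.-integrable setT (EFin \o (fun x => Re (f x))).
Proof.
move=> [a b [M hM]]; apply: measurable_bounded_integrable => //.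
  by rewrite ltey_eq fin_num_measure.
exists M; split; first exact: num_real.
move=> y My x _ /=; rewrite (le_trans (normc_Re _))// (le_trans (hM _))//.
exact: ltW.
Qed.

Lemma bmf_intIm f : bmf f -> nu.-integrable setT (EFin \o (fun x => Im (f x))).
Proof.
move=> [a b [M hM]]; apply: measurable_bounded_integrable => //.
  by rewrite ltey_eq fin_num_measure.
exists M; split; first exact: num_real.
move=> y My x _ /=; rewrite (le_trans (normc_Im _))// (le_trans (hM _))//.
exact: ltW.
Qed.

Lemma eq_cint f g : f =1 g -> cint nu f = cint nu g.
Proof. by move=> /funext ->. Qed.

Lemma Re_cint f : Re (cint nu f) = \int[nu]_v Re (f v).
Proof. by rewrite unlock. Qed.
Lemma Im_cint f : Im (cint nu f) = \int[nu]_v Im (f v).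
Proof. by rewrite unlock. Qed.

Lemma cintD f g : bmf f -> bmf g ->
  cint nu (fun x => f x + g x) = cint nu f + cint nu g.
Proof.
move=> hf hg; apply: eqcP; rewrite !ReImE; [rewrite !Re_cint|rewrite !Im_cint].
  under eq_Rintegral do rewrite ReD.
  by rewrite RintegralD//; exact: bmf_intRe.
under eq_Rintegral do rewrite ImD.
by rewrite RintegralD//; exact: bmf_intIm.
Qed.

Lemma cintZ c f : bmf f -> cint nu (fun x => c * f x) = c * cint nu f.
Proof.
move=> hf; have iR := bmf_intRe hf; have iI := bmf_intIm hf.
have Zi (r : R) (h : T -> R) : nu.-integrable setT (EFin \o h) ->
  nu.-integrable setT (EFin \o (fun x => r * h x)) by exact: integrableZl.
apply: eqcP; rewrite !ReImE !Re_cint !Im_cint.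
  under eq_Rintegral do rewrite ReM.
  by rewrite RintegralB ?RintegralZl//; exact: Zi.
under eq_Rintegral do rewrite ImM.
by rewrite RintegralD ?RintegralZl//; exact: Zi.
Qed.

Lemma cintZr c f : bmf f -> cint nu (fun x => f x * c) = cint nu f * c.
Proof. by move=> hf; under eq_cint do rewrite mulrC; rewrite cintZ// mulrC. Qed.

Lemma cintN f : bmf f -> cint nu (fun x => - f x) = - cint nu f.
Proof.
by move=> hf; under eq_cint do rewrite -mulN1r; rewrite cintZ// mulN1r.
Qed.

Lemma cintB f g : bmf f -> bmf g ->
  cint nu (fun x => f x - g x) = cint nu f - cint nu g.
Proof. by move=> hf hg; rewrite cintD ?cintN//; exact: bmfN. Qed.

Lemma cint0 : cint nu (fun=> 0) = 0.
Proof. by rewrite unlock /Rintegral/= integral0. Qed.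

Lemma cint_sum (I : Type) (r : seq I) (P : pred I) (F : I -> T -> C) :
  (forall i, P i -> bmf (F i)) ->
  cint nu (fun x => \sum_(i <- r | P i) F i x) = \sum_(i <- r | P i) cint nu (F i).
Proof.
move=> h; elim: r => [|i r IH].
  by rewrite big_nil -[RHS]cint0; congr cint; apply: funext => x; rewrite big_nil.
rewrite big_cons -IH; have [Pi|nPi] := boolP (P i).
  rewrite -cintD; [|exact: h|exact: bmf_sum].
  by apply: eq_cint => x; rewrite big_cons Pi.
by apply: eq_cint => x; rewrite big_cons (negbTE nPi).
Qed.

Lemma cintJ f : bmf f -> cint nu (fun x => (f x)^*) = (cint nu f)^*.
Proof.
move=> hf; apply: eqcP; rewrite !ReImE; [rewrite !Re_cint|rewrite !Im_cint].
  by under eq_Rintegral do rewrite ReJ.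
under eq_Rintegral do rewrite ImJ -mulN1r.
by rewrite RintegralZl ?mulN1r//; exact: bmf_intIm.
Qed.

Lemma cint_real (f : T -> R) : cint nu (fun x => (f x)%:C) = (\int[nu]_v f v)%:C.
Proof. by rewrite unlock /Rintegral /= integral0. Qed.

Definition mass := fine (nu setT).

Lemma mass_ge0 : 0 <= mass.
Proof. by rewrite fine_ge0. Qed.

Lemma bmf_normc f : bmf f -> bmf (fun x => (normc (f x))%:C).
Proof.
move=> [a b [M hM]]; apply: bmf_real.
  have -> : (fun x => normc (f x)) =
     (fun x => Num.sqrt (Re (f x) ^+ 2 + Im (f x) ^+ 2)).
    by apply/funext => x; case: (f x).
  apply: (@measurableT_comp _ _ _ _ _ _ (@Num.sqrt R)).
    by apply: continuous_measurable_fun; exact: sqrt_continuous.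
  by apply: measurable_funD; exact: measurable_funX.
by exists M => x; rewrite ger0_norm// normc_ge0.
Qed.

Lemma le_cint_normc f : bmf f -> normc (cint nu f) <= \int[nu]_v normc (f v).
Proof.
move=> hf; have [->|n0] := eqVneq (normc (cint nu f)) 0.
  by apply: Rintegral_ge0 => x _; exact: normc_ge0.
set I := cint nu f in n0 *.
have np : 0 < normc I by rewrite lt_def n0 normc_ge0.
(* Rotation by [u] makes the integral real and equal to its modulus, so that only a real part has to
   be estimated. *)
pose u : C := I^* * ((normc I)^-1)%:C.
have nu1 : normc u = 1.
  by rewrite normcM normc_conj normc_real ger0_norm ?invr_ge0 ?normc_ge0// divff.
have -> : normc I = Re (cint nu (fun x => u * f x)).
  by rewrite cintZ// /u mulrAC (mulrC I^*) mulcJ -rmorphM expr2 mulfK.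
rewrite Re_cint; apply: le_Rintegral => //.
- by apply: bmf_intRe; exact: bmfZ.
- have := bmf_intRe (bmf_normc hf); exact.
move=> x _; rewrite (le_trans (Re_le_normc _))// normcM nu1 mul1r//.
Qed.

Lemma cint_bound f (M : R) : bmf f -> (forall x, normc (f x) <= M) ->
  normc (cint nu f) <= M * mass.
Proof.
move=> hf fM; rewrite (le_trans (le_cint_normc hf))// -Rintegral_cst//.
apply: le_Rintegral => //.
- have := bmf_intRe (bmf_normc hf); exact.
- exact: (bmf_intRe (bmf_cst T M%:C)).
Qed.

Lemma cint_cvg (F : nat -> T -> C) f (M : R) :
  (forall n, bmf (F n)) -> (forall n x, normc (F n x) <= M) ->
  (forall x, F ^~ x @ \oo --> f x) ->
  (fun n => cint nu (F n)) @ \oo --> cint nu f.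
Proof.
move=> mF FM Ff; have mf := bmf_lim mF FM Ff.
have key (p : C -> R) : (forall z, `|p z| <= normc z) ->
    (forall n, measurable_fun setT (fun x => p (F n x))) ->
    measurable_fun setT (fun x => p (f x)) ->
    nu.-integrable setT (EFin \o (fun x => p (f x))) ->
    (forall n, nu.-integrable setT (EFin \o (fun x => p (F n x)))) ->
    (forall x, (fun n => p (F n x)) @ \oo --> p (f x)) ->
    (fun n => \int[nu]_v p (F n v)) @ \oo --> \int[nu]_v p (f v).
  move=> pn mpF mpf ipf ipF cp.
  apply: fine_cvg; rewrite fineK; last exact: integrable_fin_num.
  have [] := @dominated_convergence _ T R nu setT measurableT
    (fun n x => (p (F n x))%:E) (fun x => (p (f x))%:E) (fun=> M%:E) => //.
  - by move=> n; exact/measurable_EFinP.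
  - exact/measurable_EFinP.
  - apply: aeW => x _; apply/fine_cvgP; split; first exact: nearW.
    exact: cp.
  - exact: (bmf_intRe (bmf_cst T M%:C)).
  - by apply: aeW => x n _; rewrite lee_fin (le_trans (pn _)).
have [cR cI _] := mf; apply: cvgc_ReIm.
  rewrite Re_cint; under eq_fun do rewrite Re_cint.
  apply: (key _ (@normc_Re R)) => //.
  - by move=> n; case: (mF n).
  - exact: bmf_intRe.
  - by move=> n; exact: bmf_intRe.
  - by move=> x; exact: cvgc_Re.
rewrite Im_cint; under eq_fun do rewrite Im_cint.
apply: (key _ (@normc_Im R)) => //.
- by move=> n; case: (mF n).
- exact: bmf_intIm.
- by move=> n; exact: bmf_intIm.
- by move=> x; exact: cvgc_Im.
Qed.

Lemma measurable_Rintegral_param d' (X : measurableType d') (f : X * T -> R) (M : R) :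
  measurable_fun setT f -> (forall p, `|f p| <= M) ->
  measurable_fun setT (fun x => \int[nu]_v f (x, v)).
Proof.
move=> mf fM.
have fi x : nu.-integrable setT (EFin \o (fun v => f (x, v))).
  apply: measurable_bounded_integrable => //.
  - by rewrite ltey_eq fin_num_measure.
  - exact: measurableT_comp mf (pair1_measurable _).
  by exists M; split; [exact: num_real | move=> y My v _ /=; rewrite (le_trans (fM _))// ltW].
(* Adding [M] makes the integrand nonnegative, as measurability through Tonelli's theorem
   requires. *)
have -> : (fun x => \int[nu]_v f (x, v)) =
    (fun x => fine (\int[nu]_v (f (x, v) + M)%:E) - M * mass).
  apply/funext => x; rewrite -[fine _]/(\int[nu]_v (f (x, v) + M)).
  rewrite RintegralD ?Rintegral_cst ?addrK//.
  exact: (bmf_intRe (bmf_cst T M%:C)).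
apply: measurable_funB; last exact: measurable_cst.
apply: (@measurableT_comp _ _ _ _ _ _ (@fine R)); first exact: fine_measurable.
apply: (@measurable_fun_fubini_tonelli_F _ _ _ _ _ nu (fun p => (f p + M)%:E)).
  by apply/measurable_EFinP; apply: measurable_funD => //; exact: measurable_cst.
move=> p /=; rewrite lee_fin -lerBlDr sub0r.
by have := fM p; rewrite ler_norml => /andP[].
Qed.

Lemma bmf_cint d' (X : measurableType d') (F : X * T -> C) : bmf F ->
  bmf (fun x => cint nu (fun v => F (x, v))).
Proof.
move=> mF; have [a b [M hM]] := mF; split.
- under eq_fun do rewrite Re_cint.
  apply: (@measurable_Rintegral_param _ _ (fun p => Re (F p)) M) => // p.
  exact: le_trans (normc_Re _) (hM _).
- under eq_fun do rewrite Im_cint.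
  apply: (@measurable_Rintegral_param _ _ (fun p => Im (F p)) M) => // p.
  exact: le_trans (normc_Im _) (hM _).
- exists (M * mass) => x; apply: cint_bound => //.
  exact: bmf_comp (pair1_measurable _) mF.
Qed.

End cint.

Section cint_fubini.
Variable R : realType.
Local Notation C := R[i].
Context d1 d2 (T1 : measurableType d1) (T2 : measurableType d2).
Variables (nu1 : {finite_measure set T1 -> \bar R}) (nu2 : {finite_measure set T2 -> \bar R}).

Lemma Rintegral_fubini (f : T1 * T2 -> R) (M : R) :
  measurable_fun setT f -> (forall p, `|f p| <= M) ->
  \int[nu1]_x \int[nu2]_y f (x, y) = \int[nu2]_y \int[nu1]_x f (x, y).
Proof.
move=> mf fM; rewrite /Rintegral.
have fin (d : measure_display) (T : measurableType d) (nu : {finite_measure set T -> \bar R}) (h : T -> R) :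
    measurable_fun setT h -> (forall p, `|h p| <= M) -> (\int[nu]_x (h x)%:E)%E \is a fin_num.
  move=> mh hM; apply: integrable_fin_num => //; apply: measurable_bounded_integrable => //.
    by rewrite ltey_eq fin_num_measure.
  by exists M; split; [exact: num_real | move=> y My v _ /=; rewrite (le_trans (hM _))// ltW].
congr fine.
transitivity (\int[nu1]_x \int[nu2]_y (f (x, y))%:E)%E.
  apply: eq_integral => x _; rewrite fineK//; apply: fin => //.
  exact: measurableT_comp mf (pair1_measurable _).
transitivity (\int[nu2]_y \int[nu1]_x (f (x, y))%:E)%E; last first.
  apply: eq_integral => x _; rewrite fineK//; apply: fin => //.
  exact: measurableT_comp mf (pair2_measurable _).
apply: (@Fubini _ _ _ _ _ nu1 nu2 (EFin \o f)).
apply: measurable_bounded_integrable => //.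
  have := @product_measure1E _ _ _ _ _ nu1 nu2 _ _ measurableT measurableT.
  by rewrite setXTT /= => ->; rewrite ltey_eq fin_numM// fin_num_measure.
by exists M; split; [exact: num_real | move=> y My v _ /=; rewrite (le_trans (fM _))// ltW].
Qed.

Lemma cint_fubini (F : T1 * T2 -> C) : bmf F ->
  cint nu1 (fun x => cint nu2 (fun y => F (x, y))) =
  cint nu2 (fun y => cint nu1 (fun x => F (x, y))).
Proof.
move=> [a b [M hM]]; apply: eqcP; rewrite ?Re_cint ?Im_cint.
- transitivity (\int[nu1]_x \int[nu2]_y Re (F (x, y))).
    by apply: eq_Rintegral => x _; rewrite Re_cint.
  rewrite (@Rintegral_fubini (fun p => Re (F p)) M) => //.
    by apply: eq_Rintegral => x _; rewrite Re_cint.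
  by move=> p; exact: le_trans (normc_Re _) (hM _).
- transitivity (\int[nu1]_x \int[nu2]_y Im (F (x, y))).
    by apply: eq_Rintegral => x _; rewrite Im_cint.
  rewrite (@Rintegral_fubini (fun p => Im (F p)) M) => //.
    by apply: eq_Rintegral => x _; rewrite Im_cint.
  by move=> p; exact: le_trans (normc_Im _) (hM _).
Qed.

End cint_fubini.

(** The hypothesis is positivity of a Hermitian form on [x + c y], with [a] and [b] its values at
    [x] and [y] and [h] the mixed term; multiples [c = t h] with [t] real reduce it to a quadratic
    polynomial in [t]. It is applied to the inner product and to the form of a positive kernel. *)
Lemma cauchy_schwarz_disc (R : realType) (a b : R) (h : R[i]) : 0 <= b ->
  (forall c : R[i], 0 <= a + (Re (c^* * h)) *+ 2 + normc c ^+ 2 * b) ->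
  normc h ^+ 2 <= a * b.
Proof.
move=> b0 H.
have hh : h^* * h = (normc h ^+ 2)%:C by rewrite mulrC mulcJ.
have {H}H (t : R) : 0 <= a + (t * normc h ^+ 2) *+ 2 + t ^+ 2 * normc h ^+ 2 * b.
  have := H (t%:C * h); rewrite cconjM cconj_real -mulrA hh -rmorphM Re_real.
  by rewrite normcM normc_real exprMn real_normK ?num_real.
set n := normc h ^+ 2 in H *.
have n0 : 0 <= n by rewrite sqr_ge0.
(* For [b = 0] the polynomial is affine and at [t = - (a + 1) / n] would be [- a - 2 < 0]. Otherwise
   [t = - 1 / b] is its minimiser. *)
have [b_eq0|bn0] := eqVneq b 0.
  rewrite b_eq0 mulr0; have := H (- (a + 1) / n); have := H 0.
  rewrite b_eq0 !mulr0 !addr0 mul0r mul0rn addr0 => a0.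
  have [->//|nn0] := eqVneq n 0.
  by rewrite divfK// => h1; exfalso; move: h1; rewrite mulr2n; lra.
have bp : 0 < b by rewrite lt_def bn0.
have := H (- b^-1).
have -> : a + (- b^-1 * n) *+ 2 + (- b^-1) ^+ 2 * n * b = a - n / b.
  by rewrite mulr2n; field.
by rewrite subr_ge0 ler_pdivrMr.
Qed.

(** * Integral operators with bounded Hermitian kernels *)

Section kernel.
Variable R : realType.
Local Notation C := R[i].
Context d (T : measurableType d) (nu : {finite_measure set T -> \bar R}).
Implicit Types (f g h : T -> C) (K : T -> T -> C).

Definition ip f g : C := cint nu (fun x => f x * (g x)^*).
Definition nrm2 f : R := Re (ip f f).
Definition Kop K f (z : T) : C := cint nu (fun v => K z v * f v).
Definition bmker K := bmf (fun p : T * T => K p.1 p.2).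
Definition qf K f : R := Re (ip (Kop K f) f).
Definition good K := [/\ bmker K, (forall z w, K w z = (K z w)^*) &
  forall f, bmf f -> 0 <= qf K f].

Lemma bmker_col K w : bmker K -> bmf (K ^~ w).
Proof.
move=> mK; have := bmf_comp (pair2_measurable w) mK.
by apply: bmf_ext.
Qed.

Lemma bmker_row K z : bmker K -> bmf (K z).
Proof.
move=> mK; have := bmf_comp (pair1_measurable z) mK.
by apply: bmf_ext.
Qed.

Lemma bmf_fst d2 (T2 : measurableType d2) f : bmf f -> bmf (fun p : T * T2 => f p.1).
Proof. by move=> h; exact: bmf_comp measurable_fst h. Qed.

Lemma bmf_snd d2 (T2 : measurableType d2) f : bmf f -> bmf (fun p : T2 * T => f p.2).
Proof. by move=> h; exact: bmf_comp measurable_snd h. Qed.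

Lemma bmf_Kop K f : bmker K -> bmf f -> bmf (Kop K f).
Proof.
move=> mK mf; apply: (@bmf_cint _ _ _ nu _ _ (fun p : T * T => K p.1 p.2 * f p.2)).
by apply: bmfM => //; exact: bmf_snd.
Qed.

End kernel.

Ltac bmf_hyp := match goal with H : bmf ?f |- bmf ?g => constr_eq f g; exact H end.
Ltac bm := solve [repeat first [ bmf_hyp | apply: bmf_cst
  | apply: bmfB | apply: bmfD | apply: bmfN | apply: bmfJ | apply: bmfM
  | apply: bmf_Kop | apply: bmf_fst | apply: bmf_snd | apply: bmker_col | apply: bmker_row
  | assumption ] ].

Section ip_theory.
Variable R : realType.
Local Notation C := R[i].
Context d (T : measurableType d) (nu : {finite_measure set T -> \bar R}).
Implicit Types (f g h : T -> C) (K : T -> T -> C).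
Local Notation ip := (ip nu).
Local Notation nrm2 := (nrm2 nu).
Local Notation Kop := (Kop nu).
Local Notation qf := (qf nu).
Local Notation good := (good nu).

Lemma ipDl f g h : bmf f -> bmf g -> bmf h ->
  ip (fun x => f x + g x) h = ip f h + ip g h.
Proof.
by move=> mf mg mh; rewrite /ip -cintD; [|bm|bm]; apply: eq_cint => x; rewrite mulrDl.
Qed.

Lemma ipZl c f h : bmf f -> bmf h -> ip (fun x => c * f x) h = c * ip f h.
Proof.
by move=> mf mh; rewrite /ip -cintZ; [|bm]; apply: eq_cint => x; rewrite mulrA.
Qed.

Lemma ipC f g : bmf f -> bmf g -> ip g f = (ip f g)^*.
Proof.
move=> mf mg; rewrite /ip -cintJ; last bm.
by apply: eq_cint => x; rewrite cconjM cconjK mulrC.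
Qed.

Lemma ipDr f g h : bmf f -> bmf g -> bmf h ->
  ip h (fun x => f x + g x) = ip h f + ip h g.
Proof.
move=> mf mg mh; rewrite ipC; [|bm|bm]; rewrite ipDl// cconjD.
by rewrite -!ipC.
Qed.

Lemma ipZr c f h : bmf f -> bmf h -> ip h (fun x => c * f x) = c^* * ip h f.
Proof.
move=> mf mh; rewrite ipC; [|bm|bm]; rewrite ipZl// cconjM.
by rewrite -ipC.
Qed.

Lemma ipBl f g h : bmf f -> bmf g -> bmf h ->
  ip (fun x => f x - g x) h = ip f h - ip g h.
Proof.
move=> mf mg mh; under [in LHS]eq_fun do rewrite -mulN1r.
by rewrite ipDl ?ipZl ?mulN1r//; bm.
Qed.

Lemma ipBr f g h : bmf f -> bmf g -> bmf h ->
  ip h (fun x => f x - g x) = ip h f - ip h g.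
Proof.
move=> mf mg mh; rewrite ipC; [|bm|bm]; rewrite ipBl// cconjB.
by rewrite -!ipC.
Qed.

Lemma ip_suml (I : Type) (r : seq I) (F : I -> T -> C) h : (forall i, bmf (F i)) -> bmf h ->
  ip (fun x => \sum_(i <- r) F i x) h = \sum_(i <- r) ip (F i) h.
Proof.
move=> mF mh; rewrite /ip -cint_sum; last by move=> i _; apply: bmfM => //; exact: bmfJ.
by apply: eq_cint => x; rewrite mulr_suml.
Qed.

Lemma ip_nrm2 f : bmf f -> ip f f = (nrm2 f)%:C.
Proof.
move=> mf; apply: eqcP => //; rewrite Im_real.
have /(congr1 (@complex.Im R)) := ipC mf mf; rewrite ImJ => /eqP.
by rewrite -subr_eq0 opprK -mulr2n mulrn_eq0 => /eqP.
Qed.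

Lemma nrm2_Re f : nrm2 f = Re (ip f f). Proof. by []. Qed.

Lemma qf_Re K f : qf K f = Re (ip (Kop K f) f). Proof. by []. Qed.

Lemma Kop_cint K f z : Kop K f z = cint nu (fun v => K z v * f v).
Proof. by []. Qed.

Lemma ip_cint f g : ip f g = cint nu (fun x => f x * (g x)^*).
Proof. by []. Qed.

Lemma nrm2E f : nrm2 f = \int[nu]_x (normc (f x) ^+ 2).
Proof.
by rewrite /nrm2 /ip Re_cint; apply: eq_Rintegral => x _; rewrite mulcJ.
Qed.

Lemma nrm2_ge0 f : 0 <= nrm2 f.
Proof. by rewrite nrm2E; apply: Rintegral_ge0 => x _; rewrite sqr_ge0. Qed.

Lemma nrm2_bound f (M : R) : bmf f -> (forall x, normc (f x) ^+ 2 <= M) ->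
  nrm2 f <= M * mass nu.
Proof.
move=> mf fM; rewrite (le_trans (Re_le_normc _))//; apply: cint_bound; first bm.
by move=> x; rewrite mulcJ normc_real ger0_norm ?sqr_ge0.
Qed.

Lemma nrm2Z c f : bmf f -> nrm2 (fun x => c * f x) = normc c ^+ 2 * nrm2 f.
Proof.
move=> mf; rewrite /nrm2 ipZl; [|bm|bm]; rewrite ipZr// mulrA mulcJ.
by rewrite ip_nrm2// -rmorphM.
Qed.

Lemma nrm2D f g : bmf f -> bmf g ->
  nrm2 (fun x => f x + g x) = nrm2 f + Re (ip f g) *+ 2 + nrm2 g.
Proof.
move=> mf mg; rewrite /nrm2 ipDl; [|bm..]; rewrite !ipDr// !ReImE (ipC mf mg) ReJ.
by rewrite mulr2n; ring.
Qed.

Lemma nrm2B f g : bmf f -> bmf g ->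
  nrm2 (fun x => f x - g x) = nrm2 f - Re (ip f g) *+ 2 + nrm2 g.
Proof.
move=> mf mg; rewrite /nrm2 ipBl; [|bm..]; rewrite !ipBr// !ReImE (ipC mf mg) ReJ.
by rewrite mulr2n; ring.
Qed.

Lemma cauchy_schwarz f g : bmf f -> bmf g ->
  normc (ip f g) ^+ 2 <= nrm2 f * nrm2 g.
Proof.
move=> mf mg; apply: cauchy_schwarz_disc (nrm2_ge0 _) _ => c.
have := nrm2_ge0 (fun x => f x + c * g x).
by rewrite nrm2D; [|bm..]; rewrite nrm2Z// ipZr.
Qed.

Lemma KopD K f g : bmker K -> bmf f -> bmf g ->
  Kop K (fun x => f x + g x) = fun z => Kop K f z + Kop K g z.
Proof.
move=> mK mf mg; apply/funext => z; rewrite /Kop -cintD; [|bm..].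
by apply: eq_cint => x; rewrite mulrDr.
Qed.

Lemma KopZ K c f : bmker K -> bmf f ->
  Kop K (fun x => c * f x) = fun z => c * Kop K f z.
Proof.
move=> mK mf; apply/funext => z; rewrite /Kop -cintZ; [|bm].
by apply: eq_cint => x; rewrite mulrCA.
Qed.

Lemma KopB K f g : bmker K -> bmf f -> bmf g ->
  Kop K (fun x => f x - g x) = fun z => Kop K f z - Kop K g z.
Proof.
move=> mK mf mg; apply/funext => z; rewrite /Kop -cintB; [|bm..].
by apply: eq_cint => x; rewrite mulrBr.
Qed.

Lemma Kop_adj K f g : good K -> bmf f -> bmf g -> ip (Kop K f) g = ip f (Kop K g).
Proof.
move=> [mK hK _] mf mg; rewrite /ip.
transitivity (cint nu (fun x => cint nu (fun y => K x y * f y * (g x)^*))).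
  by apply: eq_cint => x; rewrite -cintZr//; bm.
rewrite (@cint_fubini _ _ _ _ _ nu nu (fun p => K p.1 p.2 * f p.2 * (g p.1)^*)); last bm.
apply: eq_cint => y; rewrite /Kop -cintJ; last bm.
rewrite -cintZ; last bm.
by apply: eq_cint => x /=; rewrite cconjM -hK; ring.
Qed.

Lemma KopE K f z : good K -> Kop K f z = ip f (K ^~ z).
Proof. by move=> [_ hK _]; apply: eq_cint => x; rewrite -hK mulrC. Qed.

Lemma qfE K f : good K -> bmf f -> ip (Kop K f) f = (qf K f)%:C.
Proof.
move=> gK mf; have [mK _ _] := gK; apply: eqcP => //; rewrite Im_real.
have /(congr1 (@complex.Im R)) := Kop_adj gK mf mf.
rewrite (@ipC (Kop K f) f); [|bm|bm]; rewrite ImJ => /eqP.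
by rewrite -subr_eq0 opprK -mulr2n mulrn_eq0 => /eqP.
Qed.

Lemma Kcauchy_schwarz K f g : good K -> bmf f -> bmf g ->
  normc (ip (Kop K f) g) ^+ 2 <= qf K f * qf K g.
Proof.
move=> gK mf mg; have [mK hK pK] := gK; apply: cauchy_schwarz_disc => [|c]; first exact: pK.
have := pK (fun x => f x + c * g x); rewrite /qf KopD; [|bm..]; rewrite KopZ//.
move/(_ ltac:(bm)); rewrite ipDl; [|bm..]; rewrite !ipDr; [|bm..].
rewrite !ipZl; [|bm..]; rewrite !ipZr; [|bm..].
rewrite (Kop_adj gK mg mf) (@ipC (Kop K f) g); [|bm..].
rewrite !ReD -/(qf K f) (qfE gK mg) mulrA mulcJ -rmorphM Re_real.
rewrite -[c * _]cconjK ReJ cconjM cconjK mulr2n => h.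
by apply: le_trans h _; rewrite !addrA.
Qed.

Definition kbound K : R := Num.max 0 (sup [set nrm2 (K ^~ z) | z in setT]).

Lemma nrm2_col K z : bmker K -> nrm2 (K ^~ z) <= kbound K.
Proof.
move=> mK; rewrite /kbound le_max; apply/orP; right.
apply: ub_le_sup; last by exists z.
have [_ _ [M hM]] := mK; exists (M ^+ 2 * mass nu) => _ [w _ <-].
apply: nrm2_bound; first bm.
move=> x; rewrite ler_sqr ?nnegrE ?normc_ge0//; first exact: (hM (x, w)).
exact: le_trans (normc_ge0 _) (hM (x, w)).
Qed.

Lemma kbound_ge0 K : 0 <= kbound K.
Proof. by rewrite le_max lexx. Qed.

(** One application of [K] turns a bound in L^2 into a bound at every point; this is how convergence
    in mean of iterates becomes pointwise convergence. *)
Lemma Kop_pointwise K f z : good K -> bmf f ->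
  normc (Kop K f z) ^+ 2 <= kbound K * nrm2 f.
Proof.
move=> gK mf; have [mK _ _] := gK; rewrite KopE// (le_trans (cauchy_schwarz _ _))//; first bm.
by rewrite mulrC ler_wpM2r ?nrm2_ge0// nrm2_col.
Qed.

Lemma nrm2_Kop K f : good K -> bmf f -> nrm2 (Kop K f) <= kbound K * mass nu * nrm2 f.
Proof.
move=> gK mf; have [mK _ _] := gK; rewrite mulrAC; apply: nrm2_bound; first bm.
by move=> x; exact: Kop_pointwise.
Qed.

(** This bounds the Rayleigh quotients and shows that the form vanishes with the norm. The [+ 1]
    replaces a square root: [A <= (A + 1)^2] for [A >= 0]. *)
Lemma qf_bound K f : good K -> bmf f -> qf K f <= (kbound K * mass nu + 1) * nrm2 f.
Proof.
move=> gK mf; have [mK _ pK] := gK.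
have A0 : 0 <= kbound K * mass nu by rewrite mulr_ge0 ?kbound_ge0 ?mass_ge0.
have N0 := nrm2_ge0 f.
rewrite -ler_sqr ?nnegrE ?pK//; last by rewrite mulr_ge0// addr_ge0.
apply: (@le_trans _ _ (normc (ip (Kop K f) f) ^+ 2)).
  by rewrite ler_sqr ?nnegrE ?normc_ge0 ?pK// Re_le_normc.
apply: (le_trans (cauchy_schwarz _ _)) => //; first bm.
apply: (@le_trans _ _ (kbound K * mass nu * nrm2 f * nrm2 f)).
  by rewrite ler_wpM2r// nrm2_Kop.
rewrite exprMn -mulrA -expr2 ler_wpM2r ?sqr_ge0//.
rewrite sqrrD1; have : 0 <= (kbound K * mass nu) ^+ 2 by rewrite sqr_ge0.
move: A0; rewrite mulr2n; lra.
Qed.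

End ip_theory.

#[global] Opaque ip nrm2 Kop qf kbound.

(** * Spectral theorem by power iteration and deflation *)

Section power_iteration.
Variable R : realType.
Local Notation C := R[i].
Context d (T : measurableType d) (nu : {finite_measure set T -> \bar R}).
Implicit Types (f g h : T -> C).
Local Notation ip := (ip nu).
Local Notation nrm2 := (nrm2 nu).
Local Notation Kop := (Kop nu).
Local Notation qf := (qf nu).
Local Notation good := (good nu).
Local Notation kbound := (kbound nu).
Variables (K : T -> T -> C) (gK : good K).

Let mK : bmker K. Proof. by case: gK. Qed.

(** The maximum with 0 gives nonnegativity without asking whether some function has positive
    norm. *)
Definition rayleigh : R :=
  Num.max 0 (sup [set r | exists g, [/\ bmf g, 0 < nrm2 g & r = qf K g / nrm2 g]]).

Lemma rayleigh_ge0 : 0 <= rayleigh. Proof. by rewrite le_max lexx. Qed.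

Lemma qf_le g : bmf g -> qf K g <= rayleigh * nrm2 g.
Proof.
move=> mg; have [n0|n0] := leP (nrm2 g) 0.
  have nE : nrm2 g = 0 by apply/eqP; rewrite eq_le n0 nrm2_ge0.
  by have := qf_bound gK mg; rewrite nE !mulr0.
rewrite -ler_pdivrMr// le_max; apply/orP; right; apply: ub_le_sup; last by exists g.
exists (kbound K * mass nu + 1) => _ [h [mh h0 ->]].
by rewrite ler_pdivrMr// qf_bound.
Qed.

Lemma rayleigh_approx (r : R) : r < rayleigh -> 0 <= r ->
  exists g, [/\ bmf g, 0 < nrm2 g & r * nrm2 g < qf K g].
Proof.
move=> rl r0; set S := [set r | exists g, [/\ bmf g, 0 < nrm2 g & r = qf K g / nrm2 g]].
have rS : r < sup S by move: rl; rewrite /rayleigh lt_max ltNge r0.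
have S0 : S !=set0.
  apply/set0P/eqP => S0; move: rS; rewrite S0 sup0 => h.
  by have := lt_le_trans h r0; rewrite ltxx.
have [||_ [g [mg g0 ->]] h] := @sup_adherent R S (sup S - r).
- by rewrite subr_gt0.
- split => //; exists (kbound K * mass nu + 1) => _ [h [mh h0 ->]].
  by rewrite ler_pdivrMr// qf_bound.
- exists g; split => //; rewrite -ltr_pdivlMr//.
  by move: h; rewrite opprB addrCA subrr addr0.
Qed.

(** Cauchy-Schwarz for the form of [K] at [g] and [K g] bounds [|K g|^4] by the product of the forms
    at [g] and at [K g]; the latter is at most [rayleigh * |K g|^2], and a factor [|K g|^2]
    cancels. *)
Lemma nrm2_Kop_le g : bmf g -> nrm2 (Kop K g) <= rayleigh * qf K g.
Proof.
move=> mg; have mKg : bmf (Kop K g) by bm.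
have q0 : 0 <= qf K g by case: gK => _ _; exact.
have := Kcauchy_schwarz gK mg mKg; rewrite ip_nrm2// normc_real.
rewrite ger0_norm ?nrm2_ge0//; have := qf_le mKg.
have [->|n0] := eqVneq (nrm2 (Kop K g)) 0; first by rewrite mulr_ge0 ?rayleigh_ge0.
have np : 0 < nrm2 (Kop K g) by rewrite lt_def n0 nrm2_ge0.
move: np q0; move: (nrm2 (Kop K g)) (qf K g) (qf K (Kop K g)) rayleigh.
move=> a b c l np q0 h1 h2; rewrite -(ler_pM2r np) -expr2; apply: (le_trans h2).
by rewrite (mulrC l) -mulrA ler_wpM2l.
Qed.

Variable lam_gt0 : 0 < rayleigh.
Local Notation lam := rayleigh.

(* [Aop] is [K] normalised by its largest Rayleigh quotient: [amom n g] then decreases in [n] and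
   the iterates [Apow n g] converge to a top eigenfunction whenever its limit is positive. *)
Definition Aop f : T -> C := fun z => (lam^-1)%:C * Kop K f z.
Definition Apow n f : T -> C := iter n Aop f.

Lemma bmf_Aop f : bmf f -> bmf (Aop f).
Proof. by move=> mf; rewrite /Aop; bm. Qed.

Lemma bmf_Apow n f : bmf f -> bmf (Apow n f).
Proof. by move=> mf; elim: n => //= n IH; exact: bmf_Aop. Qed.

Lemma Aop_adj f g : bmf f -> bmf g -> ip (Aop f) g = ip f (Aop g).
Proof.
move=> mf mg; rewrite /Aop ipZl; [|bm..]; rewrite ipZr; [|bm..].
by rewrite cconj_real Kop_adj.
Qed.

Lemma Apow_adj n m f g : bmf f -> bmf g -> ip (Apow (n + m) f) g = ip (Apow n f) (Apow m g).
Proof.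
elim: m g => [|m IH] g mf mg; first by rewrite addn0.
rewrite addnS [Apow m.+1 g]iterSr -IH//; last exact: bmf_Aop.
by rewrite -Aop_adj//; exact: bmf_Apow.
Qed.

(** The [n]-th moment of the spectral measure of [g], carried by [[0, 1]]. Nonnegativity,
    monotonicity and convexity in [n] are proved below by algebra alone, ahead of any spectral
    theorem. *)
Definition amom n g : R := Re (ip (Apow n g) g).

Lemma ip_Apow n m g : bmf g -> Re (ip (Apow n g) (Apow m g)) = amom (n + m) g.
Proof. by move=> mg; rewrite /amom Apow_adj. Qed.

Lemma nrm2_Apow n g : bmf g -> nrm2 (Apow n g) = amom n.*2 g.
Proof. by move=> mg; rewrite nrm2_Re ip_Apow// addnn. Qed.

Lemma qf_Apow n g : bmf g -> lam^-1 * qf K (Apow n g) = amom n.*2.+1 g.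
Proof.
move=> mg; have mA := bmf_Apow n mg.
rewrite -addnn -addSn -ip_Apow//.
rewrite -[Apow n.+1 g]/(fun z => (lam^-1)%:C * Kop K (Apow n g) z) ipZl; [|bm..].
by rewrite qfE// -rmorphM Re_real.
Qed.

(** Even moments are squared norms and odd ones are values of the form of [K]; the same parity split
    gives monotonicity. *)
Lemma amom_ge0 n g : bmf g -> 0 <= amom n g.
Proof.
move=> mg; rewrite -(odd_double_half n); case: odd; rewrite ?add0n ?add1n.
  rewrite -qf_Apow// mulr_ge0// ?invr_ge0 ?rayleigh_ge0//.
  by case: gK => _ _; apply; exact: bmf_Apow.
by rewrite -nrm2_Apow// nrm2_ge0.
Qed.

Lemma amom_noninc n g : bmf g -> amom n.+1 g <= amom n g.
Proof.
move=> mg; have mA := bmf_Apow n./2 mg.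
rewrite -(odd_double_half n); case: odd; rewrite ?add0n ?add1n.
  rewrite -doubleS -nrm2_Apow// -qf_Apow// /= /Aop nrm2Z; last bm.
  rewrite normc_real ger0_norm ?invr_ge0 ?rayleigh_ge0// expr2 -mulrA.
  rewrite ler_wpM2l ?invr_ge0 ?rayleigh_ge0// ler_pdivrMl//.
  exact: nrm2_Kop_le.
by rewrite -qf_Apow// -nrm2_Apow// ler_pdivrMl// qf_le.
Qed.

Lemma Aop_B f g : bmf f -> bmf g ->
  Aop (fun x => f x - g x) = fun x => Aop f x - Aop g x.
Proof.
by move=> mf mg; rewrite /Aop KopB//; apply/funext => z; rewrite mulrBr.
Qed.

Lemma Apow_B n f g : bmf f -> bmf g ->
  Apow n (fun x => f x - g x) = fun x => Apow n f x - Apow n g x.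
Proof.
by move=> mf mg; elim: n => //= n ->; rewrite Aop_B//; exact: bmf_Apow.
Qed.

Lemma AopE f : Aop f = fun z => (lam^-1)%:C * Kop K f z. Proof. by []. Qed.

Lemma ApowS n f : Apow n.+1 f = Aop (Apow n f). Proof. by []. Qed.

Opaque Aop.

(** This is nonnegativity of the [n]-th moment of [g - A g], that is, of the integral of
    [x^n (1 - x)^2]. *)
Lemma amom_convex n g : bmf g ->
  amom n.+1 g - amom n.+2 g <= amom n g - amom n.+1 g.
Proof.
move=> mg; have mh : bmf (fun x => g x - Aop g x) by apply: bmfB => //; exact: bmf_Aop.
have := amom_ge0 n mh; rewrite /amom Apow_B; [|exact: mg|exact: bmf_Aop].
have [[mA1 mA2] mA3] := (bmf_Apow n mg, bmf_Aop mg, bmf_Apow n (bmf_Aop mg)).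
have e1 : ip (Apow n (Aop g)) g = ip (Apow n.+1 g) g by rewrite /Apow iterSr.
have e2 : ip (Apow n g) (Aop g) = ip (Apow n.+1 g) g.
  exact/esym/(Aop_adj mA1 mg).
have e3 : ip (Apow n (Aop g)) (Aop g) = ip (Apow n.+2 g) g.
  have e0 : Apow n (Aop g) = Apow n.+1 g by rewrite /Apow iterSr.
  by rewrite -(Aop_adj mA3 mg) e0 -ApowS.
rewrite ipBl; [|exact: mA1|exact: mA3|exact: mh].
rewrite ipBr; [|exact: mg|exact: mA2|exact: mA1].
rewrite ipBr; [|exact: mg|exact: mA2|exact: mA3].
rewrite e1 e2 e3 !ReB.
move: (Re _) (Re _) (Re _) => a b c; lra.
Qed.

(** A convex sequence stays above the line through its first two terms. *)
Lemma amom_lin n g : bmf g -> amom 0 g - n%:R * (amom 0 g - amom 1 g) <= amom n g.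
Proof.
move=> mg.
have dec k : amom k g - amom k.+1 g <= amom 0 g - amom 1 g.
  by elim: k => // k IH; apply: le_trans IH; exact: amom_convex.
elim: n => [|n IH]; first by rewrite mul0r subr0.
by have := dec n; rewrite -natr1 mulrDl mul1r; lra.
Qed.

(** In spectral terms, the squared norm of the projection of the column at [w] onto the top
    eigenspace. *)
Definition ainf w : R := limn (fun n => amom n (K ^~ w)).

Lemma amom_cvg w : (fun n => amom n (K ^~ w)) @ \oo --> ainf w.
Proof.
have mw : bmf (K ^~ w) by bm.
apply: nonincreasing_is_cvgn.
  by apply/nonincreasing_seqP => n; exact: amom_noninc.
by exists 0 => _ [n _ <-]; exact: amom_ge0.
Qed.

Lemma amom_le0 n g : bmf g -> amom n g <= nrm2 g.
Proof.
by move=> mg; elim: n => // n IH; rewrite (le_trans (amom_noninc _ _)).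
Qed.

Lemma ainf_ge0 w : 0 <= ainf w.
Proof.
rewrite /ainf; apply: limr_ge; first exact: cvgP (@amom_cvg w).
by apply: nearW => n; apply: amom_ge0; bm.
Qed.

(* Otherwise [Apow n (K g)] tends to 0 pointwise for all [g], by bounded convergence, which
   contradicts the maximality of the Rayleigh quotient. *)
Lemma amom_sup : exists w, 0 < ainf w.
Proof.
apply/not_existsP => H.
have a0 w : ainf w = 0.
  by apply/eqP; rewrite eq_le ainf_ge0 andbT leNgt; exact/negP.
(* Joint measurability in the column index and the point is what allows the moments to be integrated
   over [w]. *)
have mAK n : bmf (fun w => (amom n.*2 (K ^~ w))%:C : C).
  have mF : bmf (fun p : T * T => Apow n (K ^~ p.1) p.2).
    elim: n => [|n IH].
      apply: (@bmf_comp _ _ _ _ _ (fun p : T * T => (p.2, p.1)) (fun p => K p.1 p.2)) => //.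
      exact: measurable_swap.
    apply: (bmf_ext (f := fun p : T * T => (lam^-1)%:C *
        cint nu (fun v => K p.2 v * Apow n (K ^~ p.1) v))) => [p|].
      by rewrite ApowS AopE Kop_cint.
    apply: bmfZ; apply: (@bmf_cint _ _ _ nu _ _ (fun q : (T * T) * T =>
       K q.1.2 q.2 * Apow n (K ^~ q.1.1) q.2)).
    apply: bmfM.
      apply: (@bmf_comp _ _ _ _ _ (fun q : (T * T) * T => (q.1.2, q.2)) (fun p => K p.1 p.2)) => //.
      apply: measurable_fun_pair => //; exact: measurableT_comp.
    apply: (@bmf_comp _ _ _ _ _ (fun q : (T * T) * T => (q.1.1, q.2)) _ _ IH).
    apply: measurable_fun_pair => //; exact: measurableT_comp.
  apply: (bmf_ext (f := fun w => cint nu (fun z =>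
      Apow n (K ^~ w) z * (Apow n (K ^~ w) z)^*))) => [w|].
    have mw : bmf (K ^~ w) by bm.
    by rewrite -ip_cint ip_nrm2 ?nrm2_Apow//; exact: bmf_Apow.
  apply: (@bmf_cint _ _ _ nu _ _ (fun p : T * T => Apow n (K ^~ p.1) p.2 * (Apow n (K ^~ p.1) p.2)^*)).
  by apply: bmfM => //; exact: bmfJ.
pose eta n := \int[nu]_w amom n.*2 (K ^~ w).
have etaE n : cint nu (fun w => (amom n.*2 (K ^~ w))%:C) = (eta n)%:C by exact: cint_real.
have eta0 : eta @ \oo --> (0 : R).
  apply/cvgc_realP; under eq_fun do rewrite -etaE.
  have -> : (0 : R)%:C = cint nu (fun=> 0) by rewrite cint0.
  apply: (@cint_cvg _ _ _ _ _ _ (kbound K)) => //.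
    move=> n w; rewrite normc_real ger0_norm ?amom_ge0//; last bm.
    by rewrite (le_trans (amom_le0 _ _)) ?nrm2_col//; bm.
  move=> w; apply/cvgc_realP; rewrite -(a0 w); have := @amom_cvg w.
  by move/cvgrPdist_lt => h; apply/cvgrPdist_lt => e /h [N _ hN]; exists N => // n /= Nn;
    apply: hN => /=; rewrite (leq_trans Nn)// -addnn leq_addr.
(* At each [z], the value of [A^(n+1) g] is the inner product of [g] with [A^n] of the column at
   [z], divided by [lam]. Cauchy-Schwarz and integration over [z] then bound a moment of any [g] by
   the integrated moments of the columns. *)
have key n g : bmf g -> amom n.*2.+2 g <= eta n / lam ^+ 2 * nrm2 g.
  move=> mg; have mAg := bmf_Apow n.+1 mg.
  rewrite -doubleS -nrm2_Apow// nrm2E.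
  have pw z : normc (Apow n.+1 g z) ^+ 2 <= lam ^- 2 * nrm2 g * amom n.*2 (K ^~ z).
    have mz : bmf (K ^~ z) by bm.
    rewrite ApowS AopE normcM exprMn normc_real ger0_norm ?invr_ge0 ?rayleigh_ge0//.
    rewrite exprVn -mulrA ler_wpM2l ?invr_ge0 ?sqr_ge0// KopE//.
    have -> : ip (Apow n g) (K ^~ z) = ip g (Apow n (K ^~ z)) := Apow_adj 0 n mg mz.
    apply: (le_trans (cauchy_schwarz _ mg (bmf_Apow n mz))).
    by rewrite nrm2_Apow.
  apply: (@le_trans _ _ (\int[nu]_z (lam ^- 2 * nrm2 g * amom n.*2 (K ^~ z)))).
    apply: le_Rintegral => //.
    - have mA2 : bmf (fun x => Apow n.+1 g x * (Apow n.+1 g x)^*) by apply: bmfM => //; exact: bmfJ.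
      by have := bmf_intRe nu mA2; under eq_fun do rewrite mulcJ.
    - have := bmf_intRe nu (bmfZ (lam ^- 2 * nrm2 g)%:C (mAK n)).
      by under eq_fun do rewrite -rmorphM.
  rewrite RintegralZl//; first by rewrite -/(eta n) mulrAC (mulrC (lam ^- 2)).
  exact: (bmf_intRe nu (mAK n)).
have [n hn] : exists n, eta n / lam ^+ 2 < 2^-1.
  have /cvgrPdist_lt h := eta0; have l2 : 0 < lam ^+ 2 / 2 by rewrite divr_gt0// exprn_gt0.
  have [N _ hN] := h _ l2; exists N.
  rewrite ltr_pdivrMr ?exprn_gt0// mulrC; have := hN N (leqnn N) => /=.
  by rewrite sub0r normrN; apply: le_lt_trans; rewrite ler_norm.
pose m := n.*2.+2.
have m0 : 0 < m%:R :> R by rewrite ltr0n.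
(* A Rayleigh quotient within a relative error [1 / (2 m)] of the supremum keeps the [m]-th moment
   above half of [|g|^2] by convexity, whereas [key] puts it below half. *)
have [g [mg g0 hg]] : exists g, [/\ bmf g, 0 < nrm2 g & (1 - (2 * m%:R)^-1) * lam * nrm2 g < qf K g].
  apply: rayleigh_approx.
    by rewrite gtr_pMl// ltrBlDr ltrDl invr_gt0 mulr_gt0.
  rewrite mulr_ge0// ?rayleigh_ge0// subr_ge0 invf_le1 ?mulr_gt0//.
  by rewrite -natrM ler1n.
have h1 := key n g mg; have h2 := amom_lin m mg.
have a1 : amom 1 g = lam^-1 * qf K g by rewrite -(qf_Apow 0).
have a00 : amom 0 g = nrm2 g by [].
have h3 : (1 - (2 * m%:R)^-1) * nrm2 g < amom 1 g.
  by rewrite a1 ltr_pdivlMl// mulrA (mulrC lam).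
have h4 : m%:R * (amom 0 g - amom 1 g) < nrm2 g / 2.
  have : amom 0 g - amom 1 g < (2 * m%:R)^-1 * nrm2 g by rewrite a00; lra.
  rewrite -(ltr_pM2l m0) => h; apply: lt_le_trans h _.
  rewrite mulrA invfM mulrCA divff ?gt_eqF// mulr1 mulrC //.
have : eta n / lam ^+ 2 * nrm2 g < 2^-1 * nrm2 g by rewrite ltr_pM2r.
rewrite -/m in h1; move: h4 h1 h2; rewrite a00; lra.
Qed.

(** The squared norm of the difference of two iterates is the combination of three moments on the
    right, small once the moments have converged; one further application of [K] makes the estimate
    pointwise. *)
Lemma Apow_cauchy n m f z : bmf f ->
  normc (Apow n.+1 f z - Apow m.+1 f z) ^+ 2 <=
  lam ^- 2 * kbound K * (amom n.*2 f - amom (n + m) f *+ 2 + amom m.*2 f).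
Proof.
move=> mf; have [mn mm] := (bmf_Apow n mf, bmf_Apow m mf).
rewrite -[Apow n.+1 f z - _]/(Aop (Apow n f) z - Aop (Apow m f) z).
have := congr1 (fun h => h z) (Aop_B mn mm) => /= <-.
rewrite AopE normcM exprMn normc_real ger0_norm ?invr_ge0 ?rayleigh_ge0//.
rewrite exprVn -mulrA ler_wpM2l ?invr_ge0 ?sqr_ge0//.
rewrite (le_trans (Kop_pointwise z gK _))//; first by apply: bmfB.
by rewrite ler_wpM2l ?kbound_ge0// nrm2B// ip_Apow// !nrm2_Apow.
Qed.

Lemma Apow_bound n f z : bmf f ->
  normc (Apow n.+1 f z) ^+ 2 <= lam ^- 2 * kbound K * nrm2 f.
Proof.
move=> mf; have mn := bmf_Apow n mf; rewrite ApowS AopE normcM exprMn normc_real.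
rewrite ger0_norm ?invr_ge0 ?rayleigh_ge0//.
rewrite exprVn -mulrA ler_wpM2l ?invr_ge0 ?sqr_ge0//.
rewrite (le_trans (Kop_pointwise z gK _))//.
by rewrite ler_wpM2l ?kbound_ge0// nrm2_Apow// amom_le0.
Qed.

End power_iteration.

Lemma cauchy_cvgc (R : realType) (u : nat -> R[i]) :
  (forall e, 0 < e -> exists N, forall n m, (N <= n)%N -> (N <= m)%N ->
    normc (u n - u m) < e) -> exists l : R[i], u @ \oo --> l.
Proof.
move=> H.
have key (p : R[i] -> R) : (forall z, `|p z| <= normc z) ->
    (forall z w, p (z - w) = p z - p w) -> cvgn (fun n => p (u n)).
  move=> pn pB; apply/cauchy_cvgP; apply: cauchy_exP => e e0.
  have [N hN] := H _ e0; exists (p (u N)); exists N => // n /= Nn.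
  by rewrite /ball/= -pB (le_lt_trans (pn _))// hN.
have cR := key (@complex.Re R) (@normc_Re R) (@ReB R).
have cI := key (@complex.Im R) (@normc_Im R) (@ImB R).
exists (limn (fun n => Re (u n)) +i* limn (fun n => Im (u n))).
by apply: cvgc_ReIm => /=.
Qed.

(** * Top eigenfunction and deflation *)

Section eigen_step.
Variable R : realType.
Local Notation C := R[i].
Context d (T : measurableType d) (nu : {finite_measure set T -> \bar R}).
Implicit Types (f g h : T -> C) (K : T -> T -> C).
Local Notation ip := (ip nu).
Local Notation nrm2 := (nrm2 nu).
Local Notation Kop := (Kop nu).
Local Notation qf := (qf nu).
Local Notation good := (good nu).

(** The iterates of a column whose moments have a positive limit converge at every point; that limit
    is the squared norm of the limit function, which can therefore be normalised. For [lam = 0] the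
    zero function serves as padding. *)
Lemma top_eigenfunction K : good K ->
  exists p : R * (T -> C), let lam := p.1 in let psi := p.2 in
    [/\ 0 <= lam, bmf psi, (forall z, Kop K psi z = lam%:C * psi z),
       (forall g, bmf g -> qf K g <= lam * nrm2 g) &
       if lam == 0 then psi = fun=> 0 else nrm2 psi = 1].
Proof.
move=> gK; have [mK hK pK] := gK.
have [l0|l0] := eqVneq (rayleigh nu K) 0.
  exists (0, fun=> 0) => /=; split => //; last by rewrite eqxx.
  - exact: bmf_cst.
  - move=> z; rewrite mulr0 Kop_cint -[RHS](cint0 nu).
    by apply: eq_cint => x; exact: mulr0.
  - by move=> g mg; rewrite -l0 qf_le.
have lp : 0 < rayleigh nu K by rewrite lt_def l0 rayleigh_ge0.
set lam := rayleigh nu K in l0 lp.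
have [w aw] := amom_sup gK lp.
have mw : bmf (K ^~ w) by bm.
pose F n : T -> C := Apow nu K n.+1 (K ^~ w).
have mF n : bmf (F n) by exact: bmf_Apow.
pose a n := amom nu K n (K ^~ w).
have ac : a @ \oo --> ainf nu K w by exact: (amom_cvg gK lp).
pose Q := lam ^- 2 * kbound nu K.
have Q0 : 0 <= Q by rewrite mulr_ge0 ?kbound_ge0// invr_ge0 sqr_ge0.
have cau z : exists l : C, (F ^~ z) @ \oo --> l.
  apply: cauchy_cvgc => // e e0.
  (* With all three moments within [E = e^2 / (Q + 1) / 4] of their limit, their combination is
     below [4 E], and [Q / (Q + 1) < 1]; the [+ 1] covers [Q = 0]. *)
  have e1 : 0 < e ^+ 2 / (Q + 1) / 4 by rewrite !divr_gt0 ?exprn_gt0// ltr_wpDl.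
  move/cvgrPdist_lt : ac => /(_ _ e1) [N _ hN]; exists N => n m Nn Nm.
  rewrite -(@ltr_pXn2r _ 2) ?nnegrE ?normc_ge0 ?(ltW e0)//.
  apply: le_lt_trans (Apow_cauchy gK _ _ _ _) _ => //.
  set E := _ / 4 in hN.
  have {}hN k : (N <= k)%N -> `|ainf nu K w - a k| < E := hN k.
  have h2 : `|ainf nu K w - a n.*2| < E.
    by apply: hN; rewrite -addnn (leq_trans Nn)// leq_addr.
  have h3 : `|ainf nu K w - a m.*2| < E.
    by apply: hN; rewrite -addnn (leq_trans Nm)// leq_addr.
  have h4 : `|ainf nu K w - a (n + m)%N| < E.
    by apply: hN; rewrite (leq_trans Nn)// leq_addr.
  have h5 : a n.*2 - a (n + m)%N *+ 2 + a m.*2 < 4 * E.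
    clear hN; move: h2 h3 h4; rewrite !ltr_distlC mulr2n.
    clearbody E; move: (ainf _ _ _) (a _) (a _) (a _) => x b1 b2 b3.
    by move=> /andP[? ?] /andP[? ?] /andP[? ?]; lra.
  have E4 : 4 * E = e ^+ 2 / (Q + 1) by rewrite /E; field; lra.
  rewrite -/Q -/(a _) -/(a _) -/(a _); rewrite E4 in h5.
  apply: (@le_lt_trans _ _ (Q * (e ^+ 2 / (Q + 1)))).
    by rewrite ler_wpM2l// ltW.
  rewrite mulrCA gtr_pMr ?exprn_gt0// ltr_pdivrMr; lra.
have [psi hpsi] := choice cau.
pose M := Num.sqrt (Q * nrm2 (K ^~ w)).
have FM n z : normc (F n z) <= M.
  rewrite -(ger0_norm (normc_ge0 _)) -sqrtr_sqr ler_wsqrtr//.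
  exact: Apow_bound.
have mpsi : bmf psi := bmf_lim mF FM hpsi.
have Kpsi z : Kop K psi z = lam%:C * psi z.
  have [_ _ [B KB]] := mK.
  have B0 : 0 <= B := le_trans (normc_ge0 _) (KB (z, z)).
  have c1 : (fun n => Kop K (F n) z) @ \oo --> Kop K psi z.
    under eq_fun do rewrite Kop_cint; rewrite Kop_cint.
    apply: (@cint_cvg _ _ _ _ (fun n v => K z v * F n v) _ (B * M)).
    - by move=> n; apply: bmfM (mF n); bm.
    - move=> n x; rewrite normcM ler_pM ?normc_ge0//; exact: (KB (z, x)).
    - by move=> x; apply: cvgcM => //; exact: cvg_cst.
  have c2 : (fun n => Kop K (F n) z) @ \oo --> lam%:C * psi z.
    have -> : (fun n => Kop K (F n) z) = (fun n => lam%:C * F n.+1 z).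
      apply/funext => n; rewrite [F n.+1]/F ApowS AopE mulrA -rmorphM divff// mul1r//.
    apply: cvgcM; first exact: cvg_cst.
    have := hpsi z => /cvgc_normP h; apply/cvgc_normP.
    by rewrite (cvg_shiftS (fun n => normc (F n z - psi z))).
  exact: cvgc_unique c1 c2.
have npsi : nrm2 psi = ainf nu K w.
  have c1 : (fun n => ip (F n) (F n)) @ \oo --> ip psi psi.
    under eq_fun do rewrite ip_cint; rewrite ip_cint.
    apply: (@cint_cvg _ _ _ _ _ _ (M * M)).
    - by move=> n; apply: bmfM => //; exact: bmfJ.
    - by move=> n x; rewrite normcM normc_conj ler_pM ?normc_ge0.
    - by move=> x; apply: cvgcM => //; exact: cvgc_conj.
  have := cvgc_Re c1; under eq_fun do rewrite ip_nrm2// Re_real nrm2_Apow//.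
  rewrite -(nrm2_Re nu psi) => c2.
  have c3 : (fun n => amom nu K n.+1.*2 (K ^~ w)) @ \oo --> ainf nu K w.
    move/cvgrPdist_lt : ac => h; apply/cvgrPdist_lt => e /h [N _ hN]; exists N => // n /= Nn.
    by apply: hN => /=; rewrite (leq_trans Nn)// -addnn (leq_trans (leqnSn _))// leq_addr.
  by rewrite -(cvg_lim (@Rhausdorff R) c2) (cvg_lim (@Rhausdorff R) c3).
exists (lam, fun z => ((Num.sqrt (ainf nu K w))^-1)%:C * psi z) => /=; split.
- exact: ltW.
- by bm.
- move=> z; rewrite KopZ// Kpsi mulrCA //.
- by move=> g mg; exact: qf_le.
rewrite (negbTE l0) nrm2Z// npsi normc_real normfV ger0_norm ?sqrtr_ge0//.
by rewrite exprVn sqr_sqrtr ?(ltW aw)// mulVf// gt_eqF.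
Qed.

Definition deflate K (lam : R) (psi : T -> C) : T -> T -> C :=
  fun z w => K z w - lam%:C * psi z * (psi w)^*.

Lemma Kop_deflate K lam psi g z : bmker K -> bmf psi -> bmf g ->
  Kop (deflate K lam psi) g z = Kop K g z - lam%:C * ip g psi * psi z.
Proof.
move=> mK mpsi mg; rewrite !Kop_cint /deflate.
transitivity (cint nu (fun v => K z v * g v - (lam%:C * psi z) * (g v * (psi v)^*))).
  by apply: eq_cint => x; ring.
rewrite cintB; [|bm..]; rewrite cintZ; [|bm].
by rewrite -ip_cint; ring.
Qed.

Lemma qf_deflate K lam psi g : bmker K -> bmf psi -> bmf g ->
  qf (deflate K lam psi) g = qf K g - lam * normc (ip g psi) ^+ 2.
Proof.
move=> mK mpsi mg; rewrite !qf_Re.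
have -> : Kop (deflate K lam psi) g = fun z => Kop K g z - lam%:C * ip g psi * psi z.
  by apply/funext => z; rewrite Kop_deflate.
rewrite ipBl; [|bm..]; rewrite ipZl// ReB (ipC nu mg mpsi) -mulrA mulcJ.
by rewrite -rmorphM Re_real.
Qed.

(** For [lam != 0], the deflated form at [f] is the form of [K] at the component of [f] orthogonal
    to [psi]. *)
Lemma good_deflate K lam psi : good K -> 0 <= lam -> bmf psi ->
  (forall z, Kop K psi z = lam%:C * psi z) ->
  (lam != 0 -> nrm2 psi = 1) -> good (deflate K lam psi).
Proof.
move=> gK l0 mpsi Kpsi npsi; have [mK hK pK] := gK; split.
- rewrite /bmker /deflate; apply: bmfB => //; apply: bmfM.
    by apply: bmfZ; exact: bmf_fst.
  by apply: bmfJ; exact: bmf_snd.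
- move=> z w; rewrite /deflate hK cconjB; congr (_ - _).
  by rewrite !cconjM cconjK cconj_real; ring.
move=> f mf; rewrite qf_deflate//.
have [->|ln0] := eqVneq lam 0; first by rewrite mul0r subr0 pK.
set c := ip f psi.
have := pK (fun z => f z - c * psi z) ltac:(bm).
rewrite qf_Re; have -> : Kop K (fun z => f z - c * psi z) =
   fun z => Kop K f z - c * lam%:C * psi z.
  by rewrite KopB; [|bm..]; rewrite KopZ//; apply/funext => z; rewrite Kpsi mulrA.
rewrite ipBl; [|bm..]; rewrite !ipBr; [|bm..].
rewrite ipZr; [|bm..]; rewrite ipZl; [|bm..]; rewrite ipZl; [|bm..]; rewrite ipZr; [|bm..].
have -> : ip (Kop K f) psi = lam%:C * c.
  rewrite Kop_adj//; have -> : Kop K psi = fun z => lam%:C * psi z by exact/funext.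
  by rewrite ipZr// cconj_real.
rewrite (ipC nu mf mpsi) -/c ip_nrm2// npsi//.
have e1 : c^* * (lam%:C * c) = (lam * normc c ^+ 2)%:C.
  by rewrite mulrCA (mulrC c^*) mulcJ -rmorphM.
have e2 : c * lam%:C * c^* = (lam * normc c ^+ 2)%:C.
  by rewrite (mulrC c) -mulrA mulcJ -rmorphM.
rewrite e1 e2 mulr1 e2 subrr subr0 ReB Re_real//.
Qed.

End eigen_step.

Section spectral_sequence.
Variable R : realType.
Local Notation C := R[i].
Context d (T : measurableType d) (nu : {finite_measure set T -> \bar R}).
Implicit Types (f g h : T -> C) (K : T -> T -> C).
Local Notation ip := (ip nu).
Local Notation nrm2 := (nrm2 nu).
Local Notation Kop := (Kop nu).
Local Notation qf := (qf nu).
Local Notation good := (good nu).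

Definition top_pair (k : {K | good K}) : R * (T -> C) :=
  sval (cid (top_eigenfunction (svalP k))).

Lemma good_next (k : {K | good K}) :
  good (deflate (sval k) (top_pair k).1 (top_pair k).2).
Proof.
rewrite /top_pair; case: cid => -[lam psi] /= [l0 mpsi Kpsi _ npsi].
apply: good_deflate => //; first exact: svalP.
by move=> ln0; move: npsi; rewrite (negbTE ln0).
Qed.

Definition next_kernel (k : {K | good K}) : {K | good K} := exist _ _ (good_next k).

(** The last inequality takes the place of completeness of the eigenfunctions: what the first [N] of
    them leave of the form is controlled by [lam N], the top eigenvalue of the [N]-th deflated
    kernel. *)
Lemma spectral_sequence K : good K ->
  exists (lam : nat -> R) (psi : nat -> T -> C),
  [/\ forall n, 0 <= lam n, forall n, bmf (psi n),
      forall n z, Kop K (psi n) z = (lam n)%:C * psi n z,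
      forall n m, ip (psi n) (psi m) = ((n == m) && (lam n != 0))%:R &
      (forall n, lam n = 0 -> psi n = fun=> 0) /\
      forall N g, bmf g ->
        0 <= qf K g - \sum_(n < N) lam n * normc (ip g (psi n)) ^+ 2 <= lam N * nrm2 g].
Proof.
move=> gK; pose ks n := iter n next_kernel (exist _ K gK).
pose Ks n := sval (ks n); have gKs n : good (Ks n) := svalP (ks n).
pose lam n := (top_pair (ks n)).1; pose psi n := (top_pair (ks n)).2.
have tp n : [/\ 0 <= lam n, bmf (psi n),
    (forall z, Kop (Ks n) (psi n) z = (lam n)%:C * psi n z),
    (forall g, bmf g -> qf (Ks n) g <= lam n * nrm2 g) &
    if lam n == 0 then psi n = fun=> 0 else nrm2 (psi n) = 1].
  by rewrite /lam /psi /Ks /top_pair; case: cid => -[].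
have KsS n : Ks n.+1 = deflate (Ks n) (lam n) (psi n) by [].
have mpsi n : bmf (psi n) by case: (tp n).
have mKs n : bmker (Ks n) by case: (gKs n).
have KopS n g z : bmf g ->
    Kop (Ks n.+1) g z = Kop (Ks n) g z - (lam n)%:C * ip g (psi n) * psi n z.
  by move=> mg; rewrite KsS Kop_deflate.
have psi0 n : lam n = 0 -> psi n = fun=> 0.
  by move=> l0; case: (tp n) => _ _ _ _; rewrite l0 eqxx.
have ip0 g : ip g (fun=> 0) = 0.
  rewrite ip_cint -[RHS](cint0 nu); apply: eq_cint => x.
  by rewrite (_ : 0^* = 0) ?mulr0//; exact: conjc0.
have psi1 n : lam n != 0 -> ip (psi n) (psi n) = 1.
  by move=> l0; case: (tp n) => _ _ _ _; rewrite (negbTE l0) ip_nrm2// => ->.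
(* A deflated kernel annihilates the eigenfunctions already removed; by self-adjointness, a later
   eigenfunction of nonzero eigenvalue is orthogonal to them, hence also an eigenfunction of [K]
   itself. *)
have killed i n : (i < n)%N -> forall z, Kop (Ks n) (psi i) z = 0.
  elim: n => // n IH; rewrite ltnS leq_eqVlt => /predU1P[->|il] z.
    rewrite KopS//; case: (tp n) => _ _ -> _ _.
    have [l0|l0] := eqVneq (lam n) 0; first by rewrite psi0// !mulr0 subrr.
    by rewrite psi1// mulr1 subrr.
  rewrite KopS// IH// sub0r.
  have -> : (lam n)%:C * ip (psi i) (psi n) = 0.
    rewrite -(cconj_real (lam n)) -ipZr//.
    have <- : Kop (Ks n) (psi n) = fun z => (lam n)%:C * psi n z.
      by apply/funext => x; case: (tp n).
    rewrite -Kop_adj// ip_cint -[RHS](cint0 nu); apply: eq_cint => x.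
    by rewrite IH// mul0r.
  by rewrite mul0r oppr0.
have orth i n : (i < n)%N -> ip (psi i) (psi n) = 0.
  move=> il; have [l0|l0] := eqVneq (lam n) 0; first by rewrite (psi0 n).
  have e : (lam n)%:C * ip (psi i) (psi n) = 0.
    rewrite -(cconj_real (lam n)) -ipZr//.
    have <- : Kop (Ks n) (psi n) = fun z => (lam n)%:C * psi n z.
      by apply/funext => x; case: (tp n).
    rewrite -Kop_adj// ip_cint -[RHS](cint0 nu); apply: eq_cint => x.
    by rewrite killed// mul0r.
  move/eqP: e; rewrite mulf_eq0 => /orP[/eqP h|/eqP//].
  by case: h => h; rewrite h eqxx in l0.
have KopN N g z : bmf g -> Kop (Ks N) g z =
    Kop K g z - \sum_(n < N) (lam n)%:C * ip g (psi n) * psi n z.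
  move=> mg; elim: N => [|N IH]; first by rewrite big_ord0 subr0.
  by rewrite KopS// IH big_ord_recr/= opprD addrA.
have qfN N g : bmf g -> qf (Ks N) g =
    qf K g - \sum_(n < N) lam n * normc (ip g (psi n)) ^+ 2.
  move=> mg; elim: N => [|N IH]; first by rewrite big_ord0 subr0.
  by rewrite KsS qf_deflate// IH big_ord_recr/= opprD addrA.
exists lam, psi; split => //.
- by move=> n; case: (tp n).
- move=> n z; case: (tp n) => _ _ <- _ _; rewrite KopN// big1 ?subr0// => i _.
  by rewrite ipC// orth// (_ : 0^* = 0) ?mulr0 ?mul0r//; exact: conjc0.
- move=> n m; case: ltngtP => [nm|nm|<-] /=; first exact: orth.
    by rewrite ipC// orth//; exact: conjc0.
  have [l0|l0] := eqVneq (lam n) 0; first by rewrite psi0// ip0.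
  exact: psi1.
split=> // N g mg; rewrite -qfN//; apply/andP; split.
  by case: (gKs N) => _ _; exact.
by case: (tp N) => _ _ _ + _; exact.
Qed.

End spectral_sequence.

(** * Trace formula *)

Section finite_rank.
Variable R : realType.
Local Notation C := R[i].
Context d (T : measurableType d) (nu : {finite_measure set T -> \bar R}).
Implicit Types (f g h : T -> C).
Local Notation ip := (ip nu).
Local Notation nrm2 := (nrm2 nu).
Local Notation Kop := (Kop nu).
Local Notation qf := (qf nu).
Local Notation good := (good nu).
(** For the Ginibre kernel the [e j] are weighted monomials restricted to [D], where they are in
    general not orthogonal. The common bound [B] permits passing to the limit under every
    integral. *)
Variables (K : T -> T -> C) (e : nat -> T -> C) (B : R).
Hypotheses (mK : bmker K) (me : forall j, bmf (e j)).
Hypothesis SB : forall J z w, normc (\sum_(j < J) e j z * (e j w)^*) <= B.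
Hypothesis SK : forall z w,
  (fun J => \sum_(j < J) e j z * (e j w)^*) @ \oo --> K z w.

Local Notation S J := (fun z w => \sum_(j < J) e j z * (e j w)^*).

Lemma Kop_S J g z : bmf g -> Kop (S J) g z = \sum_(j < J) ip g (e j) * e j z.
Proof.
move=> mg; rewrite Kop_cint.
transitivity (cint nu (fun v => \sum_(j < J) e j z * (g v * (e j v)^*))).
  by apply: eq_cint => v; rewrite mulr_suml; apply: eq_bigr => j _; ring.
rewrite cint_sum; last by move=> j _; apply: bmfZ; apply: bmfM => //; exact: bmfJ.
apply: eq_bigr => j _; rewrite cintZ; last by apply: bmfM => //; exact: bmfJ.
by rewrite -ip_cint mulrC.
Qed.

Lemma bmker_S J : bmker (S J).
Proof.
apply: bmf_sum => j _; apply: bmfM; first exact: bmf_fst.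
by apply: bmfJ; exact: bmf_snd.
Qed.

Lemma qf_S J g : bmf g -> qf (S J) g = \sum_(j < J) normc (ip g (e j)) ^+ 2.
Proof.
move=> mg; rewrite qf_Re; have -> : Kop (S J) g = fun z => \sum_(j < J) ip g (e j) * e j z.
  by apply/funext => z; exact: Kop_S.
rewrite ip_suml => [|j|//]; last by apply: bmfZ.
rewrite Re_sum; apply: eq_bigr => j _; rewrite ipZl// (ipC nu mg (me j)) mulcJ.
exact: Re_real.
Qed.

Lemma Kop_S_cvg (F : nat -> T -> C) g z (M : R) : (forall J, bmf (F J)) ->
  (forall J x, normc (F J x) <= M) -> (forall x, F ^~ x @ \oo --> g x) ->
  (fun J => Kop (S J) (F J) z) @ \oo --> Kop K g z.
Proof.
move=> mF FM Fg; under eq_fun do rewrite Kop_cint; rewrite Kop_cint.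
apply: (@cint_cvg _ _ _ _ _ _ (B * M)).
- by move=> J; apply: bmfM (mF J); exact: (bmker_row z (bmker_S J)).
- by move=> J x; rewrite normcM ler_pM ?normc_ge0.
- by move=> x; apply: cvgcM.
Qed.

Lemma qf_S_cvg g : bmf g -> (fun J => qf (S J) g) @ \oo --> qf K g.
Proof.
move=> mg; have [_ _ [M gM]] := mg.
under eq_fun do rewrite qf_Re; rewrite qf_Re; apply: cvgc_Re.
under eq_fun do rewrite ip_cint; rewrite ip_cint.
apply: (@cint_cvg _ _ _ _ _ _ (B * M * mass nu * M)).
- by move=> J; apply: bmfM; [exact: bmf_Kop (bmker_S J) mg|exact: bmfJ].
- move=> J x; rewrite normcM normc_conj ler_pM ?normc_ge0//.
  rewrite Kop_cint; apply: cint_bound.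
    by apply: bmfM mg; exact: (bmker_row x (bmker_S J)).
  by move=> v; rewrite normcM ler_pM ?normc_ge0.
- move=> x; apply: cvgcM; last exact: cvgc_cst.
  by apply: (@Kop_S_cvg (fun=> g) g x M) => // y; exact: cvgc_cst.
Qed.

Lemma qf_S_le J g : bmf g -> \sum_(j < J) normc (ip g (e j)) ^+ 2 <= qf K g.
Proof.
move=> mg; have c := qf_S_cvg mg.
rewrite -(cvg_lim (@Rhausdorff R) c); apply: limr_ge; first exact: cvgP c.
exists J => // J' /= JJ'; rewrite qf_S//.
rewrite -(subnKC JJ') big_split_ord/= lerDl; apply: sumr_ge0 => j _.
exact: sqr_ge0.
Qed.

Lemma good_finite_rank : good K.
Proof.
split=> // [z w|f mf].
  have h1 := cvgc_conj (@SK z w); apply: cvgc_unique (@SK w z) _.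
  apply: cvg_trans h1; apply: near_eq_cvg; apply: nearW => J.
  rewrite cconj_sum; apply: eq_bigr => j _.
  by rewrite cconjM cconjK mulrC.
by have := qf_S_le 0 mf; rewrite big_ord0.
Qed.

Definition Kpow n f : T -> C := iter n (Kop K) f.
(** The trace of the power [n.+1] of the operator, as the integral of its kernel over the
    diagonal. *)
Definition trace n : C := cint nu (fun z => Kpow n (K ^~ z) z).

Lemma KpowS n f : Kpow n.+1 f = Kop K (Kpow n f). Proof. by []. Qed.

Lemma bmf_Kpow n f : bmf f -> bmf (Kpow n f).
Proof. by move=> mf; elim: n => //= n IH; exact: bmf_Kop. Qed.

Lemma Kpow_lin n (J : nat) (c : nat -> C) (F : nat -> T -> C) : (forall j, bmf (F j)) ->
  Kpow n (fun z => \sum_(j < J) c j * F j z) = fun z => \sum_(j < J) c j * Kpow n (F j) z.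
Proof.
move=> mF; elim: n => // n IH; rewrite KpowS IH; apply/funext => z.
rewrite Kop_cint.
transitivity (cint nu (fun v => \sum_(j < J) c j * (K z v * Kpow n (F j) v))).
  by apply: eq_cint => v; rewrite mulr_sumr; apply: eq_bigr => j _; ring.
have m j : bmf (fun v => K z v * Kpow n (F j) v).
  by apply: bmfM (bmf_Kpow n (mF j)); exact: bmker_row.
rewrite cint_sum => [|j _]; last exact: bmfZ.
by apply: eq_bigr => j _; rewrite cintZ// -Kop_cint.
Qed.

Lemma Kpow_cvg n (F : nat -> T -> C) g (M : R) : (forall J, bmf (F J)) ->
  (forall J x, normc (F J x) <= M) -> (forall x, F ^~ x @ \oo --> g x) ->
  forall x, (fun J => Kpow n (F J) x) @ \oo --> Kpow n g x.
Proof.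
move=> mF FM Fg; have [_ _ [B' KB]] := mK.
suff [M' HM] : exists M', (forall J x, normc (Kpow n (F J) x) <= M') /\
    forall x, (fun J => Kpow n (F J) x) @ \oo --> Kpow n g x by case: HM.
elim: n => [|n [M' [IM IH]]]; first by exists M.
have key J x v : normc (K x v * Kpow n (F J) v) <= B' * M'.
  by rewrite normcM ler_pM ?normc_ge0//; exact: (KB (x, v)).
exists (B' * M' * mass nu); split=> [J x|x].
  rewrite KpowS Kop_cint; apply: cint_bound => [|v]; last exact: key.
  by apply: bmfM (bmf_Kpow n (mF J)); exact: bmker_row.
under eq_fun do rewrite KpowS Kop_cint; rewrite KpowS Kop_cint.
apply: (@cint_cvg _ _ _ _ _ _ (B' * M')) => [J|J v|v].
- by apply: bmfM (bmf_Kpow n (mF J)); exact: bmker_row.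
- exact: key.
- by apply: cvgcM; [exact: cvgc_cst|exact: IH].
Qed.

Lemma Kpow_bound n : exists M, forall f M0, bmf f -> (forall x, normc (f x) <= M0) ->
  forall x, normc (Kpow n f x) <= M * M0.
Proof.
have [_ _ [B' KB]] := mK; elim: n => [|n [M IH]].
  by exists 1 => f M0 _ fM x; rewrite mul1r fM.
exists (B' * M * mass nu) => f M0 mf fM x; rewrite KpowS Kop_cint.
rewrite mulrAC; apply: cint_bound; first by apply: bmfM (bmf_Kpow n mf); exact: bmker_row.
move=> v; rewrite normcM -mulrA ler_pM ?normc_ge0//; first exact: (KB (x, v)).
exact: IH.
Qed.

(** The trace of [K^n] composed with the finite-rank operator [S J]. *)
Definition trace_S J n : C := \sum_(i < J) ip (Kpow n (e i)) (e i).

Lemma trace_S_cvg n : (fun J => trace_S J n) @ \oo --> trace n.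
Proof.
have SE J z : Kpow n (S J ^~ z) z = \sum_(i < J) (e i z)^* * Kpow n (e i) z.
  rewrite -(congr1 (fun h => h z) (Kpow_lin n J (fun j => (e j z)^*) me)) /=.
  by congr Kpow; apply/funext => x; apply: eq_bigr => j _; rewrite mulrC.
have mt i : bmf (fun z => (e i z)^* * Kpow n (e i) z).
  by apply: bmfM (bmf_Kpow n (me i)); exact: bmfJ.
have -> : (fun J => trace_S J n) = fun J => cint nu (fun z => Kpow n (S J ^~ z) z).
  apply/funext => J; under eq_cint do rewrite SE.
  rewrite cint_sum//; apply: eq_bigr => i _; rewrite ip_cint.
  by apply: eq_cint => x; rewrite mulrC.
have [M HM] := Kpow_bound n.
apply: (@cint_cvg _ _ _ _ _ _ (M * B)).
- move=> J; apply: (bmf_ext (f := fun z => \sum_(i < J) (e i z)^* * Kpow n (e i) z)).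
    by move=> z; rewrite SE.
  exact: bmf_sum.
- by move=> J z; apply: HM => //; exact: (bmker_col z (bmker_S J)).
- move=> z; apply: (@Kpow_cvg n (fun J => S J ^~ z) (K ^~ z) B) => //.
  by move=> J; exact: (bmker_col z (bmker_S J)).
Qed.

Section with_spectrum.
Variables (lam : nat -> R) (psi : nat -> T -> C).
Hypothesis lam_ge0 : forall n, 0 <= lam n.
Hypothesis mpsi : forall n, bmf (psi n).
Hypothesis Kpsi : forall n z, Kop K (psi n) z = (lam n)%:C * psi n z.
Hypothesis orth : forall n m, ip (psi n) (psi m) = ((n == m) && (lam n != 0))%:R.
Hypothesis psi0 : forall n, lam n = 0 -> psi n = fun=> 0.
Hypothesis spec : forall N g, bmf g ->
  0 <= qf K g - \sum_(n < N) lam n * normc (ip g (psi n)) ^+ 2 <= lam N * nrm2 g.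

Let gK : good K := good_finite_rank.

(* The component of [g] orthogonal to the first [N] eigenfunctions. *)
Definition resid N g : T -> C := fun z => g z - \sum_(n < N) ip g (psi n) * psi n z.

Lemma bmf_resid N g : bmf g -> bmf (resid N g).
Proof. by move=> mg; apply: bmfB => //; apply: bmf_sum => n _; exact: bmfZ. Qed.

Lemma ip_resid_psi N g m : bmf g -> (m < N)%N -> ip (resid N g) (psi m) = 0.
Proof.
move=> mg mN; rewrite ipBl => //; last by apply: bmf_sum => n _; exact: bmfZ.
rewrite ip_suml => [|n|//]; last exact: bmfZ.
rewrite (bigD1 (Ordinal mN))//= ipZl// orth eqxx/= big1 => [|i im]; last first.
  rewrite ipZl// orth (_ : (i == m :> nat) = false) ?mulr0//.
  by apply: contraNF im => /eqP im; apply/eqP/val_inj.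
rewrite addr0; have [l0|_] := eqVneq (lam m) 0; last by rewrite mulr1 subrr.
rewrite mulr0 subr0 psi0// ip_cint -[RHS](cint0 nu); apply: eq_cint => x.
by rewrite (_ : 0^* = 0) ?mulr0//; exact: conjc0.
Qed.

Lemma qf_resid_le N g : bmf g -> qf K (resid N g) <= lam N * nrm2 (resid N g).
Proof.
move=> mg; have /andP[_] := spec N (bmf_resid N mg).
rewrite big1 ?subr0// => i _; rewrite ip_resid_psi// normc0 expr0n mulr0//.
Qed.

Lemma Kpow_psi n m z : Kpow n (psi m) z = (lam m ^+ n)%:C * psi m z.
Proof.
elim: n z => [|n IH] z; first by rewrite expr0 mul1r.
rewrite KpowS (_ : Kpow n (psi m) = fun z => (lam m ^+ n)%:C * psi m z); last exact/funext.
by rewrite KopZ// Kpsi mulrA -rmorphM -exprSr.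
Qed.

Lemma Kpow_adj n f g : bmf f -> bmf g -> ip (Kpow n f) g = ip f (Kpow n g).
Proof.
elim: n f g => // n IH f g mf mg; rewrite KpowS Kop_adj//; last exact: bmf_Kpow.
by rewrite IH//; [rewrite /Kpow -iterSr|exact: bmf_Kop].
Qed.

(** [K] maps the span of the first [N] eigenfunctions to itself and is self-adjoint, so both cross
    terms vanish. *)
Lemma Kpow_resid n N g : bmf g ->
  Re (ip (Kpow n g) g) = \sum_(m < N) lam m ^+ n * normc (ip g (psi m)) ^+ 2 +
    Re (ip (Kpow n (resid N g)) (resid N g)).
Proof.
move=> mg; have mr := bmf_resid N mg.
pose s z := \sum_(m < N) ip g (psi m) * psi m z.
have ms : bmf s by apply: bmf_sum => m _; exact: bmfZ.
have gE : g = fun z => s z + resid N g z by apply/funext => z; rewrite /resid addrC subrK.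
have KD f h : bmf f -> bmf h -> Kpow n (fun z => f z + h z) = fun z => Kpow n f z + Kpow n h z.
  move=> mf mh; elim: n => // k IH; rewrite !KpowS IH KopD//; exact: bmf_Kpow.
have Ks : Kpow n s = fun z => \sum_(m < N) ip g (psi m) * ((lam m ^+ n)%:C * psi m z).
  rewrite /s (Kpow_lin n N (fun m => ip g (psi m)) mpsi); apply/funext => z.
  by apply: eq_bigr => m _; rewrite Kpow_psi.
have mKs := bmf_Kpow n ms; have mKr := bmf_Kpow n mr.
have sr : ip (Kpow n s) (resid N g) = 0.
  rewrite Ks ip_suml => [|m|//]; last by apply: bmfZ; exact: bmfZ.
  rewrite big1// => m _; rewrite ipZl//; last exact: bmfZ.
  rewrite ipZl// (ipC nu mr (mpsi m)) ip_resid_psi// (_ : 0^* = 0) ?mulr0//; exact: conjc0.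
have rs : ip (Kpow n (resid N g)) s = 0.
  rewrite Kpow_adj// (ipC nu mKs mr) sr; exact: conjc0.
have ss : ip (Kpow n s) s = \sum_(m < N) (lam m ^+ n * normc (ip g (psi m)) ^+ 2)%:C.
  have -> : ip (Kpow n s) s = ip (Kpow n s) g.
    rewrite [in RHS]gE ipDr//; by rewrite sr addr0.
  rewrite Ks ip_suml => [|m|//]; last by apply: bmfZ; exact: bmfZ.
  apply: eq_bigr => m _; rewrite ipZl//; last exact: bmfZ.
  by rewrite ipZl// (ipC nu mg (mpsi m)) mulrCA mulcJ -rmorphM.
have -> : ip (Kpow n g) g = ip (Kpow n s) s + ip (Kpow n (resid N g)) (resid N g).
  have -> : ip (Kpow n g) g = ip (Kpow n (fun z => s z + resid N g z)) (fun z => s z + resid N g z).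
    by rewrite -gE.
  rewrite (KD _ _ ms mr) (ipDl nu mKs mKr (bmfD ms mr)).
  by rewrite (ipDr nu ms mr mKs) (ipDr nu ms mr mKr) sr rs addr0 add0r.
rewrite ss ReD Re_sum.
by congr (_ + _); apply: eq_bigr.
Qed.

Lemma resid_idem N g n : bmf g -> resid N (Kpow n (resid N g)) = Kpow n (resid N g).
Proof.
move=> mg; apply/funext => z; rewrite {1}/resid big1 ?subr0// => m _.
have mr := bmf_resid N mg; rewrite Kpow_adj//.
rewrite (_ : Kpow n (psi m) = fun z => (lam m ^+ n)%:C * psi m z); last first.
  by apply/funext => x; rewrite Kpow_psi.
by rewrite ipZr// ip_resid_psi// mulr0 mul0r.
Qed.

Lemma Kpow_resid_bounds n N g : bmf g ->
  0 <= Re (ip (Kpow n (resid N g)) (resid N g)) <= lam N ^+ n * nrm2 (resid N g).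
Proof.
move=> mg; have [_ _ pK] := gK.
have mr := bmf_resid N mg.
(* two-step induction through [ip (K^(2a) r) r = |K^a r|^2] and [ip (K^(2a+1) r) r = qf K (K^a r)] *)
have split a b : ip (Kpow (a + b) (resid N g)) (resid N g) =
    ip (Kpow a (resid N g)) (Kpow b (resid N g)).
  rewrite -Kpow_adj//; last exact: bmf_Kpow.
  by rewrite /Kpow -iterD addnC.
have qle a : qf K (Kpow a (resid N g)) <= lam N * nrm2 (Kpow a (resid N g)).
  have := qf_resid_le N (bmf_Kpow a mr); by rewrite resid_idem.
pose u k := Re (ip (Kpow k (resid N g)) (resid N g)).
have uE a : u a.*2 = nrm2 (Kpow a (resid N g)) by rewrite /u -addnn split nrm2_Re.
have uO a : u a.*2.+1 = qf K (Kpow a (resid N g)).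
  by rewrite /u -addnn -addSn split qf_Re.
have u0 k : 0 <= u k.
  rewrite -(odd_double_half k); case: odd; rewrite ?add0n ?add1n ?uE ?uO ?nrm2_ge0//.
  by apply: pK; exact: bmf_Kpow.
have uS k : u k.+1 <= lam N * u k.
  rewrite -(odd_double_half k); case: odd; rewrite ?add0n ?add1n; last by rewrite uE uO.
  set a := k./2; rewrite -doubleS uE uO.
  have mKa := bmf_Kpow a mr; have := Kcauchy_schwarz gK mKa (bmf_Kpow a.+1 mr).
  rewrite -KpowS ip_nrm2; last exact: bmf_Kpow.
  rewrite normc_real ger0_norm ?nrm2_ge0// => h.
  have h2 := qle a.+1; have q0 : 0 <= qf K (Kpow a (resid N g)) by exact: pK.
  have [->|n0] := eqVneq (nrm2 (Kpow a.+1 (resid N g))) 0; first by rewrite mulr_ge0.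
  have np : 0 < nrm2 (Kpow a.+1 (resid N g)) by rewrite lt_def n0 nrm2_ge0.
  move: h h2 q0 np; move: (nrm2 _) (qf _ _) (qf _ _) (lam N) => x y w l h h2 q0 np.
  rewrite -(ler_pM2r np) -expr2; apply: (le_trans h).
  by rewrite (mulrC l) -mulrA ler_wpM2l.
rewrite -/(u n) u0/=; elim: n => [|n IH].
  by rewrite expr0 mul1r -(uE 0).
by rewrite (le_trans (uS n))// exprS -mulrA ler_wpM2l.
Qed.

Lemma qf_psi n : qf K (psi n) = lam n.
Proof.
rewrite qf_Re (_ : Kop K (psi n) = fun z => (lam n)%:C * psi n z); last exact/funext.
rewrite ipZl// orth eqxx/=; have [->|_] := eqVneq (lam n) 0.
  by rewrite mulr0.
by rewrite mulr1.
Qed.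

Definition rtrace n : R := Re (trace n).

Lemma trace_real n : trace n = (rtrace n)%:C.
Proof.
apply: eqcP => //; rewrite Im_real.
have := cvgc_Im (@trace_S_cvg n); rewrite (_ : (fun _ => _) = (fun=> 0)).
  by move/(cvg_lim (@Rhausdorff R)) => <-; apply: (cvg_lim (@Rhausdorff R)); exact: cvg_cst.
apply/funext => J; rewrite Im_sum big1// => i _.
have := Kpow_adj n (me i) (me i).
rewrite (ipC nu (bmf_Kpow n (me i)) (me i)) => /(congr1 (@complex.Im R)).
rewrite ImJ => /eqP.
by rewrite -subr_eq0 opprK -mulr2n mulrn_eq0 => /eqP.
Qed.

Definition trace_gap n N : R := rtrace n - \sum_(m < N) lam m ^+ n.+1.

Let W J m := \sum_(i < J) normc (ip (e i) (psi m)) ^+ 2.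
Let V J n N := \sum_(i < J) Re (ip (Kpow n (resid N (e i))) (resid N (e i))).

Lemma trace_S_split J n N :
  Re (trace_S J n) = \sum_(m < N) lam m ^+ n * W J m + V J n N.
Proof.
rewrite Re_sum; under eq_bigr do rewrite (@Kpow_resid n N)//.
rewrite big_split/= exchange_big/=; congr (_ + _); apply: eq_bigr => m _.
by rewrite mulr_sumr.
Qed.

Lemma sum_ip_psi J m : W J m = qf (S J) (psi m).
Proof.
rewrite qf_S//; apply: eq_bigr => i _.
by rewrite (ipC nu (mpsi m) (me i)) normc_conj.
Qed.

(** The weight [W J m] of the [m]-th eigenfunction is the form of [S J] at [psi m] and tends to
    [lam m]; what is left of the trace comes from the residuals. *)
Lemma resid_trace_cvg n N : (fun J => V J n N) @ \oo --> trace_gap n N.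
Proof.
have -> : (fun J => V J n N) = fun J => Re (trace_S J n) - \sum_(m < N) lam m ^+ n * W J m.
  by apply/funext => J; rewrite (@trace_S_split J n N) addrC addKr.
apply: cvgB; first exact: cvgc_Re (@trace_S_cvg n).
rewrite (_ : \sum_(m < N) lam m ^+ n.+1 = \sum_(m < N) lam m ^+ n * lam m); last first.
  by apply: eq_bigr => m _; rewrite exprSr.
elim: N => [|N IH].
  by rewrite big_ord0; under eq_fun do rewrite big_ord0; exact: cvg_cst.
rewrite big_ord_recr/=; under eq_fun do rewrite big_ord_recr/=.
apply: cvgD => //; apply: cvgM; first exact: cvg_cst.
by under eq_fun do rewrite sum_ip_psi; rewrite -(qf_psi N); exact: qf_S_cvg.
Qed.

Lemma trace_gap_bounds n N : 0 <= trace_gap n N <= lam N ^+ n * trace_gap 0 N.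
Proof.
have c1 := @resid_trace_cvg n N; have c2 := @resid_trace_cvg 0 N.
have b J : 0 <= V J n N <= lam N ^+ n * V J 0 N.
  apply/andP; split.
    by apply: sumr_ge0 => i _; case/andP: (Kpow_resid_bounds n N (me i)).
  rewrite mulr_sumr; apply: ler_sum => i _.
  by case/andP: (Kpow_resid_bounds n N (me i)); rewrite nrm2_Re.
apply/andP; split.
  rewrite -(cvg_lim (@Rhausdorff R) c1); apply: limr_ge; first exact: cvgP c1.
  by apply: nearW => J; case/andP: (b J).
have c3 : (fun J => lam N ^+ n * V J 0 N) @ \oo --> lam N ^+ n * trace_gap 0 N.
  by apply: cvgM => //; exact: cvg_cst.
by apply: (ler_cvg_to c1 c3); apply: nearW => J; case/andP: (b J).
Qed.

(** With [r] the residual of [e i], the inner product of [r] and [e i] is [|r|^2], and its square is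
    one term of a sum bounded by the form of [K] at [r], hence by [lam N * |r|^2]. *)
Lemma nrm2_resid_e N i : nrm2 (resid N (e i)) <= lam N.
Proof.
have mr := bmf_resid N (me i).
have rE : ip (resid N (e i)) (resid N (e i)) = ip (resid N (e i)) (e i).
  pose s z := \sum_(m < N) ip (e i) (psi m) * psi m z.
  have ms : bmf s by apply: bmf_sum => m _; exact: bmfZ.
  rewrite -[RHS]subr0 -[X in _ - X](_ : ip (resid N (e i)) s = 0).
    by rewrite -ipBr.
  rewrite ipC// ip_suml => [|m|//]; last exact: bmfZ.
  rewrite big1 => [|m _]; first exact: conjc0.
  rewrite ipZl// (ipC nu mr (mpsi m)) ip_resid_psi// (_ : 0^* = 0) ?mulr0//; exact: conjc0.
have h1 : nrm2 (resid N (e i)) ^+ 2 <= lam N * nrm2 (resid N (e i)).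
  apply: le_trans (qf_resid_le N (me i)); apply: le_trans (qf_S_le i.+1 mr).
  rewrite big_ord_recr/= -rE ip_nrm2// normc_real ger0_norm ?nrm2_ge0//.
  by rewrite lerDr; apply: sumr_ge0 => j _; exact: sqr_ge0.
have [->//|n0] := eqVneq (nrm2 (resid N (e i))) 0.
by rewrite -(@ler_pM2r _ (nrm2 (resid N (e i)))) -?expr2// lt_def n0 nrm2_ge0.
Qed.

(** The gap for [n = 0] is nonnegative, so the partial sums of the eigenvalues are bounded by the
    trace. *)
Lemma lam_cvg0 : lam @ \oo --> (0 : R).
Proof.
apply: cvg_series_cvg_0; apply: nondecreasing_is_cvgn.
  apply/nondecreasing_seqP => n; rewrite -subr_ge0 seriesSB//.
exists (rtrace 0) => _ [n _ <-].
have /andP[+ _] := trace_gap_bounds 0 n; rewrite subr_ge0.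
by rewrite /series/= big_mkord.
Qed.

(** This is the trace formula. A fixed sum over [i < J] carries the trace up to [eps / 2]; its part
    along the eigenfunctions is at most the sum of the first [N] eigenvalues, and its [J] residuals
    are at most [lam N] each. *)
Lemma trace_gap_cvg0 : trace_gap 0 @ \oo --> (0 : R).
Proof.
apply/cvgrPdist_le => eps eps0.
have e2 : 0 < eps / 2 by rewrite divr_gt0.
have /cvgrPdist_le /(_ _ e2) [J _ hJ] := cvgc_Re (@trace_S_cvg 0).
have {}hJ := hJ J (leqnn J).
(* [J.+1] keeps the tolerance positive when [J = 0]. *)
have e3 : 0 < eps / 2 / J.+1%:R by rewrite !divr_gt0// ltr0n.
have /cvgrPdist_le /(_ _ e3) [N0 _ hN] := lam_cvg0.
exists N0 => // N /= /hN; rewrite !sub0r !normrN ger0_norm// => lN.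
have /andP[g0 _] := trace_gap_bounds 0 N; rewrite ger0_norm//.
have hV : V J 0 N <= eps / 2.
  apply: (@le_trans _ _ (\sum_(i < J) lam N)).
    by apply: ler_sum => i _; rewrite -nrm2_Re nrm2_resid_e.
  rewrite sumr_const card_ord -[_ *+ J]mulr_natl.
  have lN' : lam N * J.+1%:R <= eps / 2 by rewrite -ler_pdivlMr ?ltr0n.
  by apply: le_trans lN'; rewrite mulrC ler_wpM2l// ler_nat.
have hW : \sum_(m < N) lam m ^+ 0 * W J m <= \sum_(m < N) lam m ^+ 1.
  apply: ler_sum => m _; rewrite expr0 mul1r expr1 sum_ip_psi qf_S// -(qf_psi m).
  exact: qf_S_le.
move: hJ; rewrite (@trace_S_split J 0 N) /trace_gap /rtrace.
rewrite ler_distl => /andP[_ h3]; rewrite lerBlDr; apply: (le_trans h3).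
apply: (le_trans (lerD (lerD hW hV) (lexx (eps / 2)))).
by rewrite -addrA -splitr addrC.
Qed.

End with_spectrum.

End finite_rank.

Theorem trace_formula (R : realType) d (T : measurableType d)
    (nu : {finite_measure set T -> \bar R}) (K : T -> T -> R[i])
    (e : nat -> T -> R[i]) (B : R) :
  bmker K -> (forall j, bmf (e j)) ->
  (forall J z w, normc (\sum_(j < J) e j z * (e j w)^*) <= B) ->
  (forall z w, (fun J => \sum_(j < J) e j z * (e j w)^*) @ \oo --> K z w) ->
  good nu K /\ exists (lam : nat -> R) (psi : nat -> T -> R[i]),
  [/\ [/\ forall n, 0 <= lam n, forall n, bmf (psi n),
      forall n z, Kop nu K (psi n) z = (lam n)%:C * psi n z,
      forall n m, ip nu (psi n) (psi m) = ((n == m) && (lam n != 0))%:R &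
      forall N g, bmf g -> 0 <= qf nu K g -
        \sum_(n < N) lam n * normc (ip nu g (psi n)) ^+ 2 <= lam N * nrm2 nu g],
    forall n, trace nu K n = (rtrace nu K n)%:C,
    forall n N, 0 <= trace_gap nu K lam n N <= lam N ^+ n * trace_gap nu K lam 0 N,
    trace_gap nu K lam 0 @ \oo --> (0 : R) & lam @ \oo --> (0 : R)].
Proof.
move=> mK me SB SK; have gK := good_finite_rank nu mK me SB SK.
split=> //; have [lam [psi [l0 mpsi Kpsi orth [psi0 spec]]]] := spectral_sequence gK.
exists lam, psi; split=> //.
- exact: (trace_real nu mK me SB SK).
- exact: (trace_gap_bounds mK me SB SK l0 mpsi Kpsi orth psi0 spec).
- exact: (trace_gap_cvg0 mK me SB SK l0 mpsi Kpsi orth psi0 spec).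
- exact: (lam_cvg0 mK me SB SK l0 mpsi Kpsi orth psi0 spec).
Qed.

(** * Newton identities and infinite products *)

Section newton.
Variable R : realType.
Implicit Types (p e lam : nat -> R).

(** Newton's identities for elementary symmetric functions [e k], with [p j] the power sum of
    exponent [j.+1]. *)
Definition newton p e :=
  e 0 = 1 /\ forall k, k.+1%:R * e k.+1 = \sum_(j < k.+1) (-1) ^+ j * e (k - j)%N * p j.

(* Coefficients of the power series [sum (-s)^k e_k] divided by [1 - s l]. *)
Fixpoint divl e (l : R) k := if k is k'.+1 then e k'.+1 - l * divl e l k' else e 0.

Lemma divlS e l k : e k.+1 = divl e l k.+1 + l * divl e l k.
Proof. by rewrite /= subrK. Qed.

(** Removing the variable [l] lowers each power sum by a power of [l]. The defect [D k] of the new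
    identities satisfies [D k.+1 + l * D k = 0], because the old ones hold, and [D 0 = 0]. *)
Lemma newton_divl p e l : newton p e ->
  newton (fun j => p j - l ^+ j.+1) (divl e l).
Proof.
move=> [e0 He]; split => //; set e' := divl e l; set p' := fun j => p j - l ^+ j.+1.
pose D k := k.+1%:R * e' k.+1 - \sum_(j < k.+1) (-1) ^+ j * e' (k - j)%N * p' j.
suff D0 : forall k, D k = 0 by move=> k; apply/eqP; rewrite -subr_eq0; exact/eqP/D0.
have e'0 : e' 0 = 1 by [].
have eS k : e k.+1 = e' k.+1 + l * e' k by exact: divlS.
have pE j : p j = p' j + l ^+ j.+1 by rewrite /p' subrK.
(* the sum of the terms carrying a power of [l] telescopes *)
have tele k : \sum_(j < k) (-1) ^+ j * (e' (k - j)%N + l * e' (k - j).-1) * l ^+ j.+1 =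
    l * e' k - (-1) ^+ k * l ^+ k.+1.
  suff G n : (n <= k)%N -> \sum_(j < n) (-1) ^+ j * (e' (k - j)%N + l * e' (k - j).-1) * l ^+ j.+1 =
      l * e' k - (-1) ^+ n * l ^+ n.+1 * e' (k - n)%N.
    by rewrite G// subnn e'0 mulr1.
  elim: n => [|n IH] nk; first by rewrite big_ord0 subn0 expr0 expr1 mul1r subrr.
  rewrite big_ord_recr/= IH; last exact: ltnW.
  rewrite -subnS !exprS; ring.
have DS k : D k.+1 + l * D k = 0.
  have := He k.+1; rewrite eS big_ord_recr/= subnn e0 mulr1.
  under eq_bigr => j _.
    have jk : (k.+1 - j)%N = (k - j).+1 by rewrite subSn// -ltnS.
    rewrite jk eS (pE j); over.
  rewrite (pE k.+1) /D [\sum_(j < k.+2) _]big_ord_recr/= subnn e'0 mulr1 => H.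
  have := tele k.+1.
  have -> : \sum_(j < k.+1) (-1) ^+ j * (e' (k.+1 - j)%N + l * e' (k.+1 - j).-1) * l ^+ j.+1 =
     \sum_(j < k.+1) (-1) ^+ j * (e' (k - j).+1 + l * e' (k - j)%N) * l ^+ j.+1.
    by apply: eq_bigr => j _; rewrite subSn// -ltnS.
  have s1 : \sum_(j < k.+1) (-1) ^+ j * e' (k.+1 - j)%N * p' j =
     \sum_(j < k.+1) (-1) ^+ j * e' (k - j).+1 * p' j.
    by apply: eq_bigr => j _; rewrite subSn// -ltnS.
  rewrite s1; move: H.
  have -> : \sum_(i < k.+1) (-1) ^+ i * (e' (k - i).+1 + l * e' (k - i)%N) * (p' i + l ^+ i.+1) =
    \sum_(j < k.+1) (-1) ^+ j * e' (k - j).+1 * p' j +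
    l * \sum_(j < k.+1) (-1) ^+ j * e' (k - j)%N * p' j +
    \sum_(j < k.+1) (-1) ^+ j * (e' (k - j).+1 + l * e' (k - j)%N) * l ^+ j.+1.
    by rewrite mulr_sumr -!big_split/=; apply: eq_bigr => j _; ring.
  move: (\sum_(j < _) _) (\sum_(j < _) _) (\sum_(j < _) _) => a b c H tl.
  have h2 : k.+2%:R = k.+1%:R + 1 :> R by rewrite -natr1.
  rewrite h2 in H *; move: H; rewrite tl => H.
  by move/eqP: H; rewrite -subr_eq0 => /eqP H; rewrite -[RHS]H; ring.
elim=> [|k IH].
  rewrite /D big_ord1 subnn e'0 !mul1r /p' expr1; have := He 0.
  by rewrite big_ord1 subnn e0 !mul1r => h; rewrite /e' /= h e0 mulr1 subrr.
by have := DS k; rewrite IH mulr0 addr0.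
Qed.

(** Strong induction: each of the [k.+1] terms is at most [eps ^+ k.+1], and the factor [k.+1] on
    the left cancels their number. *)
Lemma newton_bound p e (eps : R) : newton p e ->
  (forall j, `|p j| <= eps ^+ j.+1) -> 0 <= eps -> forall k, `|e k| <= eps ^+ k.
Proof.
move=> [e0 He] pb eps0 k; elim/ltn_ind: k => -[|k] IH; first by rewrite e0 normr1.
have k0 : 0 < k.+1%:R :> R by rewrite ltr0n.
rewrite -(ler_pM2l k0) -{1}(ger0_norm (ltW k0)) -normrM He (le_trans (ler_norm_sum _ _ _))//.
apply: (@le_trans _ _ (\sum_(j < k.+1) eps ^+ k.+1)).
  apply: ler_sum => j _; rewrite !normrM normrX normrN1 expr1n mul1r.
  have -> : eps ^+ k.+1 = eps ^+ (k - j) * eps ^+ j.+1.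
    by rewrite -exprD addnS subnK// -ltnS.
  by rewrite ler_pM// IH// ltnS leq_subr.
by rewrite sumr_const card_ord mulr_natl.
Qed.

Definition altsum e (s : R) m := \sum_(k < m) (- s) ^+ k * e k.

Lemma altsum_divl e l s m :
  altsum e s m.+1 = altsum (divl e l) s m.+1 - s * l * altsum (divl e l) s m.
Proof.
rewrite /altsum; elim: m => [|m IH].
  by rewrite !big_ord_recr !big_ord0/= mulr0 subr0.
rewrite big_ord_recr/= IH [in X in _ = X - _]big_ord_recr/=.
rewrite [in X in _ = _ - _ * X]big_ord_recr/= exprS; ring.
Qed.

Lemma altsum_divl_cvg e l s F : altsum (divl e l) s @ \oo --> F ->
  altsum e s @ \oo --> (1 - s * l) * F.
Proof.
move=> h; rewrite -cvg_shiftS/=.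
rewrite (_ : (fun n => altsum e s n.+1) =
  fun m => altsum (divl e l) s m.+1 - s * l * altsum (divl e l) s m); last first.
  by apply/funext => m; exact: altsum_divl.
rewrite mulrBl mul1r; apply: cvgB; first by rewrite (cvg_shiftS (altsum (divl e l) s)).
by apply: cvgM => //; exact: cvg_cst.
Qed.

Lemma altsum_geo e s (eps : R) : (forall k, `|e k| <= eps ^+ k) -> e 0 = 1 ->
  0 <= eps -> `|s| * eps <= 2^-1 ->
  exists2 F : R, altsum e s @ \oo --> F & `|F - 1| <= 2 * (`|s| * eps).
Proof.
move=> eb e0 eps0 se; set r := `|s| * eps in se *.
have r0 : 0 <= r by rewrite mulr_ge0.
have r1 : `|r| < 1 by rewrite ger0_norm// (le_lt_trans se)// invf_lt1// ltr1n.
have tb k : `|(- s) ^+ k * e k| <= r ^+ k.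
  by rewrite normrM normrX normrN exprMn ler_wpM2l.
have aE : altsum e s = series (fun k => (- s) ^+ k * e k).
  by apply/funext => m; rewrite /series/= big_mkord.
have cv : cvgn (altsum e s).
  rewrite aE; apply: normed_cvg; apply: (@series_le_cvg _ _ (geometric 1 r)) => //=.
  - by move=> n; rewrite mul1r exprn_ge0.
  - by move=> n; rewrite mul1r.
  exact: is_cvg_geometric_series.
exists (limn (altsum e s)) => //.
have bm m : `|altsum e s m.+1 - 1| <= 2 * r.
  rewrite /altsum big_ord_recl/= expr0 mul1r e0 addrAC subrr add0r.
  rewrite (le_trans (ler_norm_sum _ _ _))//.
  apply: (@le_trans _ _ (\sum_(i < m) r * 2^-1 ^+ i)).
    apply: ler_sum => i _; rewrite (le_trans (tb _))// /bump leq0n add1n exprS.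
    by rewrite ler_wpM2l// lerXn2r// nnegrE// invr_ge0.
  rewrite -mulr_sumr mulrC ler_wpM2r//.
  have -> : \sum_(i < m) (2^-1 : R) ^+ i = 2 - 2 * 2^-1 ^+ m.
    elim: m => [|m IH]; first by rewrite big_ord0 expr0 mulr1 subrr.
    by rewrite big_ord_recr/= IH exprS; move: (_ ^+ m) => x; lra.
  by rewrite gerBl mulr_ge0// exprn_ge0.
have c2 : (fun m => `|altsum e s m.+1 - 1|) @ \oo --> `|limn (altsum e s) - 1|.
  apply: cvg_norm; apply: cvgB; last exact: cvg_cst.
  by rewrite (cvg_shiftS (altsum e s)).
rewrite -(cvg_lim (@Rhausdorff R) c2); apply: limr_le; first exact: cvgP c2.
exact: nearW.
Qed.

(* Dividing out the first [N] factors leaves a series whose coefficients are bounded by the powers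
   of [eps N], hence close to 1. *)
Theorem newton_product p e lam (eps : nat -> R) :
  newton p e -> (forall N, 0 <= eps N) -> eps @ \oo --> (0 : R) ->
  (forall n N, `|p n - \sum_(m < N) lam m ^+ n.+1| <= eps N ^+ n.+1) ->
  forall s, exists2 F : R, altsum e s @ \oo --> F &
    (fun N => \prod_(n < N) (1 - s * lam n)) @ \oo --> F.
Proof.
move=> pe eps0 epsc gap s.
pose E := fix E N := if N is N'.+1 then divl (E N') (lam N') else e.
have nE N : newton (fun n => p n - \sum_(m < N) lam m ^+ n.+1) (E N).
  elim: N => [|N IH].
    by rewrite (_ : (fun _ => _) = p)//; apply/funext => n; rewrite big_ord0 subr0.
  have := newton_divl (lam N) IH; rewrite -/(E N.+1); congr (newton _ _).
  by apply/funext => n; rewrite big_ord_recr/= opprD addrA.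
have EB N := newton_bound (nE N) (fun j => gap j N) (eps0 N).
have back N F : altsum (E N) s @ \oo --> F ->
    altsum e s @ \oo --> (\prod_(n < N) (1 - s * lam n)) * F.
  elim: N F => [|N IH] F h; first by rewrite big_ord0 mul1r.
  by rewrite big_ord_recr/= -mulrA; apply: IH; exact: altsum_divl_cvg.
have /cvgrPdist_le small : (fun N => `|s| * eps N) @ \oo --> (0 : R).
  by rewrite -(mulr0 `|s|); apply: cvgM => //; exact: cvg_cst.
have {}small del : 0 < del -> exists N0, forall N, (N0 <= N)%N -> `|s| * eps N <= del.
  move=> /small [N0 _ h]; exists N0 => N /h; rewrite sub0r normrN ger0_norm//.
  by rewrite mulr_ge0.
have /small [N0 hN0] : 0 < 2^-1 :> R by rewrite invr_gt0.
have geo N : (N0 <= N)%N -> exists2 F : R, altsum (E N) s @ \oo --> F & `|F - 1| <= 2 * (`|s| * eps N).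
  by move=> /hN0; exact: (altsum_geo (EB N) (proj1 (nE N)) (eps0 N)).
have [F0 hF0 _] := geo N0 (leqnn N0).
exists ((\prod_(n < N0) (1 - s * lam n)) * F0); first exact: back.
set F := _ * F0; have eF : altsum e s @ \oo --> F by exact: back.
(* [A N] is the sum of the series left after [N] divisions, by default 1 where no suitable limit
   exists. [F] is the product of the first [N] factors and [A N], so it remains to see that [A N]
   tends to 1. *)
pose A N := xget 1 [set x | altsum (E N) s @ \oo --> x /\ `|x - 1| <= 2 * (`|s| * eps N)].
have hA N : (N0 <= N)%N -> altsum (E N) s @ \oo --> A N /\ `|A N - 1| <= 2 * (`|s| * eps N).
  move=> /geo [x h1 h2]; rewrite /A.
  by case: xgetP => [y _ //|/(_ x)]; case.
have FA N : (N0 <= N)%N -> F = (\prod_(n < N) (1 - s * lam n)) * A N.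
  move=> /hA [/back h _].
  by rewrite -(cvg_lim (@Rhausdorff R) eF) (cvg_lim (@Rhausdorff R) h).
have A1 : A @ \oo --> (1 : R).
  apply/cvgrPdist_le => del del0.
  have /small [N1 hN1] : 0 < del / 2 by rewrite divr_gt0.
  exists (maxn N0 N1) => // N /=; rewrite geq_max => /andP[a b].
  rewrite distrC; have [_ h] := hA N a; apply: (le_trans h).
  by rewrite mulrC -ler_pdivlMr// hN1.
have : (fun N => F / A N) @ \oo --> F.
  rewrite -{2}(divr1 F); apply: cvgM; first exact: cvg_cst.
  by apply: cvgV => //; exact: oner_neq0.
apply: cvg_trans; apply: near_eq_cvg.
have /cvgrPdist_lt /(_ _ ltr01) [N2 _ hN2] := A1.
exists (maxn N0 N2) => // N /=; rewrite geq_max => /andP[a b].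
rewrite (FA N a) mulfK//; apply/eqP => A0; have := hN2 N b.
by rewrite /= A0 subr0 normr1 ltxx.
Qed.

(** It handles, in [mertens], the convolution of a geometric sequence with a null sequence. *)
Lemma contraction_cvg0 (y x : nat -> R) (rho : R) : 0 <= rho < 1 ->
  (forall m, 0 <= y m) -> (forall m, y m.+1 <= rho * y m + x m) ->
  x @ \oo --> (0 : R) -> y @ \oo --> (0 : R).
Proof.
move=> /andP[r0 r1] y0 yS /cvgrPdist_le xc; apply/cvgrPdist_le => del del0.
have d1 : 0 < del / 2 * (1 - rho) by rewrite mulr_gt0 ?divr_gt0// subr_gt0.
have [N _ hN] := xc _ d1.
have key k : y (N + k)%N <= rho ^+ k * y N + del / 2.
  elim: k => [|k IH]; first by rewrite addn0 expr0 mul1r lerDl divr_ge0// ltW.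
  rewrite addnS (le_trans (yS _))//.
  have h := hN (N + k)%N (leq_addr _ _); rewrite sub0r normrN in h.
  have {}h := le_trans (ler_norm _) h.
  apply: (le_trans (lerD (ler_wpM2l r0 IH) h)).
  by rewrite exprS; lra.
have /cvgrPdist_le gc : (fun k => rho ^+ k * y N) @ \oo --> (0 : R).
  rewrite -(mul0r (y N)); apply: cvgM; last exact: cvg_cst.
  by apply: cvg_expr; rewrite ger0_norm.
have d2 : 0 < del / 2 by rewrite divr_gt0.
have [M _ hM] := gc _ d2.
exists (N + M)%N => // n /= Nn; rewrite sub0r normrN ger0_norm//.
have Nn' : (N <= n)%N := leq_trans (leq_addr _ _) Nn.
rewrite -(subnKC Nn') (le_trans (key _))//.
have := hM (n - N)%N; rewrite /= leq_subRL// => /(_ Nn).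
rewrite sub0r normrN => /(le_trans (ler_norm _)).
by rewrite -lerBrDr => h; apply: (le_trans h); rewrite {2}(splitr del) addrK.
Qed.

(** The Cauchy product is a convolution of [a] with the partial sums of [u]. Replacing these by [U]
    costs at most [c * y m], where [y] is the convolution of [rho ^+ j] with their errors and so
    obeys a contracting recursion. *)
Lemma mertens (a u : nat -> R) (c rho A U : R) : 0 <= rho < 1 ->
  (forall j, `|a j| <= c * rho ^+ j) ->
  (fun m => \sum_(j < m) a j) @ \oo --> A ->
  (fun m => \sum_(j < m) u j) @ \oo --> U ->
  (fun m => \sum_(k < m) \sum_(j < k.+1) a j * u (k - j)%N) @ \oo --> A * U.
Proof.
move=> rho01 ab aA uU; have /andP[r0 r1] := rho01.
pose Us m := \sum_(j < m) u j.
have E m : \sum_(k < m) \sum_(j < k.+1) a j * u (k - j)%N = \sum_(j < m) a j * Us (m - j)%N.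
  elim: m => [|m IH]; first by rewrite !big_ord0.
  rewrite big_ord_recr/= IH [RHS]big_ord_recr/= subSnn /Us big_ord1.
  rewrite [X in _ + X]big_ord_recr/= subnn addrA; congr (_ + _).
  rewrite -big_split/=; apply: eq_bigr => j _; rewrite subSn; last exact: ltnW.
  by rewrite big_ord_recr/= mulrDr.
have E2 m : \sum_(j < m) a j * Us (m - j)%N =
    (\sum_(j < m) a j) * U + \sum_(j < m) a j * (Us (m - j)%N - U).
  by rewrite mulr_suml -big_split/=; apply: eq_bigr => j _; ring.
under eq_fun do rewrite E E2.
rewrite -(addr0 (A * U)); apply: cvgD.
  by apply: cvgM => //; exact: cvg_cst.
pose y m := \sum_(j < m) rho ^+ j * `|Us (m - j)%N - U|.
have y0 m : 0 <= y m by apply: sumr_ge0 => j _; rewrite mulr_ge0// exprn_ge0.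
have yc : y @ \oo --> (0 : R).
  apply: (@contraction_cvg0 y (fun m => `|Us m.+1 - U|) rho) => //.
    move=> m; rewrite /y big_ord_recl/= expr0 mul1r subn0 addrC lerD2r.
    rewrite mulr_sumr; apply: ler_sum => j _.
    by rewrite /bump leq0n add1n exprS mulrA subSS.
  rewrite -(normr0 R); apply: cvg_norm; rewrite -(subrr U); apply: cvgB; last exact: cvg_cst.
  by rewrite (cvg_shiftS Us).
apply: (@squeeze_cvgr _ _ _ _ (fun m => - (c * y m)) (fun m => c * y m)).
- apply: nearW => m; rewrite -ler_norml (le_trans (ler_norm_sum _ _ _))//.
  rewrite /y mulr_sumr; apply: ler_sum => j _; rewrite normrM mulrA.
  by rewrite ler_wpM2r.
- by rewrite -oppr0; apply: cvgN; rewrite -(mulr0 c); apply: cvgM => //; exact: cvg_cst.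
- by rewrite -(mulr0 c); apply: cvgM => //; exact: cvg_cst.
Qed.

End newton.

(** * Products over rearranged sequences *)

Section products.
Variable R : realType.
Implicit Types (alpha lam : nat -> R).

(* Equal fibres only give a rearrangement of the nonzero terms; for factors in [0, 1] the infimum
   of the partial products is insensitive to it. *)
Lemma prod_fibers_le alpha lam : (forall n, 0 <= lam n <= 1) ->
  (forall a, a != 0 -> [set n | alpha n = a] #<= [set n | lam n = a])%card ->
  forall N, exists M, \prod_(m < M) (1 - lam m) <= \prod_(n < N) (1 - alpha n).
Proof.
move=> l01 fib N.
(* One injection per nonzero value; glued along the disjoint fibres they give [f], injective on the
   indices with [alpha n != 0]. *)
have /choice [g hg] : forall a : R, exists g : nat -> nat, a != 0 ->
    {in [set n | alpha n = a] &, injective g} /\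
    forall n, alpha n = a -> lam (g n) = a.
  move=> a; have [->|a0] := eqVneq a 0; first by exists id.
  have /pcard_leP [f] := fib a a0.
  exists f => _; split; first exact: (@inj _ _ _ f).
  by move=> n na; exact: (@funS _ _ _ _ f n na).
pose f n := g (alpha n) n.
have fl n : alpha n != 0 -> lam (f n) = alpha n by move=> /hg [_]; exact.
have finj n n' : alpha n != 0 -> alpha n' != 0 -> f n = f n' -> n = n'.
  move=> a0 a0' ff; have aa : alpha n = alpha n' by rewrite -fl// ff fl.
  have [gi _] := hg _ a0; apply: gi; rewrite ?inE//=.
  by rewrite [LHS]ff /f aa.
pose M := (\max_(n < N) f n).+1; exists M.
pose f' (i : 'I_N) : 'I_M := inord (f i).
have f'E i : f' i = f i :> nat by rewrite inordK// ltnS; exact: (leq_bigmax i).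
pose S : {set 'I_N} := finset (fun i : 'I_N => alpha (nat_of_ord i) != 0).
rewrite (bigID (mem S))/= [X in _ <= _ * X]big1; last first.
  by move=> i; rewrite inE negbK => /eqP ->; rewrite subr0.
rewrite mulr1.
have -> : \prod_(i in S) (1 - alpha i) = \prod_(j in (f' @: S)) (1 - lam j).
  rewrite big_imset/=; last first.
    move=> i j; rewrite !inE => ai aj /(congr1 val); rewrite /= !f'E => h.
    exact/val_inj/finj.
  by apply: eq_bigr => i; rewrite inE => ai; rewrite f'E fl.
rewrite (bigID (mem (f' @: S)))/= ler_piMr//.
  by apply: prodr_ge0 => j _; have /andP[] := l01 j; rewrite subr_ge0.
apply: prodr_ile1 => j; have /andP[] := l01 j; lra.
Qed.

Lemma prod_fibers_eq alpha lam : (forall n, 0 <= lam n <= 1) ->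
  (forall a, a != 0 -> [set n | alpha n = a] #= [set n | lam n = a])%card ->
  limn (fun N => \prod_(n < N) (1 - alpha n)) = limn (fun N => \prod_(n < N) (1 - lam n)).
Proof.
move=> l01 fib.
have a01 n : 0 <= alpha n <= 1.
  have [->|a0] := eqVneq (alpha n) 0; first by rewrite lexx ler01.
  have := fib _ a0; rewrite card_eq_le => /andP[/pcard_leP [f] _].
  by have <- := @funS _ _ _ _ f n erefl.
have prop (be : nat -> R) : (forall n, 0 <= be n <= 1) ->
    let u := fun N => \prod_(n < N) (1 - be n) in
    (forall n, limn u <= u n) /\ cvgn u.
  move=> b01 u; have b1 n : 0 <= 1 - be n <= 1 by have /andP[] := b01 n; lra.
  have u0 n : 0 <= u n by apply: prodr_ge0 => i _; case/andP: (b1 i).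
  have ni : nonincreasing_seq u.
    apply/nonincreasing_seqP => n; rewrite /u big_ord_recr/=.
    by apply: ler_piMr; [exact: u0|case/andP: (b1 n)].
  have cu : cvgn u by apply: nonincreasing_is_cvgn => //; exists 0 => _ [n _ <-].
  by split => // n; exact: nonincreasing_cvgn_ge.
have [aL aC] := prop _ a01; have [lL lC] := prop _ l01.
apply/eqP; rewrite eq_le; apply/andP; split; apply: limr_ge => //; apply: nearW => N.
  have [|M hM] := @prod_fibers_le lam alpha a01 _ N.
    by move=> a a0; have := fib _ a0; rewrite card_eq_le => /andP[].
  exact: le_trans (aL M) hM.
have [|M hM] := @prod_fibers_le alpha lam l01 _ N.
  by move=> a a0; have := fib _ a0; rewrite card_eq_le => /andP[].
exact: le_trans (lL M) hM.
Qed.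

End products.

(** * Fredholm expansion *)

Section iterated_integral.
Variable R : realType.
Local Notation C := R[i].
Context d (T : measurableType d) (nu : {finite_measure set T -> \bar R}).

(** Nested one-variable integrals, so that exchanging variables only takes Fubini's theorem for two
    of them; [integral_cube] makes the link with [power_measure]. *)
Fixpoint Jint k : (k.-tuple T -> C) -> C :=
  match k with
  | 0 => fun f => f [tuple]
  | k'.+1 => fun f => cint nu (fun v => Jint (fun t : k'.-tuple T => f (tuple_cons (v, t))))
  end.

Lemma JintS k (f : k.+1.-tuple T -> C) :
  Jint f = cint nu (fun v => Jint (fun t : k.-tuple T => f (tuple_cons (v, t)))).
Proof. by []. Qed.

Lemma eq_Jint k (f g : k.-tuple T -> C) : f =1 g -> Jint f = Jint g.
Proof. by move=> /funext ->. Qed.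

Lemma bmf_cons k (f : k.+1.-tuple T -> C) v : bmf f ->
  bmf (fun t : k.-tuple T => f (tuple_cons (v, t))).
Proof.
apply: bmf_comp; apply: measurableT_comp (@measurable_tuple_cons _ _ _) _.
exact: pair1_measurable.
Qed.

Lemma bmf_Jint k d' (X : measurableType d') (F : X * k.-tuple T -> C) : bmf F ->
  bmf (fun x => Jint (fun t => F (x, t))).
Proof.
elim: k d' X F => [|k IH] d' X F mF.
  exact: (bmf_comp (pair2_measurable _) mF).
pose F' (q : (X * T) * k.-tuple T) := F (q.1.1, tuple_cons (q.1.2, q.2)).
have mF' : bmf F'.
  apply: (bmf_comp (h := fun q : (X * T) * k.-tuple T => (q.1.1, tuple_cons (q.1.2, q.2)))) mF.
  apply: measurable_fun_pair; first by apply: measurableT_comp => //; exact: measurable_fst.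
  apply: measurableT_comp; first exact: measurable_tuple_cons.
  apply: measurable_fun_pair => //; exact: measurableT_comp.
exact: (bmf_cint nu (IH _ _ _ mF')).
Qed.

Lemma bmf_Jint_cons k (f : k.+1.-tuple T -> C) : bmf f ->
  bmf (fun v => Jint (fun t : k.-tuple T => f (tuple_cons (v, t)))).
Proof.
move=> mf; apply: (@bmf_Jint _ _ _ (fun p : T * k.-tuple T => f (tuple_cons p))).
exact: (bmf_comp (@measurable_tuple_cons _ _ _) mf).
Qed.

Lemma JintZ k c (f : k.-tuple T -> C) : bmf f -> Jint (fun t => c * f t) = c * Jint f.
Proof.
elim: k f => [//|k IH] f mf; rewrite !JintS -cintZ; last exact: bmf_Jint_cons.
by apply: eq_cint => v; rewrite IH//; exact: bmf_cons.
Qed.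

Lemma JintD k (f g : k.-tuple T -> C) : bmf f -> bmf g ->
  Jint (fun t => f t + g t) = Jint f + Jint g.
Proof.
elim: k f g => [//|k IH] f g mf mg; rewrite !JintS -cintD; [|exact: bmf_Jint_cons..].
by apply: eq_cint => v; rewrite IH//; exact: bmf_cons.
Qed.

Lemma JintB k (f g : k.-tuple T -> C) : bmf f -> bmf g ->
  Jint (fun t => f t - g t) = Jint f - Jint g.
Proof.
move=> mf mg; rewrite JintD//; last exact: bmfN.
by congr (_ + _); under eq_Jint do rewrite -mulN1r; rewrite JintZ// mulN1r.
Qed.

Lemma Jint0 k : Jint (fun _ : k.-tuple T => 0) = 0.
Proof.
elim: k => [//|k IH]; rewrite JintS -[RHS](cint0 nu).
by apply: eq_cint => v; exact: IH.
Qed.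

Lemma Jint_sum k (n : nat) (F : 'I_n -> k.-tuple T -> C) : (forall i, bmf (F i)) ->
  Jint (fun t => \sum_(i < n) F i t) = \sum_(i < n) Jint (F i).
Proof.
elim: n F => [|n IH] F mF.
  rewrite big_ord0 -[RHS](Jint0 k).
  by apply: eq_Jint => t; rewrite big_ord0.
rewrite big_ord_recl -IH// -JintD//; last exact: bmf_sum.
by apply: eq_Jint => t; rewrite big_ord_recl.
Qed.

Definition del k (j : 'I_k.+1) (u : k.+1.-tuple T) : k.-tuple T :=
  [tuple tnth u (lift j i) | i < k].

Lemma measurable_del k (j : 'I_k.+1) : measurable_fun setT (@del k j).
Proof.
apply/measurable_fun_tnthP => i.
rewrite (_ : _ \o _ = fun u : k.+1.-tuple T => tnth u (lift j i)).
  exact: measurable_tnth.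
by apply/funext => u; rewrite /= tnth_mktuple.
Qed.

(** The [j]-th variable is brought to the outermost integral; the induction exchanges it with one
    variable at a time. *)
Lemma Jint_del k (j : 'I_k.+1) (g : T * k.-tuple T -> C) : bmf g ->
  Jint (fun u => g (tnth u j, del j u)) = cint nu (fun v => Jint (fun t => g (v, t))).
Proof.
elim: k j g => [|k IH] j g mg; rewrite JintS.
  apply: eq_cint => v /=; congr (g (_, _)); last by rewrite !tuple0.
  by rewrite (ord1 j).
have [->|[j' ->]] : j = ord0 \/ exists j', j = lift ord0 j'.
  by case: (unliftP ord0 j) => [j' ->|->]; [right; exists j'|left].
  apply: eq_cint => v; apply: eq_Jint => t; congr (g (_, _)).
  by apply: eq_from_tnth => i; rewrite tnth_mktuple tnthS.
pose g' (v : T) (p : T * k.-tuple T) := g (p.1, tuple_cons (v, p.2)).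
have mg' v : bmf (g' v).
  apply: (bmf_comp (h := fun p : T * k.-tuple T => (p.1, tuple_cons (v, p.2)))) mg.
  apply: measurable_fun_pair => //; apply: measurableT_comp; first exact: measurable_tuple_cons.
  by apply: measurable_fun_pair => //; exact: measurable_cst.
transitivity (cint nu (fun u0 => cint nu (fun v => Jint (fun t => g' u0 (v, t))))).
  apply: eq_cint => u0; rewrite -(IH j' (g' u0) (mg' u0)); apply: eq_Jint => t; congr (g (_, _)).
    by rewrite tnthS.
  apply: eq_from_tnth => i; rewrite tnth_mktuple.
  case: (unliftP ord0 i) => [i' ->|->].
    rewrite [RHS]tnthS tnth_mktuple.
    rewrite (_ : lift (lift ord0 j') (lift ord0 i') = lift ord0 (lift j' i')) ?tnthS//.
    by apply/val_inj; rewrite /= /bump/= !add1n ltnS addnS.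
  rewrite (_ : lift (lift ord0 j') ord0 = ord0)//.
  by apply/val_inj.
rewrite (@cint_fubini _ _ _ _ _ nu nu (fun p => Jint (fun t => g' p.1 (p.2, t)))).
  by apply: eq_cint => v; rewrite JintS.
apply: (@bmf_Jint _ _ _ (fun q : (T * T) * k.-tuple T => g' q.1.1 (q.1.2, q.2))).
apply: (bmf_comp (h := fun q : (T * T) * k.-tuple T => (q.1.2, tuple_cons (q.1.1, q.2)))) mg.
apply: measurable_fun_pair; first exact: measurableT_comp.
apply: measurableT_comp; first exact: measurable_tuple_cons.
by apply: measurable_fun_pair => //; exact: measurableT_comp.
Qed.

Lemma bmf_det d' (X : measurableType d') n (A : X -> 'M[C]_n) :
  (forall i j, bmf (fun x => A x i j)) -> bmf (fun x => \det (A x)).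
Proof.
move=> mA; apply: bmf_sum => s _; apply: bmfZ; apply: bmf_prod => i _; exact: mA.
Qed.

End iterated_integral.

Section fredholm.
Variable R : realType.
Local Notation C := R[i].
Context d (T : measurableType d) (nu : {finite_measure set T -> \bar R}).
Variables (K : T -> T -> C) (mK : bmker K).
Local Notation Jint := (Jint nu).
Local Notation Kop := (Kop nu).
Local Notation Kpow := (Kpow nu K).

Definition gram k (x z : k.-tuple T) : 'M[C]_k := \matrix_(i, j) K (tnth x i) (tnth z j).

(** For the kernel of a determinantal process and Lebesgue measure on [D], this is the [k]-th
    factorial moment of the number of points in [D]. Bordering by [x] and [y], as in [fminor], gives
    the terms of Fredholm's first minor. *)
Definition fmom k : C := Jint (fun z : k.-tuple T => \det (gram z z)).
Definition fminor k (x y : T) : C :=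
  Jint (fun z : k.-tuple T => \det (gram (tuple_cons (x, z)) (tuple_cons (y, z)))).

Lemma bmf_gram d' (X : measurableType d') k (f g : X -> k.-tuple T) :
  measurable_fun setT f -> measurable_fun setT g ->
  bmf (fun x => \det (gram (f x) (g x))).
Proof.
move=> mf mg; apply: bmf_det => i j.
apply: (bmf_ext (f := fun x => K (tnth (f x) i) (tnth (g x) j))) => [x|]; first by rewrite mxE.
apply: (bmf_comp (h := fun x => (tnth (f x) i, tnth (g x) j)) _ mK).
by apply: measurable_fun_pair; apply: measurableT_comp (measurable_tnth _) _.
Qed.

Lemma measurable_cons_l k x : measurable_fun setT (fun z : k.-tuple T => tuple_cons (x, z)).
Proof.
apply: measurableT_comp; first exact: measurable_tuple_cons.
by apply: measurable_fun_pair => //; exact: measurable_cst.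
Qed.

Lemma bmf_fminor k : bmf (fun p : T * T => fminor k p.1 p.2).
Proof.
apply: (@bmf_Jint _ _ _ nu k _ _ (fun q : (T * T) * k.-tuple T =>
   \det (gram (tuple_cons (q.1.1, q.2)) (tuple_cons (q.1.2, q.2))))).
by apply: bmf_gram; (apply: measurableT_comp; first exact: measurable_tuple_cons);
  apply: measurable_fun_pair => //; exact: measurableT_comp.
Qed.

Lemma fmomS k : fmom k.+1 = cint nu (fun v => fminor k v v).
Proof. by []. Qed.

Lemma fmom0 : fmom 0 = 1.
Proof. by rewrite /fmom /= det_mx00. Qed.

Lemma fminor0 x y : fminor 0 x y = K x y.
Proof. by rewrite /fminor /= det_mx11 mxE. Qed.

(** Expansion along the row of [x]: in the minor of the column of [z_j], moving the row of [z_j] to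
    the top gives again a bordered Gram determinant. *)
Lemma det_gram_expand k x y (z : k.+1.-tuple T) :
  \det (gram (tuple_cons (x, z)) (tuple_cons (y, z))) =
  K x y * \det (gram z z) - \sum_(j < k.+1) K x (tnth z j) *
    \det (gram (tuple_cons (tnth z j, del j z)) (tuple_cons (y, del j z))).
Proof.
rewrite (expand_det_row _ ord0) big_ord_recl; congr (_ + _).
  rewrite mxE /cofactor expr0 mul1r; congr (_ * \det _).
  by apply/matrixP => i j; rewrite !mxE !tnthS.
rewrite -sumrN; apply: eq_bigr => j _; rewrite mxE tnthS -mulrN; congr (_ * _).
set M := gram (tuple_cons (tnth z j, del j z)) _.
rewrite /cofactor.
(* The permutation has sign [(-1)^j] and the cofactor [(-1)^(j+1)], so each term comes with the sign
   [-1]. *)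
have -> : row' ord0 (col' (lift ord0 j) (gram (tuple_cons (x, z)) (tuple_cons (y, z)))) =
    row_perm (lift_perm j ord0 1) M.
  apply/matrixP => i l; rewrite !mxE tnthS; congr (K _ _).
    case: (unliftP j i) => [i' ->|->]; last by rewrite lift_perm_id.
    by rewrite lift_perm_lift perm1 tnthS tnth_mktuple.
  case: (unliftP ord0 l) => [l' ->|->].
    rewrite [RHS]tnthS tnth_mktuple.
    rewrite (_ : lift (lift ord0 j) (lift ord0 l') = lift ord0 (lift j l')) ?tnthS//.
    by apply/val_inj; rewrite /= /bump/= !add1n ltnS addnS.
  rewrite (_ : lift (lift ord0 j) ord0 = ord0)//.
  by apply/val_inj.
rewrite row_permE det_mulmx det_perm odd_lift_perm odd_perm1 addbF/= addbF.
rewrite signr_odd mulrA -exprD /bump/= add0n add1n addSn addnn exprS.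
by rewrite -mul2n exprM sqrrN !expr1n mulr1 mulN1r.
Qed.

(** After integration all [k.+1] terms of the expansion are equal by symmetry. *)
Lemma fminorS k x y : fminor k.+1 x y =
  K x y * fmom k.+1 - k.+1%:R * Kop K (fun v => fminor k v y) x.
Proof.
have m1 : bmf (fun z : k.+1.-tuple T => \det (gram z z)) by exact: bmf_gram.
have mg : bmf (fun p : T * k.-tuple T =>
    K x p.1 * \det (gram (tuple_cons p) (tuple_cons (y, p.2)))).
  apply: bmfM; first exact: (bmf_comp measurable_fst (bmker_row x mK)).
  apply: bmf_gram; first exact: measurable_tuple_cons.
  apply: measurableT_comp; first exact: measurable_tuple_cons.
  by apply: measurable_fun_pair => //; exact: measurable_cst.
have mj j : bmf (fun z : k.+1.-tuple T => K x (tnth z j) *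
    \det (gram (tuple_cons (tnth z j, del j z)) (tuple_cons (y, del j z)))).
  apply: (bmf_comp (h := fun z => (tnth z j, del j z)) _ mg).
  by apply: measurable_fun_pair; [exact: measurable_tnth|exact: measurable_del].
rewrite /fminor; under eq_Jint do rewrite det_gram_expand.
rewrite JintB; [|by apply: bmfZ|by apply: bmf_sum].
rewrite JintZ// Jint_sum//; congr (_ - _).
rewrite (eq_bigr (fun=> Kop K (fun v => fminor k v y) x)); last first.
  move=> j _; rewrite (Jint_del nu j mg) Kop_cint; apply: eq_cint => v.
  by rewrite /fminor -JintZ//; apply: bmf_gram; exact: measurable_cons_l.
by rewrite sumr_const card_ord mulr_natl.
Qed.

(* Taylor coefficients of the Fredholm determinant and of the first Fredholm minor, up to sign. *)
Definition ecoef k : C := fmom k / (k`!)%:R.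
Definition bcoef k x y : C := fminor k x y / (k`!)%:R.

Lemma factC_neq0 k : (k`!)%:R != 0 :> C.
Proof. by rewrite pnatr_eq0 -lt0n fact_gt0. Qed.

Lemma bcoefS k x y : bcoef k.+1 x y = ecoef k.+1 * K x y - Kop K (fun v => bcoef k v y) x.
Proof.
have h := factC_neq0 k; have h1 : k.+1%:R != 0 :> C by rewrite pnatr_eq0.
rewrite /bcoef /ecoef fminorS.
have -> : Kop K (fun v => fminor k v y / k`!%:R) x = (k`!%:R)^-1 * Kop K (fun v => fminor k v y) x.
  rewrite -[RHS]/((fun z => (k`!%:R)^-1 * Kop K (fun v => fminor k v y) z) x) -KopZ//.
    by congr Kop; apply/funext => v; rewrite mulrC.
  exact: (bmf_comp (pair2_measurable y) (bmf_fminor k)).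
rewrite factS natrM; field.
by rewrite h nat1r h1.
Qed.

(** The recursion unrolled: coefficientwise, the first minor is the Fredholm determinant times the
    Neumann series of the resolvent. *)
Lemma bcoefE k x y : bcoef k x y =
  \sum_(j < k.+1) (-1) ^+ j * ecoef (k - j)%N * Kpow j (K ^~ y) x.
Proof.
elim: k x => [|k IH] x.
  by rewrite big_ord1 /bcoef /ecoef fminor0 fmom0 subnn fact0 expr0 !divr1 !mul1r.
have my : bmf (K ^~ y) by exact: bmker_col.
rewrite bcoefS big_ord_recl subn0 expr0 mul1r; congr (_ + _).
rewrite (_ : (fun v => bcoef k v y) = fun v =>
  \sum_(j < k.+1) (-1) ^+ j * ecoef (k - j)%N * Kpow j (K ^~ y) v); last exact/funext.
pose F j := Kpow j (K ^~ y).
have mF j : bmf (F j) by exact: bmf_Kpow.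
have := Kpow_lin nu mK 1 k.+1 (fun j => (-1) ^+ j * ecoef (k - j)%N) mF.
rewrite /Kpow/= => /(congr1 (fun h => h x)) ->; rewrite -sumrN.
apply: eq_bigr => j _; rewrite /bump leq0n add1n subSS exprS !mulN1r !mulNr//.
Qed.

Lemma bmf_Kpow_diag j : bmf (fun v => Kpow j (K ^~ v) v).
Proof.
have mF : bmf (fun p : T * T => Kpow j (K ^~ p.1) p.2).
  elim: j => [|j IH].
    apply: (@bmf_comp _ _ _ _ _ (fun p : T * T => (p.2, p.1)) (fun p => K p.1 p.2)) => //.
    exact: measurable_swap.
  apply: (bmf_ext (f := fun p : T * T => cint nu (fun v => K p.2 v * Kpow j (K ^~ p.1) v))) => [p|].
    by rewrite KpowS Kop_cint.
  apply: (@bmf_cint _ _ _ nu _ _ (fun q : (T * T) * T => K q.1.2 q.2 * Kpow j (K ^~ q.1.1) q.2)).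
  apply: bmfM.
    apply: (@bmf_comp _ _ _ _ _ (fun q : (T * T) * T => (q.1.2, q.2)) (fun p => K p.1 p.2)) => //.
    apply: measurable_fun_pair => //; exact: measurableT_comp.
  apply: (@bmf_comp _ _ _ _ _ (fun q : (T * T) * T => (q.1.1, q.2)) _ _ IH).
  apply: measurable_fun_pair => //; exact: measurableT_comp.
apply: (bmf_comp (h := fun v : T => (v, v)) _ mF).
exact: measurable_fun_pair.
Qed.

(** Set [x = y] in the expansion of the first minor and integrate: the minor becomes the next
    Fredholm coefficient and the iterated kernels become traces. *)
Lemma ecoef_newton k : k.+1%:R * ecoef k.+1 =
  \sum_(j < k.+1) (-1) ^+ j * ecoef (k - j)%N * trace nu K j.
Proof.
have h := factC_neq0 k; have h1 : k.+1%:R != 0 :> C by rewrite pnatr_eq0.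
have -> : k.+1%:R * ecoef k.+1 = cint nu (fun v => bcoef k v v).
  rewrite /bcoef cintZr; last first.
    by apply: (bmf_comp (h := fun v : T => (v, v)) _ (bmf_fminor k)); exact: measurable_fun_pair.
  rewrite -fmomS /ecoef factS natrM; field; by rewrite h nat1r h1.
under eq_cint do rewrite bcoefE.
rewrite cint_sum => [|j _]; last by apply: bmfZ; exact: bmf_Kpow_diag.
by apply: eq_bigr => j _; rewrite cintZ//; exact: bmf_Kpow_diag.
Qed.

Hypothesis treal : forall n, trace nu K n = (rtrace nu K n)%:C.

Definition recoef k : R := Re (ecoef k).

Lemma ecoef_real k : ecoef k = (recoef k)%:C.
Proof.
elim/ltn_ind: k => -[|k] IH; first by rewrite /recoef /ecoef fmom0 fact0 divr1.
have h1 : k.+1%:R != 0 :> C by rewrite pnatr_eq0.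
have [x hx] : exists x : R, ecoef k.+1 = x%:C; last by rewrite /recoef hx.
exists (k.+1%:R^-1 * \sum_(j < k.+1) (-1) ^+ j * recoef (k - j)%N * rtrace nu K j).
have hk : k.+1%:R = (k.+1%:R : R)%:C :> C by rewrite rmorph_nat.
have h2 : k.+1%:R != 0 :> R by rewrite pnatr_eq0.
apply: (mulfI h1); rewrite ecoef_newton hk -rmorphM.
rewrite mulrA mulfV// mul1r rmorph_sum; apply: eq_bigr => j _.
by rewrite !rmorphM rmorphXn rmorphN1 treal IH// ltnS leq_subr.
Qed.

Lemma recoef_newton : newton (rtrace nu K) recoef.
Proof.
split=> [|k]; first by rewrite /recoef /ecoef fmom0 fact0 divr1.
have hk : k.+1%:R = (k.+1%:R : R)%:C :> C by rewrite rmorph_nat.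
apply: (@complexI R).
transitivity ((k.+1%:R : R)%:C * (recoef k.+1)%:C); first by rewrite -rmorphM.
rewrite -ecoef_real -hk ecoef_newton rmorph_sum; apply: eq_bigr => j _.
by rewrite !rmorphM rmorphXn rmorphN1 treal ecoef_real.
Qed.

End fredholm.

(** * Restricted measures and integrals over powers of a set *)

Section restriction.
Context d (T : measurableType d) (R : realType) (mu : {measure set T -> \bar R}).
Variables (D : set T) (mD : measurable D) (moo : (mu D < +oo)%E).

Lemma ge0_integral_mfrestr (f : T -> \bar R) : measurable_fun setT f ->
  (forall x, 0 <= f x)%E ->
  (\int[mfrestr mD moo]_x f x = \int[mu]_(x in D) f x)%E.
Proof.
move=> mf f0.
rewrite (@ge0_negligible_integral _ _ _ (mfrestr mD moo) setT (~` D))//=; last 2 first.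
- exact: measurableC.
- by rewrite /mfrestr /mrestr setICl measure0.
rewrite setTD setCK; apply: eq_measure_integral => A mA AD.
by rewrite /= /mfrestr /mrestr setIidl.
Qed.

Lemma integral_mfrestr (f : T -> \bar R) : measurable_fun setT f ->
  (\int[mfrestr mD moo]_x f x = \int[mu]_(x in D) f x)%E.
Proof.
move=> mf; rewrite [LHS]integralE [RHS]integralE.
rewrite !ge0_integral_mfrestr//; [exact: measurable_funeneg|exact: measurable_funepos].
Qed.

End restriction.

Section power_integral.
Variable R : realType.
Local Notation C := R[i].
Context d (T : measurableType d) (m : {sigma_finite_measure set T -> \bar R}).
Variables (D : set T) (mD : measurable D) (moo : (m D < +oo)%E).
Local Notation nu := (mfrestr mD moo).

Definition cube k : set (k.-tuple T) := [set t | forall i, D (tnth t i)].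

Lemma cubeS k v (t : k.-tuple T) : cube (tuple_cons (v, t)) <-> D v /\ cube t.
Proof.
split=> [h|[h1 h2] i].
  split; first by have := h ord0; rewrite tnth0.
  by move=> i; have := h (lift ord0 i); rewrite tnthS.
by case: (unliftP ord0 i) => [j ->|->]; rewrite ?tnth0// tnthS; exact: h2.
Qed.

Lemma measurable_cube k : measurable (@cube k).
Proof.
rewrite (_ : @cube k = \bigcap_(i in [set: 'I_k]) ((fun t : k.-tuple T => tnth t i) @^-1` D)).
  apply: fin_bigcap_measurable; first exact: finite_finset.
  by move=> i _; rewrite -[X in measurable X]setTI; exact: measurable_tnth.
by apply/seteqP; split => t h i; [move=> _; exact: h|exact: h].
Qed.

Lemma Jint_Re k (f : k.-tuple T -> C) : bmf f ->
  Jint nu (fun z => (Re (f z))%:C) = (Re (Jint nu f))%:C.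
Proof.
elim: k f => [//|k IH] f mf; rewrite !JintS Re_cint -cint_real.
by apply: eq_cint => v; rewrite IH//; exact: bmf_cons.
Qed.

Lemma ge0_integral_cube k (g : k.-tuple T -> R) (M : R) :
  measurable_fun setT g -> (forall t, 0 <= g t <= M) ->
  (\int[power_measure m k]_(z in @cube k) (g z)%:E = (Re (Jint nu (fun t => (g t)%:C)))%:E)%E.
Proof.
elim: k g => [|k IH] g mg gM.
  rewrite /= integral_dirac//; last 2 first.
    exact: measurable_cube.
    by apply/measurable_EFinP; exact: measurable_funTS.
  by rewrite diracE mem_set ?mul1e//; move=> [].
have g0 t : 0 <= g t by case/andP: (gM t).
pose F (p : T * k.-tuple T) : \bar R := ((fun z => (g z)%:E) \_ (@cube k.+1)) (tuple_cons p).
have mF : measurable_fun setT F.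
  apply: (@measurableT_comp _ _ _ _ _ _ ((fun z => (g z)%:E) \_ (@cube k.+1))).
    apply/measurable_restrict => //; first exact: measurable_cube.
    by apply/measurable_EFinP; exact: measurable_funTS.
  exact: measurable_tuple_cons.
have F0 p : (0 <= F p)%E by rewrite /F patchE; case: ifP => // _; rewrite lee_fin.
transitivity (\int[(m \x power_measure m k)%E]_p F p)%E.
  rewrite integral_mkcond.
  rewrite [LHS](_ : _ = \int[pushforward (m \x power_measure m k)%E (@tuple_cons _ T k)]_z
    (((fun z => (g z)%:E) \_ (@cube k.+1)) z))%E//.
  rewrite ge0_integral_pushforward//.
  - exact: measurable_tuple_cons.
  - apply/measurable_restrict => //; first exact: measurable_cube.
    by apply/measurable_EFinP; exact: measurable_funTS.
  - by move=> z _; rewrite patchE; case: ifP => // _; rewrite lee_fin.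
rewrite fubini_tonelli1// /fubini_F.
have mgv v : measurable_fun setT (fun t : k.-tuple T => g (tuple_cons (v, t))).
  apply: measurableT_comp mg _; apply: measurableT_comp (@measurable_tuple_cons _ _ _) _.
  exact: pair1_measurable.
transitivity (\int[m]_(v in D) (Re (Jint nu (fun t : k.-tuple T => (g (tuple_cons (v, t)))%:C)))%:E)%E.
  rewrite [RHS]integral_mkcond; apply: eq_integral => v _.
  rewrite patchE; case: ifPn => vD.
    rewrite -IH// [RHS]integral_mkcond; apply: eq_integral => t _.
    rewrite /F !patchE; move: vD; rewrite inE => vD.
    have [ct|ct] := boolP (t \in @cube k).
      by rewrite mem_set//; apply/cubeS; split=> //; rewrite inE in ct.
    by rewrite memNset// => /cubeS[_ h]; move/negP: ct; apply; rewrite inE.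
  rewrite -[RHS](integral0 (power_measure m k) setT); apply: eq_integral => t _.
  rewrite /F patchE memNset// => /cubeS[h _]; move/negP: vD; apply; by rewrite inE.
have mg' : bmf (fun t : k.+1.-tuple T => (g t)%:C : C).
  by apply: bmf_real => //; exists M => t; rewrite ger0_norm//; case/andP: (gM t).
have mJ := bmf_Jint_cons nu mg'.
rewrite JintS Re_cint /Rintegral fineK; last first.
  apply: integrable_fin_num => //; exact: (bmf_intRe nu mJ).
rewrite integral_mfrestr//.
by apply/measurable_EFinP; case: mJ.
Qed.

Lemma cube_lty k : (power_measure m k (@cube k) < +oo)%E.
Proof.
have h : (\int[power_measure m k]_(z in @cube k) (1 : R)%:E =
    (Re (Jint nu (fun _ : k.-tuple T => (1 : R)%:C)))%:E)%E.
  by apply: (@ge0_integral_cube k (fun=> 1) 1) => // t; rewrite ler01 lexx.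
rewrite -[X in (X < _)%E]mul1e -integral_cst; last exact: measurable_cube.
by rewrite h ltry.
Qed.

Lemma integral_cube k (f : k.-tuple T -> C) : bmf f ->
  (\int[power_measure m k]_(z in @cube k) (Re (f z))%:E = (Re (Jint nu f))%:E)%E.
Proof.
move=> mf; have [mR mI [M0 fM0]] := mf.
have mC := @measurable_cube k; pose M := `|M0|.
have fM z : normc (f z) <= M by rewrite (le_trans (fM0 z))// ler_norm.
(* The nonnegative case is applied to [Re f + M] and to the constant [M], then subtracted. *)
have bM z : 0 <= Re (f z) + M <= M + M.
  have := fM z; have := normc_Re (f z); rewrite ler_norml => /andP[]; lra.
have iR : (power_measure m k).-integrable (@cube k) (EFin \o (fun z => Re (f z))).
  apply: measurable_bounded_integrable => //; first exact: cube_lty.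
    exact: measurable_funTS.
  exists M; split; first exact: num_real.
  by move=> y My z _ /=; rewrite (le_trans (normc_Re _))// (le_trans (fM _))// ltW.
have iM : (power_measure m k).-integrable (@cube k) (EFin \o (fun=> M)).
  apply: measurable_bounded_integrable => //; first exact: cube_lty.
  exists `|M|; split; first exact: num_real.
  by move=> y My z _ /=; exact: ltW.
have h1 := @ge0_integral_cube k (fun z => Re (f z) + M) (M + M)
  (measurable_funD mR (measurable_cst _)) bM.
have h2 : (\int[power_measure m k]_(z in @cube k) (Re (f z) + M)%:E =
   \int[power_measure m k]_(z in @cube k) (Re (f z))%:E +
   \int[power_measure m k]_(z in @cube k) M%:E)%E by rewrite -integralD_EFin.
have h3 := @ge0_integral_cube k (fun=> M) M (measurable_cst _) _.
have mRf : bmf (fun z => (Re (f z))%:C : C).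
  by apply: bmf_real => //; exists M => z; exact: le_trans (normc_Re _) (fM z).
have h4 : Jint nu (fun z => (Re (f z) + M)%:C) =
    (Re (Jint nu f))%:C + Jint nu (fun _ : k.-tuple T => M%:C).
  rewrite -Jint_Re// -JintD//; last exact: bmf_cst.
  by apply: eq_Jint => z; rewrite -rmorphD.
move: h2; rewrite h1 h3; last by move=> t; rewrite lexx normr_ge0.
rewrite h4 ReD Re_real EFinD => /(congr1 (fun y => y - (Re (Jint nu (fun _ : k.-tuple T => M%:C)))%:E)%E).
by rewrite !addeK.
Qed.

End power_integral.

(** Bonferroni's inequalities: the remainder [r m N] has the sign [(-1)^m] and is at most the first
    omitted term, by induction with Pascal's rule. This controls the expectation of each truncation
    without a bound on the whole series. *)
Lemma falling_alternating (R : realType) (s : R) N m : 0 <= s <= 1 ->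
  `|(1 - s) ^+ N - \sum_(k < m) (- s) ^+ k * ('C(N, k))%:R| <= s ^+ m * ('C(N, m))%:R.
Proof.
move=> /andP[s0 s1].
pose r m N := (1 - s) ^+ N - \sum_(k < m) (- s) ^+ k * ('C(N, k))%:R.
have rS k n : r k.+1 n.+1 = r k.+1 n - s * r k n.
  rewrite /r exprS !big_ord_recl !bin0.
  have -> : \sum_(i < k) (- s) ^+ bump 0 i * ('C(n.+1, bump 0 i))%:R =
     \sum_(i < k) (- s) ^+ bump 0 i * ('C(n, bump 0 i))%:R -
     s * \sum_(i < k) (- s) ^+ i * ('C(n, i))%:R.
    rewrite mulr_sumr -sumrB; apply: eq_bigr => i _.
    rewrite /bump leq0n add1n binS natrD exprS; ring.
  ring.
suff H k n : 0 <= (-1) ^+ k * r k n <= s ^+ k * ('C(n, k))%:R.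
  rewrite -/(r m N); have /andP[h0 h1] := H m N.
  by rewrite -[X in X <= _]ger0_norm// normrM normrX normrN1 expr1n mul1r in h1.
elim: n k => [|n IH] [|k].
- rewrite /r big_ord0 !expr0 subr0 !mul1r; by rewrite ?bin0 ler01 lexx.
- rewrite /r bin0n /= mulr0 expr0 big_ord_recl expr0 bin0 mul1r big1.
    by rewrite addr0 subrr mulr0 lexx.
  by move=> i _; rewrite bin0n mulr0.
- rewrite /r big_ord0 !expr0 subr0 !mul1r bin0 exprn_ge0 ?subr_ge0//=.
  by rewrite exprn_ile1// ?subr_ge0// gerBl.
- rewrite rS binS natrD; have /andP[a b] := IH k.+1; have /andP[c e] := IH k.
  have -> : (-1) ^+ k.+1 * (r k.+1 n - s * r k n) =
     (-1) ^+ k.+1 * r k.+1 n + s * ((-1) ^+ k * r k n) by rewrite exprS; ring.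
  apply/andP; split; first by apply: addr_ge0 => //; exact: mulr_ge0.
  apply: (le_trans (lerD b (ler_wpM2l s0 e))).
  by rewrite [leRHS]mulrDr [in X in _ <= _ + X]exprS mulrA.
Qed.

Section counting.
Variable R : realType.
Local Notation C := R[i].

Lemma counting_fin (T : choiceType) (A : set T) : finite_set A ->
  counting A = (#|` fset_set A|)%:R%:E :> \bar R.
Proof. by move=> fA; rewrite /counting asboolT. Qed.

Lemma counting_distinct_tuples (A : set C) k : finite_set A ->
  counting (distinct_tuples (k := k) A) = ((#|` fset_set A| ^_ k)%:R)%:E :> \bar R.
Proof.
move=> fA; pose A0 := fset_set A.
pose S : {set k.-tuple A0} := finset (fun t : k.-tuple A0 => uniq t).
pose fs : {fset k.-tuple C} := [fset (map_tuple (@fsval _ A0) t : k.-tuple C) | t in S]%fset.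
have -> : distinct_tuples (k := k) A = [set` fs].
  apply/seteqP; split => t /=.
    move=> [ut At]; apply/imfsetP => /=.
    have tA i : tnth t i \in A0 by rewrite in_fset_set//; exact: mem_set.
    exists [tuple [` tA i]%fset | i < k].
      rewrite inE; apply/tuple_uniqP => i j; rewrite !tnth_mktuple => /(congr1 val)/= h.
      by move/tuple_uniqP : ut; exact.
    by apply: eq_from_tnth => i; rewrite tnth_map tnth_mktuple.
  move=> /imfsetP[/= u]; rewrite inE => uu ->; split.
    by rewrite /= map_inj_uniq//; exact: val_inj.
  move=> i; rewrite tnth_map; have := fsvalP (tnth u i).
  by rewrite in_fset_set// => /set_mem.
rewrite counting_fin; last exact: finite_fset.
rewrite set_fsetK; congr (_%:R%:E); rewrite card_imfset/=.
  rewrite -cardE (_ : #|_| = #|S|)//.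
  rewrite -[X in (X ^_ _)%N]/(#|` A0|) cardfE -card_uniq_tuples.
  by apply: eq_card => t; rewrite !inE andb_idl// => _; apply/allP.
move=> t u /(congr1 val)/= tu; apply: val_inj => /=.
exact: (inj_map val_inj) tu.
Qed.

End counting.

(** * Void probabilities of determinantal processes *)

Section void_probability.
Variable R : realType.
Local Notation C := R[i].
Local Notation mu := (@lebesgue_complex R).
Context d (Omega : measurableType d) (P : probability Omega R).
Variables (psi : Omega -> set C) (K : C -> C -> C).
Variables (D : set C) (mD : measurable D) (moo : (mu D < +oo)%E).
Variables (rad : R) (Drad : forall z, D z -> normc z <= rad).
Hypothesis hpsi : determinantal P psi K.
Hypothesis mK : bmker K.
Local Notation nu := (mfrestr mD moo).

Definition npts (w : Omega) : nat := #|` fset_set (psi w `&` D)|.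

Lemma finite_pts w : finite_set (psi w `&` D).
Proof.
have [[lf _] _] := hpsi; apply: sub_finite_set (lf w rad) => z [pz Dz].
by split=> //=; rewrite normC lecR Drad.
Qed.

Lemma npts0P w : npts w = 0%N <-> psi w `&` D = set0.
Proof.
split=> [/cardfs0_eq h|h]; last by rewrite /npts h fset_set0 cardfs0.
by rewrite -(fset_setK (finite_pts w)) h set_fset0.
Qed.

Lemma measurable_npts : measurable_fun setT npts.
Proof.
have [[_ mc] _] := hpsi.
have mN : measurable_fun setT (fun w => (npts w)%:R%:E : \bar R).
  rewrite (_ : (fun w => _) = fun w => counting (psi w `&` D)); first exact: mc.
  by apply/funext => w; rewrite counting_fin//; exact: finite_pts.
move=> _ A _; rewrite setTI.
rewrite (_ : npts @^-1` A = \bigcup_(n in A) npts @^-1` [set n]); last first.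
  by apply/seteqP; split => [w Aw|w [n An /= ->]]; [exists (npts w)|].
apply: bigcup_measurable => n _.
rewrite (_ : _ @^-1` _ = (fun w => (npts w)%:R%:E : \bar R) @^-1` [set n%:R%:E]).
  by rewrite -[X in measurable X]setTI; exact: mN.
apply/seteqP; split => w /=; first by move=> ->.
by move=> [] /eqP; rewrite eqr_nat => /eqP.
Qed.

Lemma measurable_nat_comp (f : nat -> R) : measurable_fun setT (fun w => f (npts w)).
Proof. by apply: measurableT_comp measurable_npts. Qed.

Local Notation rec := (recoef nu K).

Lemma integral_bin_npts k : (\int[P]_w (('C(npts w, k))%:R : R)%:E = (rec k)%:E)%E.
Proof.
have fE : (\int[P]_w ((npts w ^_ k)%:R : R)%:E = (Re (fmom nu K k))%:E)%E.
  (* [determinantal] speaks of positive [k] only; for [k = 0] both sides are 1. *)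
  case: k => [|k].
    rewrite fmom0 /=; under eq_integral do rewrite ffactn0.
    by rewrite integral_cst// mul1e; exact: probability_setT.
  have mCu : measurable (@cube _ _ D k.+1) by exact: measurable_cube.
  have [_ /(_ k.+1 _ isT mCu)] := hpsi.
  rewrite (_ : (fun w => counting _) = fun w => ((npts w ^_ k.+1)%:R : R)%:E); last first.
    apply/funext => w; rewrite -counting_distinct_tuples; last exact: finite_pts.
    congr counting; apply/seteqP; split => [t [[ut pt] Dt]|t [ut pt]]; split=> //.
    - by split=> //; move=> i; have [] := pt i.
    - by move=> i; have [] := pt i.
  have mg : bmf (fun z : k.+1.-tuple C => \det (gram K z z)).
    by apply: bmf_gram => //; exact: measurable_id.
  by move=> ->; exact: (integral_cube mD moo mg).
have k0 : (k`!%:R : R) != 0 by rewrite pnatr_eq0 -lt0n fact_gt0.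
have -> : rec k = (k`!%:R)^-1 * Re (fmom nu K k).
  rewrite /recoef /ecoef (_ : k`!%:R = (k`!%:R : R)%:C); last by rewrite rmorph_nat.
  by rewrite -fmorphV ReM Re_real Im_real mulr0 subr0 mulrC.
rewrite EFinM -fE -ge0_integralZl//.
- apply: eq_integral => w _; rewrite -EFinM; congr _%:E.
  by rewrite -bin_ffact natrM mulrCA mulVf// mulr1.
- by apply/measurable_EFinP; exact: (measurable_nat_comp (fun n => (n ^_ k)%:R)).
Qed.

Lemma integrable_bin_npts k : P.-integrable setT (EFin \o (fun w => ('C(npts w, k))%:R : R)).
Proof.
apply/integrableP; split.
  by apply/measurable_EFinP; exact: (measurable_nat_comp (fun n => ('C(n, k))%:R)).
rewrite (_ : (\int[P]_x `| _ |)%E = (rec k)%:E) ?ltry// -integral_bin_npts.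
by apply: eq_integral => w _ /=; rewrite ger0_norm.
Qed.

Lemma Rintegral_bin_npts k : \int[P]_w ('C(npts w, k))%:R = rec k.
Proof. by rewrite /Rintegral integral_bin_npts. Qed.

(** By [falling_alternating] the [m]-th truncation errs by at most [s^m] times a binomial moment,
    which is [s ^+ m * rec m]. *)
Lemma generating_function (s : R) : 0 <= s <= 1 ->
  (fun m => s ^+ m * rec m) @ \oo --> (0 : R) ->
  altsum rec s @ \oo --> \int[P]_w ((1 - s) ^+ npts w).
Proof.
move=> s01 tail; have /andP[s0 s1] := s01.
have iG : P.-integrable setT (EFin \o (fun w => (1 - s) ^+ npts w)).
  apply: measurable_bounded_integrable => //.
  - by rewrite ltey_eq fin_num_measure.
  - exact: (measurable_nat_comp (fun n => (1 - s) ^+ n)).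
  exists 1; split; first exact: num_real.
  move=> y y1 w _ /=; rewrite normrX (le_trans _ (ltW y1))// exprn_ile1//.
  by rewrite ger0_norm; lra.
have iZ (r : R) k : P.-integrable setT (EFin \o (fun w => r * ('C(npts w, k))%:R)).
  by have := integrable_bin_npts k; exact: integrableZl.
have iS m : P.-integrable setT (EFin \o (fun w => \sum_(k < m) (- s) ^+ k * ('C(npts w, k))%:R)).
  elim: m => [|m IH].
    rewrite (_ : _ \o _ = fun=> 0%E); first exact: integrable0.
    by apply/funext => w /=; rewrite big_ord0.
  rewrite (_ : _ \o _ = ((EFin \o (fun w => (\sum_(k < m) (- s) ^+ k * ('C(npts w, k))%:R)%R)) \+
     (fun w => ((- s) ^+ m)%:E * (EFin \o (fun w => ('C(npts w, m))%:R)) w))%E).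
    apply: integrableD => //; apply: integrableZl => //; exact: integrable_bin_npts.
  by apply/funext => w /=; rewrite big_ord_recr.
have SE m : \int[P]_w (\sum_(k < m) (- s) ^+ k * ('C(npts w, k))%:R) = altsum rec s m.
  elim: m => [|m IH].
    rewrite /altsum big_ord0 -[RHS](mul0r (fine (P setT))) -Rintegral_cst//.
    by apply: eq_Rintegral => w _; rewrite big_ord0.
  rewrite /altsum big_ord_recr/= -/(altsum rec s m) -IH -Rintegral_bin_npts.
  rewrite -RintegralZl//; last exact: integrable_bin_npts.
  rewrite -RintegralD; [|by []|exact: iS|exact: iZ].
  by apply: eq_Rintegral => w _; rewrite big_ord_recr.
have iB m : P.-integrable setT (EFin \o (fun w =>
    (1 - s) ^+ npts w - \sum_(k < m) (- s) ^+ k * ('C(npts w, k))%:R)).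
  by have := iG; have := iS m; move=> h1 h2; exact: (integrableB measurableT h2 h1).
apply/cvgrPdist_le => e e0; have /cvgrPdist_le /(_ _ e0) [M _ hM] := tail.
exists M => // m /hM /=; rewrite sub0r normrN => h; apply: le_trans h.
rewrite -SE -RintegralB//; apply: (le_trans (le_normr_Rintegral measurableT (iB m))).
apply: (@le_trans _ _ (\int[P]_w (s ^+ m * ('C(npts w, m))%:R))).
  apply: le_Rintegral => //.
    exact: (integrable_norm (iB m)).
  by move=> w _; exact: falling_alternating.
rewrite RintegralZl//; last exact: integrable_bin_npts.
by rewrite Rintegral_bin_npts ler_norm.
Qed.

(** [(1 - 1) ^+ n] is 1 for [n = 0] and 0 otherwise. *)
Lemma void_Rintegral : \int[P]_w ((1 - 1) ^+ npts w) = fine (P [set w | psi w `&` D = set0]).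
Proof.
rewrite /Rintegral; congr fine; rewrite -(setIT [set w | _]) -integral_indic//; last first.
  rewrite (_ : [set w | _] = npts @^-1` [set 0%N]).
    by rewrite -[X in measurable X]setTI; exact: measurable_npts.
  by apply/seteqP; split => w /=; rewrite npts0P.
apply: eq_integral => w _; rewrite subrr expr0n indicE; congr (_%:R%:E).
have [/npts0P h|h] := eqVneq (npts w) 0%N; first by rewrite mem_set.
by rewrite memNset//= => /npts0P h'; rewrite h' eqxx in h.
Qed.

(** Together with the product formula this excludes eigenvalues greater than 1. *)
Lemma generating_function_gt0 (s : R) : 0 <= s < 1 -> 0 < \int[P]_w ((1 - s) ^+ npts w).
Proof.
move=> /andP[s0 s1].
have pos w : 0 < (1 - s) ^+ npts w by rewrite exprn_gt0// subr_gt0.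
have iG : P.-integrable setT (EFin \o (fun w => (1 - s) ^+ npts w)).
  apply: measurable_bounded_integrable => //.
  - by rewrite ltey_eq fin_num_measure.
  - exact: (measurable_nat_comp (fun n => (1 - s) ^+ n)).
  exists 1; split; first exact: num_real.
  move=> y y1 w _ /=; rewrite normrX (le_trans _ (ltW y1))// exprn_ile1//.
  by rewrite ger0_norm; lra.
rewrite lt_def; apply/andP; split; last by apply: Rintegral_ge0 => w _; exact: ltW.
apply/eqP => h.
have h2 : (\int[P]_w `|((1 - s) ^+ npts w)%:E| = 0)%E.
  have := integrable_fin_num measurableT iG => /fineK /=.
  rewrite -/(Rintegral _ _ _) h => /esym h2; rewrite -[RHS]h2.
  by apply: eq_integral => w _; rewrite /= ger0_norm// ltW.
have mf : measurable_fun setT (fun w => ((1 - s) ^+ npts w)%:E).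
  by apply/measurable_EFinP; exact: (measurable_nat_comp (fun n => (1 - s) ^+ n)).
have /(ae_eq_integral_abs P measurableT mf) [N [mN N0 sub]] := h2.
have : setT `<=` N.
  by move=> w _; apply: sub => /= /(_ I) []/eqP; rewrite gt_eqF.
move=> TN; have l : (P [set: Omega] <= P N)%E by apply: le_measure; rewrite ?inE.
have P1 : P [set: Omega] = 1%E := probability_setT P.
have P0 : P N = 0%E := N0.
by move: l; rewrite P1 P0 lee_fin ler10.
Qed.

End void_probability.

(** * The Ginibre kernel *)

Section exponential_sums.

Definition expsum (F : numFieldType) N (x : F) : F := \sum_(k < N) x ^+ k / k`!%:R.

Lemma triangle_sum (F : numFieldType) (f : nat -> nat -> F) N :
  \sum_(n < N) \sum_(j < n.+1) f j (n - j)%N = \sum_(j < N) \sum_(k < N - j) f j k.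
Proof.
elim: N => [|m IH]; first by rewrite !big_ord0.
rewrite big_ord_recr/= IH [RHS]big_ord_recr/= subSnn big_ord1.
rewrite [X in _ + X]big_ord_recr/= subnn addrA; congr (_ + _).
rewrite -big_split/=; apply: eq_bigr => j _; rewrite subSn; last exact: ltnW.
by rewrite big_ord_recr.
Qed.

(** What remains are the terms outside the triangle [j + k < N]; their coefficients are positive, so
    moduli may be taken termwise. *)
Lemma expsumMB (F : numFieldType) N (x w : F) :
  expsum N x * expsum N w - expsum N (x + w) =
  \sum_(j < N) \sum_(N - j <= k < N) (x ^+ j / j`!%:R) * (w ^+ k / k`!%:R).
Proof.
have -> : expsum N (x + w) =
    \sum_(j < N) \sum_(k < N - j) (x ^+ j / j`!%:R) * (w ^+ k / k`!%:R).
  rewrite -(triangle_sum (fun j k => (x ^+ j / j`!%:R) * (w ^+ k / k`!%:R))).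
  rewrite /expsum; apply: eq_bigr => n _; rewrite addrC exprDn mulr_suml.
  apply: eq_bigr => j _.
  have jn : (j <= n)%N by rewrite -ltnS.
  have := congr1 (fun m => m%:R : F) (bin_fact jn); rewrite !natrM => <-.
  have h m : m`!%:R != 0 :> F by rewrite pnatr_eq0 -lt0n fact_gt0.
  have b : 'C(n, j)%:R != 0 :> F by rewrite pnatr_eq0 -lt0n bin_gt0.
  rewrite -mulr_natr; field.
  by rewrite !h b.
rewrite /expsum mulr_suml -sumrB; apply: eq_bigr => j _.
rewrite mulr_sumr -!(big_mkord xpredT (fun k => x ^+ j / j`!%:R * (w ^+ k / k`!%:R))).
by rewrite (big_cat_nat (n := (N - j)%N)) ?leq_subr//= addrAC subrr add0r.
Qed.

End exponential_sums.

Section complex_exponential.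
Variable R : realType.
Local Notation C := R[i].

Lemma cvg_expsum (x : R) : (fun N => expsum N x) @ \oo --> expR x.
Proof.
rewrite (_ : (fun N => _) = series (exp_coeff x)); first exact: is_cvg_series_exp_coeff.
by apply/funext => N; rewrite /series/= /expsum big_mkord.
Qed.

Lemma expsum_nd (x : R) : 0 <= x -> nondecreasing_seq (fun N => expsum N x).
Proof.
move=> x0; apply/nondecreasing_seqP => N.
by rewrite /expsum big_ord_recr/= lerDl divr_ge0// exprn_ge0.
Qed.

Lemma expsum_le N (x : R) : 0 <= x -> expsum N x <= expR x.
Proof.
move=> x0; rewrite -(cvg_lim (@Rhausdorff R) (@cvg_expsum x)).
by apply: (nondecreasing_cvgn_le (expsum_nd x0)); exact: cvgP (@cvg_expsum x).
Qed.

Lemma fact_real (k : nat) : (k`!%:R : C) = (k`!%:R)%:C.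
Proof. by rewrite -(rmorph_nat (real_complex R)). Qed.

Lemma normc_expterm (x : C) k :
  normc (x ^+ k / k`!%:R) = normc x ^+ k / k`!%:R.
Proof.
rewrite normcM normcX fact_real -fmorphV.
by rewrite (normc_real (k`!%:R^-1)) ger0_norm// invr_ge0.
Qed.

Lemma normc_expsum N (x : C) : normc (expsum N x) <= expsum N (normc x).
Proof.
rewrite (le_trans (normc_sum _ _ _))//; apply: ler_sum => k _.
by rewrite normc_expterm.
Qed.

Lemma normc_expsumMB N (x w : C) :
  normc (expsum N x * expsum N w - expsum N (x + w)) <=
  expsum N (normc x) * expsum N (normc w) - expsum N (normc x + normc w).
Proof.
rewrite !expsumMB (le_trans (normc_sum _ _ _))//; apply: ler_sum => j _.
rewrite (le_trans (normc_sum _ _ _))//; apply: ler_sum => k _.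
by rewrite normcM !normc_expterm.
Qed.

Lemma cvg_expsum_imaginary (y : R) :
  (fun N => expsum N (0 +i* y : C)) @ \oo --> (cos y +i* sin y : C).
Proof.
have E (k : nat) : (0 +i* y : C) ^+ k / k`!%:R = cos_coeff y k +i* sin_coeff y k.
  have -> : (0 +i* y : C) ^+ k =
      (if odd k then 0 else (-1) ^+ k./2 * y ^+ k) +i*
      (if odd k then (-1) ^+ k./2 * y ^+ k else 0).
    elim: k => [|k IH]; first by rewrite !expr0 mul1r.
    rewrite exprS IH /= uphalf_half; case: (odd k) => /=; apply: eqcP;
      rewrite ?ReImE/= ?mul0r ?mulr0 ?sub0r ?subr0 ?addr0 ?add0r ?add1n ?add0n ?exprS; ring.
  rewrite fact_real -fmorphV /cos_coeff /sin_coeff /=.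
  case: (boolP (odd k)) => ok; apply: eqcP; rewrite ?ReImE/= ?mul0r ?mulr0 ?subr0 ?addr0 ?add0r ?mul1r//.
  by case: k ok => //= k ok; rewrite uphalf_half (negbTE ok) add0n.
apply: cvgc_ReIm.
  rewrite (_ : (fun N => _) = series (cos_coeff y)).
    rewrite /= unlock; exact: is_cvg_series_cos_coeff.
  by apply/funext => N; rewrite /series/= /expsum Re_sum big_mkord; apply: eq_bigr => k _; rewrite E.
rewrite (_ : (fun N => _) = series (sin_coeff y)).
  rewrite /= unlock; exact: is_cvg_series_sin_coeff.
by apply/funext => N; rewrite /series/= /expsum Im_sum big_mkord; apply: eq_bigr => k _; rewrite E.
Qed.

Lemma expsum_real N (x : R) : expsum N (x%:C : C) = (expsum N x)%:C.
Proof.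
rewrite /expsum rmorph_sum; apply: eq_bigr => k _.
by rewrite rmorphM rmorphXn fact_real -fmorphV.
Qed.

(** [cexp] is the product of the limits of the series at [Re z] and at [i Im z]. The series at their
    sum differs from the product by an error bounded by the same error at the moduli, which tends to
    0 since [expR] turns sums into products. *)
Lemma cvg_expsum_cexp (z : C) : (fun N => expsum N z) @ \oo --> cexp z.
Proof.
have zE : z = (Re z)%:C + (0 +i* Im z).
  by apply: eqcP; rewrite ReImE/= ?addr0 ?add0r.
set x : C := (Re z)%:C in zE; set w : C := 0 +i* Im z in zE.
have h : (fun N => expsum N x * expsum N w) @ \oo --> cexp z.
  apply: cvgcM; last exact: cvg_expsum_imaginary.
  under eq_fun do rewrite expsum_real.
  exact/cvgc_realP/cvg_expsum.
have h0 : (fun N => expsum N x * expsum N w - expsum N (x + w)) @ \oo --> (0 : C).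
  apply/cvgc_normP; apply: (@squeeze_cvgr _ _ _ _ (cst 0)
    (fun N => expsum N (normc x) * expsum N (normc w) - expsum N (normc x + normc w))).
  - by apply: nearW => N; rewrite normc_ge0 subr0/= normc_expsumMB.
  - exact: cvg_cst.
  rewrite -(subrr (expR (normc x + normc w))) [X in X - _]expRD; apply: cvgB; last exact: cvg_expsum.
  by apply: cvgM; exact: cvg_expsum.
rewrite -(subr0 (cexp z)).
rewrite (_ : (fun N => _) = (fun N => expsum N x * expsum N w - (expsum N x * expsum N w - expsum N (x + w)))).
  exact: (cvgcB h h0).
have sBB (a b : C) : b = a - (a - b) by rewrite opprB addrC subrK.
by apply/funext => N; rewrite {1}zE; exact: sBB.
Qed.

End complex_exponential.

(** * Expansion and determinants of the Ginibre kernel *)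

Section ginibre.
Variable R : realType.
Local Notation C := R[i].
Local Notation K := (@ginibre_kernel R).
Local Notation K0 := (@ginibre_kernel0 R).

Lemma measurable_Re : measurable_fun setT (fun z : C => Re z).
Proof. exact: (measurableT_comp measurable_fst (@measurable_plane_of_complex R)). Qed.

Lemma measurable_Im : measurable_fun setT (fun z : C => Im z).
Proof. exact: (measurableT_comp measurable_snd (@measurable_plane_of_complex R)). Qed.

Lemma measurable_normc2 : measurable_fun setT (fun z : C => normc z ^+ 2).
Proof.
under eq_fun do rewrite normcE2.
by apply: measurable_funD; apply: measurable_funX; [exact: measurable_Re|exact: measurable_Im].
Qed.

Lemma normc_sqrt (z : C) : normc z = Num.sqrt (normc z ^+ 2).
Proof. by rewrite sqrtr_sqr ger0_norm// normc_ge0. Qed.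

Lemma measurable_normc : measurable_fun setT (fun z : C => normc z).
Proof.
under eq_fun do rewrite normc_sqrt.
exact: (measurableT_comp (continuous_measurable_fun (@sqrt_continuous R)) measurable_normc2).
Qed.

Lemma measurable_cX n : measurable_fun setT (fun z : C => Re (z ^+ n)) /\
  measurable_fun setT (fun z : C => Im (z ^+ n)).
Proof.
elim: n => [|n [hr hi]]; first by split; under eq_fun do rewrite expr0; exact: measurable_cst.
split; under eq_fun do rewrite exprS ReImE.
  apply: measurable_funB; apply: measurable_funM => //; [exact: measurable_Re|exact: measurable_Im].
apply: measurable_funD; apply: measurable_funM => //; [exact: measurable_Re|exact: measurable_Im].
Qed.

Definition gauss (z : C) : R := expR (- normc z ^+ 2 / 2).

Lemma measurable_gauss : measurable_fun setT gauss.
Proof.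
apply: measurableT_comp => //; apply: measurable_funM; last exact: measurable_cst.
by apply: measurableT_comp => //; exact: measurable_normc2.
Qed.

Lemma gauss_gt0 z : 0 < gauss z. Proof. exact: expR_gt0. Qed.

Lemma gauss_sqr z : gauss z ^+ 2 = (expR (normc z ^+ 2))^-1.
Proof. by rewrite /gauss -expRN expr2 -expRD; congr expR; field. Qed.

(** The orthonormal Gaussian-weighted monomials of the whole plane; this normalisation makes
    [ginibre_partial] a Taylor polynomial of the kernel. *)
Definition ginibre_basis j (z : C) : C :=
  (gauss z / Num.sqrt (pi * j`!%:R))%:C * z ^+ j.

Lemma pifact_gt0 j : 0 < pi * j`!%:R :> R.
Proof. by rewrite mulr_gt0 ?pi_gt0// ltr0n fact_gt0. Qed.

Lemma bmf_ginibre_basis j : bmf (ginibre_basis j).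
Proof.
have m : measurable_fun setT (fun z : C => gauss z / Num.sqrt (pi * j`!%:R)).
  by apply: measurable_funM; [exact: measurable_gauss|exact: measurable_cst].
have [hr hi] := measurable_cX j.
split.
- rewrite /ginibre_basis; under eq_fun do rewrite ReM Re_real Im_real mul0r subr0.
  exact: measurable_funM.
- rewrite /ginibre_basis; under eq_fun do rewrite ImM Re_real Im_real mul0r addr0.
  exact: measurable_funM.
exists (Num.sqrt pi^-1) => z.
have -> : normc (ginibre_basis j z) = Num.sqrt (normc (ginibre_basis j z) ^+ 2) by exact: normc_sqrt.
rewrite ler_wsqrtr// /ginibre_basis normcM normc_real normcX exprMn real_normK ?num_real//.
rewrite exprMn gauss_sqr exprVn sqr_sqrtr; last exact/ltW/pifact_gt0.
have h : (normc z ^+ 2) ^+ j / j`!%:R <= expR (normc z ^+ 2).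
  apply: le_trans (expsum_le j.+1 (sqr_ge0 (normc z))).
  rewrite /expsum big_ord_recr/= lerDr; apply: sumr_ge0 => k _.
  by rewrite divr_ge0// exprn_ge0// sqr_ge0.
rewrite exprAC.
have -> : (expR (normc z ^+ 2))^-1 / (pi * j`!%:R) * (normc z ^+ 2) ^+ j =
  pi^-1 * (((normc z ^+ 2) ^+ j / j`!%:R) / expR (normc z ^+ 2)).
  by rewrite invfM; ring.
rewrite ler_piMr// ?invr_ge0 ?pi_ge0// ler_pdivrMr ?expR_gt0// mul1r//.
Qed.

Lemma ginibre_partial J z w :
  \sum_(j < J) ginibre_basis j z * (ginibre_basis j w)^* =
  (pi^-1 * (gauss z * gauss w))%:C * expsum J (z * w^*).
Proof.
rewrite /expsum mulr_sumr; apply: eq_bigr => j _.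
rewrite /ginibre_basis cconjM cconj_real (rmorphXn (@conjc R)) exprMn fact_real -fmorphV.
have h : (gauss z / Num.sqrt (pi * j`!%:R))%:C * (gauss w / Num.sqrt (pi * j`!%:R))%:C =
   (pi^-1 * (gauss z * gauss w))%:C * (j`!%:R^-1)%:C :> C.
  rewrite -!rmorphM; congr (_%:C).
  have e : (Num.sqrt (pi * j`!%:R) : R)^-1 * (Num.sqrt (pi * j`!%:R))^-1 = pi^-1 * j`!%:R^-1.
    by rewrite -invfM -expr2 sqr_sqrtr ?invfM//; exact/ltW/pifact_gt0.
  by rewrite mulrACA e; ring.
rewrite mulrACA h; by rewrite -mulrA [(j`!%:R^-1)%:C * _]mulrC.
Qed.

Lemma ginibre_kernelE z w :
  K z w = (pi^-1 * (gauss z * gauss w))%:C * cexp (z * w^*).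
Proof.
rewrite /ginibre_kernel /gauss -expRD.
rewrite (_ : - normc z ^+ 2 / 2 + - normc w ^+ 2 / 2 = - (normc z ^+ 2 + normc w ^+ 2) / 2).
  by rewrite mulrAC -rmorphM.
by field.
Qed.

Lemma ginibre_partial_cvg z w :
  (fun J => \sum_(j < J) ginibre_basis j z * (ginibre_basis j w)^*) @ \oo --> K z w.
Proof.
under eq_fun do rewrite ginibre_partial; rewrite ginibre_kernelE.
by apply: cvgcM; [exact: cvgc_cst|exact: cvg_expsum_cexp].
Qed.

(** From [(|z| - |w|)^2 >= 0]: the Gaussian weights absorb the exponential, which gives the uniform
    bound [1 / pi] on the partial sums. *)
Lemma gauss_expR z w : gauss z * gauss w * expR (normc z * normc w) <= 1.
Proof.
rewrite /gauss -!expRD -[leRHS]expR0 ler_expR.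
have := sqr_ge0 (normc z - normc w); lra.
Qed.

Lemma ginibre_partial_bound J z w :
  normc (\sum_(j < J) ginibre_basis j z * (ginibre_basis j w)^*) <= pi^-1.
Proof.
rewrite ginibre_partial normcM normc_real ger0_norm; last first.
  by rewrite mulr_ge0// ?invr_ge0 ?pi_ge0// mulr_ge0// ltW// gauss_gt0.
rewrite -mulrA ler_piMr ?invr_ge0 ?pi_ge0//; apply: le_trans (gauss_expR z w).
rewrite ler_wpM2l//; first by rewrite mulr_ge0// ltW// gauss_gt0.
rewrite (le_trans (normc_expsum _ _))// normcM normc_conj expsum_le//.
by rewrite mulr_ge0// normc_ge0.
Qed.

Lemma bmker_ginibre : bmker K.
Proof.
apply: (@bmf_lim _ _ _ (fun J (p : C * C) =>
    \sum_(j < J) ginibre_basis j p.1 * (ginibre_basis j p.2)^*) _ pi^-1).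
- move=> J; apply: bmf_sum => j _; apply: bmfM; first exact: (bmf_comp measurable_fst (bmf_ginibre_basis j)).
  by apply: bmfJ; exact: (bmf_comp measurable_snd (bmf_ginibre_basis j)).
- by move=> J p; exact: ginibre_partial_bound.
by move=> p; exact: ginibre_partial_cvg.
Qed.

Lemma gauss0 : gauss 0 = 1.
Proof. by rewrite /gauss normc0 expr0n/= oppr0 mul0r expR0. Qed.

Lemma cexp0 : cexp 0 = 1 :> C.
Proof.
rewrite /cexp /= expR0 cos0 sin0 mul1r; exact: eqcP.
Qed.

Lemma ginibre_kernel_0r z : K z 0 = (pi^-1 * gauss z)%:C.
Proof.
rewrite ginibre_kernelE gauss0 mulr1 (_ : z * 0^* = 0) ?cexp0 ?mulr1//.
by rewrite (rmorph0 (@conjc R)) mulr0.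
Qed.

Lemma ginibre_kernel_0l z : K 0 z = (pi^-1 * gauss z)%:C.
Proof. by rewrite ginibre_kernelE gauss0 mul1r mul0r cexp0 mulr1. Qed.

Lemma ginibre_kernel00 : K 0 0 = (pi^-1)%:C.
Proof. by rewrite ginibre_kernel_0r gauss0 mulr1. Qed.

Lemma ginibre_kernel0E z w : K0 z w = K z w - pi%:C * (K z 0 * K 0 w).
Proof.
rewrite ginibre_kernel_0r ginibre_kernel_0l -2!rmorphM.
rewrite /ginibre_kernel0 /ginibre_kernel mulrBr mulrBl mulr1; congr (_ - _).
rewrite -rmorphM; congr (_%:C).
rewrite (_ : - (normc z ^+ 2 + normc w ^+ 2) / 2 = - normc z ^+ 2 / 2 + - normc w ^+ 2 / 2); last by field.
rewrite expRD -/(gauss z) -/(gauss w).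
have p0 : pi != 0 :> R by rewrite gt_eqF// pi_gt0.
by move: p0; move: (pi : R) (gauss z) (gauss w) => a b c a0; field.
Qed.

Lemma bmker_ginibre0 : bmker K0.
Proof.
have h := bmker_ginibre.
apply: (@bmf_ext _ _ _ (fun p => K p.1 p.2 - pi%:C * (K p.1 0 * K 0 p.2))).
  by move=> p; rewrite ginibre_kernel0E.
apply: (bmfB h); apply: bmfZ; apply: bmfM.
  have h1 := bmker_col (0 : C) h; exact: (bmf_fst C h1).
have h1 := bmker_row (0 : C) h; exact: (bmf_snd C h1).
Qed.

(* [K0 z w = K z w - K z 0 * K 0 w / K 0 0] is a Schur complement. *)
Lemma det_gram_ginibre0 k (x z : k.-tuple C) :
  \det (gram K (tuple_cons (0 : C, x)) (tuple_cons (0 : C, z))) = (pi^-1)%:C * \det (gram K0 x z).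
Proof.
pose r : 'rV[C]_k := \row_j K 0 (tnth z j).
pose c : 'cV[C]_k := \col_i K (tnth x i) 0.
pose M : 'M[C]_(1 + k) := block_mx ((pi^-1)%:C)%:M r c (gram K x z).
have -> : gram K (tuple_cons (0 : C, x)) (tuple_cons (0 : C, z)) = M.
  apply/(@matrixP _ (1 + k) (1 + k)) => i j; rewrite /gram (@mxE _ (1 + k) (1 + k)) /M.
  case: (@split_ordP 1 k i) => i' ->; case: (@split_ordP 1 k j) => j' ->.
  - by rewrite block_mxEul mxE !ord1 eqxx mulr1n -ginibre_kernel00.
  - by rewrite block_mxEur mxE !ord1 rshift1 tnthS.
  - by rewrite block_mxEdl mxE !ord1 rshift1 tnthS.
  - by rewrite block_mxEdr mxE !rshift1 !tnthS.
pose L : 'M[C]_(1 + k) := block_mx 1%:M 0 (- pi%:C *: c) 1%:M.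
have dL : \det L = 1 by rewrite det_lblock !det1 mulr1.
have -> : \det M = \det (L *m M) by rewrite det_mulmx dL mul1r.
rewrite mulmx_block !mul1mx !mul0mx !addr0.
have -> : - pi%:C *: c *m ((pi^-1)%:C)%:M + c = 0.
  rewrite mul_mx_scalar scalerA mulrN -(rmorphM (real_complex R)) mulVf ?gt_eqF ?pi_gt0// scaleNr scale1r addNr//.
rewrite det_ublock det_scalar1; congr (_ * \det _).
apply/matrixP => i j; rewrite !mxE big_ord1 !mxE ginibre_kernel0E; ring.
Qed.

End ginibre.

(** * Eigenvalue multiplicities *)

Section complex_measurability.
Variable R : realType.
Local Notation C := R[i].
Local Notation mu := (@lebesgue_complex R).

Lemma measurable_complexP d (X : measurableType d) (f : X -> C) :
  measurable_fun setT (fun x => Re (f x)) -> measurable_fun setT (fun x => Im (f x)) ->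
  measurable_fun setT f.
Proof.
move=> hr hi.
rewrite (_ : f = @complex_of_plane R \o (fun x => (Re (f x), Im (f x)))); last first.
  by apply/funext => x /=; case: (f x).
apply: (measurableT_comp (@measurable_complex_of_plane R)).
exact: measurable_fun_pair.
Qed.

Lemma bmf_measurable d (X : measurableType d) (f : X -> C) : bmf f -> measurable_fun setT f.
Proof. by move=> [hr hi _]; exact: measurable_complexP. Qed.

Lemma measurable_ReD d (X : measurableType d) (D : set X) (f : X -> C) :
  measurable_fun D f -> measurable_fun D (fun x => Re (f x)).
Proof. by move=> mf; apply: (measurableT_comp (@measurable_Re R) mf). Qed.

Lemma measurable_ImD d (X : measurableType d) (D : set X) (f : X -> C) :
  measurable_fun D f -> measurable_fun D (fun x => Im (f x)).
Proof. by move=> mf; apply: (measurableT_comp (@measurable_Im R) mf). Qed.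

Lemma Rintegral_dominated d (X : measurableType d) (m : {measure set X -> \bar R})
    (D : set X) (h_ : nat -> X -> R) (h g : X -> R) :
  measurable D -> (forall n, measurable_fun D (h_ n)) -> measurable_fun D h ->
  (forall x, D x -> h_ ^~ x @ \oo --> h x) ->
  m.-integrable D (EFin \o g) -> (forall n x, D x -> `|h_ n x| <= g x) ->
  (fun n => \int[m]_(x in D) h_ n x) @ \oo --> \int[m]_(x in D) h x.
Proof.
move=> mD mh_ mh hc ig hg.
have [|||||ih _ c] := @dominated_convergence _ _ _ m D mD (fun n => EFin \o h_ n)
    (EFin \o h) (EFin \o g).
- by move=> n; exact/measurable_EFinP.
- exact/measurable_EFinP.
- by apply: aeW => x Dx; apply: cvg_EFin; [exact: nearW|exact: hc].
- exact: ig.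
- by apply: aeW => x n Dx /=; rewrite lee_fin; exact: hg.
by apply: (fine_cvg (f := fun n => (\int[m]_(x in D) (h_ n x)%:E)%E)); rewrite fineK// integrable_fin_num.
Qed.

End complex_measurability.

(** * Square-integrable functions on a set of finite measure *)

Section square_integrable.
Variable R : realType.
Local Notation C := R[i].
Local Notation mu := (@lebesgue_complex R).
Variables (D : set C) (mD : measurable D) (moo : (mu D < +oo)%E).
Local Notation nu := (mfrestr mD moo).

Lemma cintegral_cint (f : C -> C) : measurable_fun setT (fun z => Re (f z)) ->
  measurable_fun setT (fun z => Im (f z)) -> cintegral D f = cint nu f.
Proof.
move=> hr hi; apply: eqcP.
  rewrite Re_cint /= /Rintegral integral_mfrestr//; exact/measurable_EFinP.
rewrite Im_cint /= /Rintegral integral_mfrestr//; exact/measurable_EFinP.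
Qed.

Lemma cintegral_bmf (f : C -> C) : bmf f -> cintegral D f = cint nu f.
Proof. by move=> [hr hi _]; exact: cintegral_cint. Qed.

Lemma kernel_operator_Kop (K : C -> C -> C) f z : bmker K -> bmf f ->
  kernel_operator K D f z = Kop nu K f z.
Proof.
move=> mK mf; rewrite Kop_cint /kernel_operator cintegral_bmf//.
by apply: bmfM mf; exact: bmker_row.
Qed.

Lemma bmf_square_integrable (f : C -> C) : bmf f -> square_integrable D f.
Proof.
move=> mf; have mf2 := bmf_measurable mf; have [_ _ [M fM]] := mf; split.
  exact: measurable_funTS mf2.
have m2 : measurable_fun setT (fun v => normc (f v) ^+ 2).
  exact: (measurableT_comp (@measurable_normc2 R) mf2).
have i2 : mu.-integrable D (EFin \o (fun v => normc (f v) ^+ 2)); last first.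
  rewrite (_ : integral _ _ _ = \int[mu]_(v in D) `|(normc (f v) ^+ 2)%R%:E|)%E.
    by have /integrableP[] := i2.
  by apply: eq_integral => v _; rewrite /= ger0_norm// sqr_ge0.
apply: measurable_bounded_integrable => //; first exact: measurable_funTS.
exists (M ^+ 2); split; first exact: num_real.
move=> y My x _ /=; rewrite (le_trans _ (ltW My))// normrX ger0_norm ?normc_ge0//.
by rewrite lerXn2r ?nnegrE ?normc_ge0// (le_trans (normc_ge0 (f x))).
Qed.

Section truncation.
Variables (f : C -> C) (sf : square_integrable D f).

Let A n : set C := D `&` [set v | normc (f v) <= n%:R].
Let F n : C -> C := f \_ (A n).

Let mA n : measurable (A n).
Proof.
have [mf _] := sf.
have mn : measurable_fun D (fun v => normc (f v)).
  exact: (measurableT_comp (@measurable_normc R) mf).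
rewrite (_ : A n = D `&` (fun v => normc (f v)) @^-1` `]-oo, n%:R]%classic); last first.
  by apply/seteqP; split => v [Dv h]; split => //; move: h; rewrite /= in_itv.
exact: mn.
Qed.

Let mF n : bmf (F n).
Proof.
have [mf _] := sf.
have mfA : measurable_fun (A n) f by apply: measurable_funS mf => // v [].
have mFn : measurable_fun setT (F n) by apply/(measurable_restrictT f (mA n)).
have h1 := measurable_ReD mFn.
have h2 := measurable_ImD mFn.
split; first exact h1. exact h2.

exists n%:R => v; rewrite /F patchE; case: ifPn => [|_]; last by rewrite normc0.
by rewrite inE => -[].
Qed.

Let F_le n v : normc (F n v) <= normc (f v).
Proof. by rewrite /F patchE; case: ifPn => // _; rewrite normc0 normc_ge0. Qed.

Let F_cvg v : D v -> F ^~ v @ \oo --> f v.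
Proof.
move=> Dv; apply/cvgc_normP; apply: cvg_near_cst.
have [N fN] : exists N : nat, normc (f v) <= N%:R.
  by exists (Num.truncn (normc (f v))).+1; rewrite ltW// truncnS_gt.
exists N => // n /= Nn; rewrite /F patchE ifT ?subrr ?normc0//.
by rewrite inE; split => //=; rewrite (le_trans fN)// ler_nat.
Qed.

(* An eigenfunction in [L^2(D)] may be unbounded; [K f] is a bounded measurable representative of
   its class up to the eigenvalue. *)
Lemma kernel_operator_bmf (K : C -> C -> C) : bmker K -> bmf (kernel_operator K D f).
Proof.
move=> mK; have [_ _ [B0 KB0]] := mK; have [mf fi] := sf.
have [B B0' KB] : exists2 B, 0 <= B & forall z v, normc (K z v) <= B.
  exists `|B0| => // z v; rewrite (le_trans (KB0 (z, v)))//= ler_norm//.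
(* Since [|f| <= 1 + |f|^2] and [D] has finite measure, this function dominates all truncations of
   [K z v * f v]. *)
have i1 : mu.-integrable D (EFin \o (fun v => B * (1 + normc (f v) ^+ 2))).
  have ig : mu.-integrable D (EFin \o (fun v => (1 + normc (f v) ^+ 2))).
    have i0 : mu.-integrable D (EFin \o (fun=> 1 : R)).
      apply: measurable_bounded_integrable => //; exists 1; split; first exact: num_real.
      by move=> y y1 x _ /=; rewrite normr1 ltW.
    have i2 : mu.-integrable D (EFin \o (fun v => normc (f v) ^+ 2)).
      apply/integrableP; split.
        apply/measurable_EFinP.
        exact: (measurableT_comp (@measurable_normc2 R) mf).
      rewrite (_ : integral _ _ _ = \int[mu]_(v in D) (normc (f v) ^+ 2)%R%:E)%E//.
      by apply: eq_integral => v _; rewrite /= ger0_norm// sqr_ge0.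
    exact: (integrableD mD i0 i2).
  have := integrableZl mD B ig; rewrite (_ : (fun _ => _) = EFin \o (fun v => B * (1 + normc (f v) ^+ 2)))//.
have Kf z : (fun n => kernel_operator K D (F n) z) @ \oo --> kernel_operator K D f z.
  have [kr ki _] := bmker_row z mK.
  have [fr fi'] := (measurable_ReD mf, measurable_ImD mf).
  have b n v : normc (K z v * F n v) <= B * (1 + normc (f v) ^+ 2).
    rewrite normcM ler_pM ?normc_ge0//; apply: (le_trans (F_le n v)).
    have := sqr_ge0 (normc (f v) - 1); have := normc_ge0 (f v); nra.
  have mfn n := mF n.
  apply: cvgc_ReIm => /=; apply: Rintegral_dominated i1 _ => //.
  - move=> n; have [h _ _] := bmfM (bmker_row z mK) (mF n).
    exact: measurable_funTS h.
  - under eq_fun do rewrite ReM; apply: measurable_funB; apply: measurable_funM => //; exact: measurable_funTS.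
  - by move=> v Dv; apply: cvgc_Re; apply: cvgcM; [exact: cvgc_cst|exact: F_cvg].
  - by move=> n v _; rewrite (le_trans (normc_Re _))// b.
  - move=> n; have [_ h _] := bmfM (bmker_row z mK) (mF n).
    exact: measurable_funTS h.
  - under eq_fun do rewrite ImM; apply: measurable_funD; apply: measurable_funM => //; exact: measurable_funTS.
  - by move=> v Dv; apply: cvgc_Im; apply: cvgcM; [exact: cvgc_cst|exact: F_cvg].
  - by move=> n v _; rewrite (le_trans (normc_Im _))// b.
have If n z : kernel_operator K D (F n) z = Kop nu K (F n) z by exact: kernel_operator_Kop.
pose M := \int[mu]_(v in D) (B * (1 + normc (f v) ^+ 2)).
apply: (@bmf_lim _ _ _ (fun n => kernel_operator K D (F n)) _ (M + M)).
- by move=> n; apply: bmf_ext (bmf_Kop nu mK (mF n)) => z; rewrite If.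
- move=> n z; have b : forall v, normc (K z v * F n v) <= B * (1 + normc (f v) ^+ 2).
    move=> v; rewrite normcM ler_pM ?normc_ge0//; apply: (le_trans (F_le n v)).
    have := sqr_ge0 (normc (f v) - 1); have := normc_ge0 (f v); nra.
  have [hr hi [Q hQ]] := bmfM (bmker_row z mK) (mF n).
  have ib (h : C -> R) : measurable_fun setT h -> (forall v, `|h v| <= normc (K z v * F n v)) ->
      `|\int[mu]_(v in D) h v| <= M.
    move=> mh hb.
    have ih : mu.-integrable D (EFin \o h).
      apply: measurable_bounded_integrable => //; first exact: measurable_funTS.
      exists Q; split; first exact: num_real.
      by move=> y Qy x _ /=; rewrite (le_trans (hb x))// (le_trans (hQ x))// ltW.
    apply: (le_trans (le_normr_Rintegral mD ih)); apply: le_Rintegral => //.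
      exact: integrable_norm.
    by move=> v _; exact: le_trans (hb v) (b v).
  rewrite (le_trans (normc_le_ReIm _))//= lerD//; apply: ib => // v.
    exact: normc_Re.
  exact: normc_Im.
exact: Kf.
Qed.

End truncation.
End square_integrable.

Section multiplicity.
Variable R : realType.
Local Notation C := R[i].
Local Notation mu := (@lebesgue_complex R).
Variables (D : set C) (mD : measurable D) (moo : (mu D < +oo)%E).
Local Notation nu := (mfrestr mD moo).

Definition cmeasurable (f : C -> C) :=
  measurable_fun D (fun z => Re (f z)) /\ measurable_fun D (fun z => Im (f z)).

Lemma measurable_cmeasurable f : measurable_fun D f -> cmeasurable f.
Proof. by split; [exact: measurable_ReD|exact: measurable_ImD]. Qed.

Lemma bmf_cmeasurable f : bmf f -> cmeasurable f.
Proof. by move=> [? ? _]; split; exact: measurable_funTS. Qed.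

Lemma cmeasurableM f g : cmeasurable f -> cmeasurable g -> cmeasurable (fun z => f z * g z).
Proof.
move=> [fr fi] [gr gi]; split.
  by under eq_fun do rewrite ReM; apply: measurable_funB; exact: measurable_funM.
by under eq_fun do rewrite ImM; apply: measurable_funD; exact: measurable_funM.
Qed.

Lemma cintegral_ae (f g : C -> C) : cmeasurable f -> cmeasurable g ->
  ae_eq_on D f g -> cintegral D f = cintegral D g.
Proof.
move=> [fr fi] [gr gi] fg; apply: eqcP; rewrite /= /Rintegral; congr fine;
  apply: ae_eq_integral => //.
- exact/measurable_EFinP.
- exact/measurable_EFinP.
- by apply: filterS fg => z h Dz; rewrite /= h.
- exact/measurable_EFinP.
- exact/measurable_EFinP.
- by apply: filterS fg => z h Dz; rewrite /= h.
Qed.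

Lemma cint_ae (f g : C -> C) : bmf f -> bmf g -> ae_eq_on D f g -> cint nu f = cint nu g.
Proof.
move=> mf mg fg; rewrite -!cintegral_bmf//; apply: cintegral_ae fg; exact: bmf_cmeasurable.
Qed.

Variables (K : C -> C -> C) (lam : nat -> R) (psi : nat -> C -> C).
Hypothesis gK : good nu K.
Hypothesis lam0 : forall n, 0 <= lam n.
Hypothesis mpsi : forall n, bmf (psi n).
Hypothesis Kpsi : forall n z, Kop nu K (psi n) z = (lam n)%:C * psi n z.
Hypothesis orth : forall n m, ip nu (psi n) (psi m) = ((n == m) && (lam n != 0))%:R.
Hypothesis spec : forall N g, bmf g -> 0 <= qf nu K g -
  \sum_(n < N) lam n * normc (ip nu g (psi n)) ^+ 2 <= lam N * nrm2 nu g.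
Hypothesis lamc : lam @ \oo --> (0 : R).

Lemma kernel_operator_ae f g z : square_integrable D f -> square_integrable D g ->
  ae_eq_on D f g -> kernel_operator K D f z = kernel_operator K D g z.
Proof.
have [mK _ _] := gK.
move=> [mf _] [mg _] fg.
have mz : cmeasurable (K z) by apply: bmf_cmeasurable; exact: bmker_row.
apply: (cintegral_ae (cmeasurableM mz (measurable_cmeasurable mf))
  (cmeasurableM mz (measurable_cmeasurable mg))).
by apply: filterS fg => v h Dv; rewrite h.
Qed.

(** The difference [h] of the two sides is an eigenfunction for [a] orthogonal to every [psi n]: to
    those of eigenvalue [a] by construction, to the others by self-adjointness. Then
    [a |h|^2 <= lam N * |h|^2] for all [N], so [h] has norm 0, and [a h = K h] vanishes at every
    point. *)
Lemma eigenvector_expansion (a : R) m (idx : nat -> nat) (g : C -> C) : a != 0 ->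
  set_bij `I_m [set n | lam n = a] idx -> bmf g ->
  (forall z, Kop nu K g z = a%:C * g z) ->
  forall z, g z = \sum_(i < m) ip nu g (psi (idx i)) * psi (idx i) z.
Proof.
move=> a0 [idxF idxI idxS] mg Kg; have [mK _ _] := gK.
pose s z := \sum_(i < m) ip nu g (psi (idx i)) * psi (idx i) z.
have ms : bmf s by apply: bmf_sum => i _; apply: bmfZ; exact: mpsi.
pose h z := g z - s z.
have mh : bmf h by exact: bmfB.
have lidx (i : 'I_m) : lam (idx i) = a by exact: (idxF i (ltn_ord i)).
have Kh z : Kop nu K h z = a%:C * h z.
  rewrite /h KopB// Kg mulrBr; congr (_ - _).
  rewrite Kop_cint /s; transitivity (\sum_(i < m) cint nu (fun v => ip nu g (psi (idx i)) * (K z v * psi (idx i) v))).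
    rewrite -cint_sum => [|i _]; last first.
      by apply: bmfZ; apply: bmfM (mpsi _); exact: bmker_row.
    by apply: eq_cint => v; rewrite mulr_sumr; apply: eq_bigr => i _; rewrite mulrCA.
  rewrite mulr_sumr; apply: eq_bigr => i _; rewrite cintZ; last first.
    by apply: bmfM (mpsi _); exact: bmker_row.
  by rewrite -Kop_cint Kpsi lidx mulrCA.
have h0 n : ip nu h (psi n) = 0.
  have mp := mpsi n; rewrite /h (ipBl nu mg ms mp).
  have sE : ip nu s (psi n) = \sum_(i < m) ip nu g (psi (idx i)) * ip nu (psi (idx i)) (psi n).
    rewrite /s (ip_suml nu (index_enum 'I_m) (F := fun i z => ip nu g (psi (idx i)) * psi (idx i) z)).
    - by apply: eq_bigr => i _; rewrite ipZl//; exact: mpsi.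
    - by move=> i; apply: bmfZ; exact: mpsi.
    - exact: mpsi.
  rewrite sE; have [ln|ln] := eqVneq (lam n) a.
    have [i im iE] := idxS n ln; have {}im : (i < m)%N by [].
    rewrite (bigD1 (Ordinal im))//= iE orth eqxx ln a0 mulr1 big1 ?addr0 ?subrr// => j ji.
    rewrite orth; case: eqVneq => [e|_]; last by rewrite mulr0.
    exfalso; move/eqP: ji; apply; apply/val_inj => /=; apply: idxI; rewrite ?inE//=.
    by rewrite e iE.
  rewrite big1 ?subr0 => [|i _]; last first.
    rewrite orth; case: eqVneq => [e|_]; last by rewrite mulr0.
    by move: ln; rewrite -e lidx eqxx.
  have := Kop_adj gK mg (mpsi n).
  have -> : Kop nu K g = fun z => a%:C * g z by apply/funext => z; exact: Kg.
  have -> : Kop nu K (psi n) = fun z => (lam n)%:C * psi n z by apply/funext => z; exact: Kpsi.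
  rewrite ipZl ?ipZr//; [|exact: mpsi..].
  rewrite cconj_real => /eqP; rewrite -subr_eq0 -mulrBl mulf_eq0 => /orP[/eqP e|/eqP//].
  by move: ln; move/(congr1 (@complex.Re R)): e; rewrite /= => /eqP; rewrite subr_eq0 eq_sym => ->.
have n0 : nrm2 nu h = 0.
  have q : qf nu K h = a * nrm2 nu h.
    have := qfE gK mh; have -> : Kop nu K h = fun z => a%:C * h z by apply/funext => z; exact: Kh.
    by rewrite ipZl// ip_nrm2// -rmorphM => /(congr1 (@complex.Re R)).
  have b N : 0 <= a * nrm2 nu h <= lam N * nrm2 nu h.
    have := spec N mh; rewrite big1 ?subr0 ?q// => i _.
    by rewrite h0 normc0 expr0n mulr0.
  have : a * nrm2 nu h = 0.
    apply/eqP; rewrite eq_le; have /andP[-> _] := b 0%N; rewrite andbT.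
    have l0 : (fun N => lam N * nrm2 nu h) @ \oo --> (0 : R).
      by rewrite -(mul0r (nrm2 nu h)); apply: cvgM => //; exact: cvg_cst.
    rewrite -(cvg_lim (@Rhausdorff R) l0); apply: limr_ge; first exact: cvgP l0.
    by apply: nearW => N; have /andP[] := b N.
  by move/eqP; rewrite mulf_eq0 (negbTE a0) => /eqP.
move=> z; apply/eqP; rewrite -subr_eq0 -/(s z) -/(h z); apply/eqP.
have := Kop_pointwise z gK mh; rewrite n0 mulr0 Kh normcM exprMn normc_real => hz.
have : normc (h z) ^+ 2 = 0.
  apply/eqP; rewrite eq_le sqr_ge0 andbT.
  by move: hz; rewrite pmulr_rle0// exprn_gt0// normr_gt0.
by move/eqP; rewrite sqrf_eq0 => /eqP /normc_eq0.
Qed.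

Lemma multiplicity_fiber (a : R) m : a != 0 -> ([set n | lam n = a] #= `I_m)%card ->
  multiplicity K D a%:C m.
Proof.
move=> a0 lamE; have [mK _ _] := gK.
have aC : a%:C != 0 :> C by apply/eqP => /(congr1 (@complex.Re R)) /= /eqP; apply/negP.
have /card_set_bijP[idx bidx] : (`I_m #= [set n | lam n = a])%card by rewrite card_eq_sym.
have [idxF idxI _] := bidx.
have lidx (i : 'I_m) : lam (idx i) = a by exact: (idxF i (ltn_ord i)).
exists (fun i z => psi (idx i) z); split.
- move=> i; split; first exact: bmf_square_integrable.
  apply: aeW => z _; rewrite (kernel_operator_Kop mD moo)//.
  by rewrite Kpsi lidx.
- move=> c c0 j.
  have mi (i : 'I_m) : bmf (fun z => c i * psi (idx i) z) by apply: bmfZ; exact: mpsi.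
  have ms : bmf (fun z => \sum_i c i * psi (idx i) z) by exact: bmf_sum.
  have : ip nu (fun z => \sum_i c i * psi (idx i) z) (psi (idx j)) = 0.
    rewrite ip_cint (@cint_ae _ (fun=> 0)); first exact: cint0.
    - by apply: bmfM => //; apply: bmfJ; exact: mpsi.
    - exact: bmf_cst.
    by apply: filterS c0 => z h Dz; rewrite h// mul0r.
  rewrite (ip_suml nu (index_enum 'I_m) (F := fun i z => c i * psi (idx i) z))//.
  rewrite (bigD1 j)//= big1 => [|i ij].
    rewrite ipZl ?orth ?eqxx ?lidx ?a0 ?mulr1 ?addr0//.
  rewrite ipZl ?orth//.
  case: eqVneq => [e|_]; last by rewrite mulr0.
  by exfalso; move/eqP: ij; apply; apply/val_inj/idxI; rewrite ?inE//=.
move=> f [sf ef].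
(* [f] equals [g] almost everywhere on [D], and [g] is bounded and satisfies the eigenvalue equation
   at every point. *)
pose g z := a%:C^-1 * kernel_operator K D f z.
have mg : bmf g by apply: bmfZ; exact: kernel_operator_bmf.
have fg : ae_eq_on D f g.
  by apply: filterS ef => z h Dz; rewrite /g h// mulKf.
have Kg z : Kop nu K g z = a%:C * g z.
  rewrite -kernel_operator_Kop// /g mulVKf//; symmetry; apply: kernel_operator_ae => //.
  exact: bmf_square_integrable.
have gE := eigenvector_expansion a0 bidx mg Kg.
exists (fun i => ip nu g (psi (idx i))).
by apply: filterS fg => z h Dz; rewrite h// gE.
Qed.

Lemma finite_fiber (a : R) : a != 0 -> finite_set [set n | lam n = a].
Proof.
move=> a0; have a1 : 0 < `|a| by rewrite normr_gt0.
have /cvgrPdist_lt /(_ _ a1) [N _ h] := lamc.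
apply: (sub_finite_set _ (finite_II N)) => n /= ln; rewrite ltnNge; apply/negP => Nn.
by have := h n Nn; rewrite /= sub0r normrN ln ltxx.
Qed.

(** Since [lam] tends to 0, its fibre over a nonzero value is finite, and the cardinal of that fibre
    is the multiplicity which [alpha] reproduces; the fibres over 0 may differ. *)
Lemma eigenvalue_sequence_prod alpha : (forall n, lam n <= 1) ->
  eigenvalue_sequence K D alpha ->
  limn (fun N => \prod_(n < N) (1 - alpha n)) = limn (fun N => \prod_(n < N) (1 - lam n)).
Proof.
move=> lam1 ha; apply: prod_fibers_eq => [n|a a0]; first by rewrite lam0 lam1.
have /finite_setP[m hm] := finite_fiber a0.
have aC : a%:C != 0 :> C by apply/eqP => /(congr1 (@complex.Re R)) /= /eqP; apply/negP.
have := (ha _ aC m).1 (multiplicity_fiber a0 hm).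
rewrite (_ : [set n | (alpha n)%:C = a%:C] = [set n | alpha n = a]); last first.
  by apply/seteqP; split => n /=; [case|move=> ->].
by move=> h; apply: card_eq_trans h _; rewrite card_eq_sym.
Qed.

End multiplicity.

(** * Void probabilities of the Ginibre process *)

Section geometric_series.
Variable R : realType.
Local Notation C := R[i].

Lemma geometric_dominated_cvg (u : nat -> R) (c rho : R) : 0 <= c -> 0 <= rho < 1 ->
  (forall j, `|u j| <= c * rho ^+ j) ->
  exists A : R, (fun m => \sum_(j < m) u j) @ \oo --> A.
Proof.
move=> c0 /andP[r0 r1] h.
have hn : cvgn [normed series u].
  apply: (@series_le_cvg _ _ (geometric c rho)).
  - by move=> n; exact: normr_ge0.
  - by move=> n; rewrite /geometric/= mulr_ge0// exprn_ge0.
  - exact: h.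
  - by apply: is_cvg_geometric_series; rewrite ger0_norm.
exists (limn (series u)).
rewrite (_ : (fun m => _) = series u); first exact: normed_cvg.
by apply/funext => m; rewrite /series/= big_mkord.
Qed.

Lemma geometric_dominated_cvgc (u : nat -> C) (c rho : R) : 0 <= c -> 0 <= rho < 1 ->
  (forall j, normc (u j) <= c * rho ^+ j) ->
  exists A : C, (fun m => \sum_(j < m) u j) @ \oo --> A.
Proof.
move=> c0 r01 h.
have [A hA] : exists A : R, (fun m => \sum_(j < m) Re (u j)) @ \oo --> A.
  apply: (@geometric_dominated_cvg (fun j => Re (u j)) c rho c0 r01) => j.
  exact: le_trans (normc_Re _) (h j).
have [B hB] : exists A : R, (fun m => \sum_(j < m) Im (u j)) @ \oo --> A.
  apply: (@geometric_dominated_cvg (fun j => Im (u j)) c rho c0 r01) => j.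
  exact: le_trans (normc_Im _) (h j).
exists (A +i* B); apply: cvgc_ReIm.
  by under eq_fun do rewrite Re_sum.
by under eq_fun do rewrite Im_sum.
Qed.

Lemma series_tail_cvg0 (u : nat -> R) (A : R) : (fun m => \sum_(j < m) u j) @ \oo --> A ->
  u @ \oo --> (0 : R).
Proof.
move=> h; have h1 : (fun m => \sum_(j < m.+1) u j) @ \oo --> A.
  by rewrite (cvg_shiftS (fun m => \sum_(j < m) u j)).
rewrite -(subrr A) (_ : u = fun m => \sum_(j < m.+1) u j - \sum_(j < m) u j).
  exact: cvgB.
by apply/funext => m; rewrite big_ord_recr/= addrAC subrr add0r.
Qed.

Lemma altsum_tail_cvg0 (e : nat -> R) (s F : R) : 0 <= s -> altsum e s @ \oo --> F ->
  (fun m => s ^+ m * e m) @ \oo --> (0 : R).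
Proof.
move=> s0 hF; have h := @series_tail_cvg0 (fun k => (- s) ^+ k * e k) F hF; apply/norm_cvg0P.
rewrite (_ : (fun m => _) = fun m => `|(- s) ^+ m * e m|).
  by rewrite -(normr0 R); apply: cvg_norm.
by apply/funext => m; rewrite !normrM !normrX normrN.
Qed.

End geometric_series.

Section ginibre_void.
Variable R : realType.
Local Notation C := R[i].
Local Notation mu := (@lebesgue_complex R).
Local Notation K := (@ginibre_kernel R).
Local Notation K0 := (@ginibre_kernel0 R).
Context d (Omega : measurableType d) (P : probability Omega R).
Variables (phi phi0 : Omega -> set C).
Hypothesis hphi : determinantal P phi K.
Hypothesis hphi0 : determinantal P phi0 K0.
Variables (D : set C) (mD : measurable D) (moo : (mu D < +oo)%E).
Variables (rad : R) (Drad : forall z, D z -> normc z <= rad).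
Local Notation nu := (mfrestr mD moo).

Let mK := @bmker_ginibre R.
Let spectral := trace_formula nu mK (@bmf_ginibre_basis R) (@ginibre_partial_bound R)
  (@ginibre_partial_cvg R).

(** [r j] is [pi] times the iterated kernel [K_D^(j+1)] at the origin, so [r 0 = 1] and the sum of
    the series is [pi R_D(0, 0)]. *)
Let r j : C := pi%:C * Kpow nu K j (K ^~ 0) 0.

(** The bordered determinant at the origin turns the coefficient for [K0] into [pi] times the first
    minor of [K] at [(0, 0)], which [bcoefE] expands. *)
Lemma ecoef_ginibre0 k : ecoef nu K0 k = \sum_(j < k.+1) (-1) ^+ j * ecoef nu K (k - j) * r j.
Proof.
have -> : ecoef nu K0 k = pi%:C * bcoef nu K k 0 0.
  rewrite /ecoef /bcoef mulrA; congr (_ / _).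
  rewrite /fminor -JintZ; last first.
    have mc := @measurable_cons_l _ _ k (0 : C).
    exact: (bmf_gram mK mc mc).
  apply: eq_Jint => z; rewrite det_gram_ginibre0 mulrA -(rmorphM (real_complex R)).
  by rewrite mulfV ?mul1r// gt_eqF// pi_gt0.
rewrite bcoefE// mulr_sumr; apply: eq_bigr => j _.
by rewrite mulrCA.
Qed.

Lemma recoef_ginibre0 k : recoef nu K0 k =
  \sum_(j < k.+1) (-1) ^+ j * recoef nu K (k - j) * Re (r j).
Proof.
have [_ [lam [psi [_ treal _ _ _]]]] := spectral.
rewrite /recoef ecoef_ginibre0 Re_sum; apply: eq_bigr => j _.
rewrite (ecoef_real mK treal) -(rmorphN1 (real_complex R)) -(rmorphXn (real_complex R)).
by rewrite -(rmorphM (real_complex R)) ReM Re_real Im_real mul0r subr0.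
Qed.

(** In L^2 each application of [K] multiplies the squared norm by at most [l^2], by Cauchy-Schwarz
    for the form of [K]; the last application gives the value at 0, hence the shift from [j.+1] to
    [j]. *)
Lemma Kpow_ginibre_decay (l : R) : good nu K -> 0 <= l ->
  (forall g, bmf g -> qf nu K g <= l * nrm2 nu g) ->
  exists2 c : R, 0 <= c & forall j, normc (Kpow nu K j.+1 (K ^~ 0) 0) <= c * l ^+ j.
Proof.
move=> gK l0 hl; pose f j := Kpow nu K j (K ^~ 0).
have mf j : bmf (f j) by apply: (bmf_Kpow nu mK); exact: bmker_col.
have step j : nrm2 nu (f j.+1) <= l ^+ 2 * nrm2 nu (f j).
  have [->|n0] := eqVneq (nrm2 nu (f j.+1)) 0; first by rewrite mulr_ge0 ?nrm2_ge0// exprn_ge0.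
  have n1 : 0 < nrm2 nu (f j.+1) by rewrite lt_neqAle eq_sym n0 nrm2_ge0.
  have := Kcauchy_schwarz gK (mf j) (mf j.+1).
  have -> : Kop nu K (f j) = f j.+1 by [].
  rewrite ip_nrm2// normc_real ger0_norm ?nrm2_ge0// => h.
  rewrite -(ler_pM2r n1) -expr2 (le_trans h)//.
  have [_ _ q0] := gK.
  apply: (@le_trans _ _ ((l * nrm2 nu (f j)) * (l * nrm2 nu (f j.+1)))).
    by rewrite ler_pM ?q0// hl.
  by rewrite mulrACA -expr2 mulrA.
have dec j : nrm2 nu (f j) <= (l ^+ j) ^+ 2 * nrm2 nu (f 0).
  elim: j => [|j IH]; first by rewrite expr0 expr1n mul1r.
  rewrite (le_trans (step j))// (exprS l j) exprMn -[leRHS]mulrA ler_wpM2l// exprn_ge0//.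
exists (Num.sqrt (kbound nu K * nrm2 nu (f 0))) => [|j]; first exact: sqrtr_ge0.
rewrite normc_sqrt -(ger0_norm (exprn_ge0 j l0)) -sqrtr_sqr -sqrtrM; last first.
  by rewrite mulr_ge0 ?nrm2_ge0// kbound_ge0.
apply: ler_wsqrtr; rewrite -/(f j.+1) (le_trans (Kop_pointwise (0 : C) gK (mf j)))//.
by rewrite -[leRHS]mulrA ler_wpM2l ?kbound_ge0// mulrC dec.
Qed.

Lemma iter_kernelE n v : iter_kernel K D n v 0 = Kpow nu K n (K ^~ 0) v.
Proof.
elim: n v => [//|n IH] v; rewrite KpowS /= -(kernel_operator_Kop mD moo)//; last first.
  by apply: (bmf_Kpow nu mK); exact: bmker_col.
by congr cintegral; apply/funext => w; rewrite IH.
Qed.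

Lemma resolvent_series (A : C) : (fun m => \sum_(j < m) r j) @ \oo --> A ->
  pi * Re (resolvent_kernel K D 0 0) = Re A.
Proof.
move=> hA; have p0 : pi != 0 :> R by rewrite gt_eqF// pi_gt0.
have pC : pi%:C != 0 :> C by apply/eqP => /(congr1 (@complex.Re R)) /= /eqP; apply/negP.
have hB : (fun N => \sum_(1 <= n < N) iter_kernel K D n 0 0) @ \oo --> pi%:C^-1 * A - K 0 0.
  rewrite -(cvg_shiftS (fun N => \sum_(1 <= n < N) iter_kernel K D n 0 0)) /=.
  rewrite (_ : (fun N => _) = (fun N => pi%:C^-1 * (\sum_(j < N.+1) r j) - K 0 0)); last first.
    apply/funext => N; rewrite mulr_sumr -(big_mkord xpredT (fun j => pi%:C^-1 * r j)).
    rewrite [in RHS]big_ltn// /r mulKf// addrAC subrr add0r.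
    by apply: eq_bigr => n _; rewrite mulKf// iter_kernelE.
  apply: cvgcB; last exact: cvgc_cst.
  apply: cvgcM; first exact: cvgc_cst.
  by rewrite (cvg_shiftS (fun m => \sum_(j < m) r j)).
have -> : resolvent_kernel K D 0 0 = pi%:C^-1 * A.
  rewrite /resolvent_kernel.
  have h : (fun N => \sum_(1 <= n < N) iter_kernel K D n 0 0) @ \oo -->
     limn (fun N => \sum_(1 <= n < N) iter_kernel K D n 0 0).
    exact: (cvgP _ hB).
  by rewrite (cvgc_unique h hB) addrC subrK.
by rewrite -fmorphV ReM Re_real Im_real mul0r subr0 mulVKf.
Qed.

Lemma ginibre_void_probability (alpha : nat -> R) :
  eigenvalue_sequence K D alpha ->
  (limn (fun N => \prod_(n < N) (1 - alpha n)) = fine (P [set w | phi w `&` D = set0])) /\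
  (fine (P [set w | phi w `&` D = set0]) != 0 ->
   pi * Re (resolvent_kernel K D 0 0) * fine (P [set w | phi w `&` D = set0]) =
   fine (P [set w | phi0 w `&` D = set0])).
Proof.
move=> halpha.
have [gK [lam [psi [[lam0 mpsi Kpsi orth spec] treal gap gapc lamc]]]] := spectral.
pose e := recoef nu K; have ne : newton (rtrace nu K) e := recoef_newton mK treal.
(* Dominating both terms, [eps N] satisfies [lam N ^+ n * trace_gap nu K lam 0 N <= eps N ^+ n.+1],
   the form required by [newton_product]. *)
pose eps N := lam N + trace_gap nu K lam 0 N.
have g0 N : 0 <= trace_gap nu K lam 0 N by have /andP[] := gap 0%N N.
have prodE := @newton_product R (rtrace nu K) e lam eps ne.
have {}prodE : forall s, exists2 F : R, altsum e s @ \oo --> F &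
    (fun N => \prod_(n < N) (1 - s * lam n)) @ \oo --> F.
  apply: prodE.
  - by move=> N; rewrite addr_ge0.
  - by rewrite -(addr0 0); apply: cvgD.
  move=> n N; rewrite -/(trace_gap nu K lam n N); have /andP[h1 h2] := gap n N.
  have e1 : lam N <= eps N by rewrite /eps lerDl.
  have e2 : trace_gap nu K lam 0 N <= eps N by rewrite /eps lerDr.
  rewrite ger0_norm// (le_trans h2)// exprSr ler_pM ?exprn_ge0//.
  by rewrite lerXn2r ?nnegrE//; exact: le_trans e1.
have lam1 n : lam n <= 1.
  rewrite leNgt; apply/negP => ln.
  have l0 : 0 < lam n by exact: lt_trans ln.
  pose s := (lam n)^-1.
  have s01 : 0 <= s < 1 by rewrite invr_ge0 lam0 invf_lt1.
  have [F hF hprod] := prodE s.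
  have F0 : F = 0.
    rewrite -(cvg_lim (@Rhausdorff R) hprod); apply/cvg_lim => //.
    apply: cvg_near_cst; exists n.+1 => // N /= nN.
    by rewrite (bigD1 (Ordinal nN))//= mulVf ?gt_eqF// subrr mul0r.
  have /andP[s0 s1] := s01.
  have s01' : 0 <= s <= 1 by rewrite s0 ltW.
  have h := generating_function Drad hphi mK s01' (altsum_tail_cvg0 s0 hF).
  have := generating_function_gt0 mD Drad hphi s01.
  rewrite -(cvg_lim (@Rhausdorff R) h) (cvg_lim (@Rhausdorff R) hF) F0 ltxx//.
have [F hF hprod] := prodE 1.
have s1 : 0 <= (1 : R) <= 1 by rewrite ler01 lexx.
have FE : F = fine (P [set w | phi w `&` D = set0]).
  rewrite -(void_Rintegral mD Drad hphi).
  have h := generating_function Drad hphi mK s1 (altsum_tail_cvg0 ler01 hF).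
  by rewrite -(cvg_lim (@Rhausdorff R) h) (cvg_lim (@Rhausdorff R) hF).
have {}hprod : (fun N => \prod_(n < N) (1 - lam n)) @ \oo --> F.
  rewrite (_ : (fun N => _) = fun N => \prod_(n < N) (1 - 1 * lam n))//.
  by apply/funext => N; apply: eq_bigr => n _; rewrite mul1r.
split.
  rewrite (eigenvalue_sequence_prod gK lam0 mpsi Kpsi orth spec lamc lam1 halpha) -FE.
  exact: (cvg_lim (@Rhausdorff R) hprod).
rewrite -FE => F0.
have ltlam n : lam n < 1.
  rewrite lt_neqAle lam1 andbT; apply/eqP => ln; move/eqP: F0; apply.
  rewrite -(cvg_lim (@Rhausdorff R) hprod); apply/cvg_lim => //.
  apply: cvg_near_cst; exists n.+1 => // N /= nN.
  by rewrite (bigD1 (Ordinal nN))//= ln subrr mul0r.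
(* [lam 0] bounds all Rayleigh quotients, by [spec] with [N = 0]; [1 / 2] keeps [rho] positive, so
   that it can be divided by. *)
pose rho := Num.max (lam 0%N) (2^-1).
have rho1 : rho < 1 by rewrite gt_max ltlam/=; lra.
have rho2 : 2^-1 <= rho by rewrite le_max lexx orbT.
have rho0 : 0 < rho by apply: lt_le_trans rho2; lra.
have [c c0 hc] : exists2 c : R, 0 <= c & forall j, normc (Kpow nu K j.+1 (K ^~ 0) 0) <= c * rho ^+ j.
  apply: (Kpow_ginibre_decay gK (ltW rho0)) => g mg.
  have := spec 0%N g mg; rewrite big_ord0 subr0 => /andP[_ h].
  by rewrite (le_trans h)// ler_wpM2r ?nrm2_ge0// le_max lexx.
(* The [1] accounts for [r 0 = 1], the division by [rho] for the index shift in [hc]. *)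
pose c' := 1 + pi * c / rho.
have pc : 0 <= pi * c / rho by rewrite divr_ge0 ?(ltW rho0)// mulr_ge0// pi_ge0.
have c'0 : 0 <= c' by rewrite addr_ge0.
have rb j : normc (r j) <= c' * rho ^+ j.
  case: j => [|j].
    have -> : r 0 = pi%:C * K 0 0 by [].
    rewrite expr0 mulr1 ginibre_kernel00 -(rmorphM (real_complex R)) mulfV ?gt_eqF ?pi_gt0//.
    by rewrite normc1 lerDl.
  rewrite /r normcM normc_real ger0_norm ?pi_ge0// exprS mulrA.
  apply: (@le_trans _ _ (pi * c * rho ^+ j)); first by rewrite -mulrA ler_wpM2l ?pi_ge0.
  apply: ler_wpM2r; first by rewrite exprn_ge0// ltW.
  have -> : c' * rho = rho + pi * c by rewrite /c' mulrDl mul1r divfK// gt_eqF.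
  by rewrite lerDr ltW.
have r01 : 0 <= rho < 1 by rewrite rho1 ltW.
have [A hA] := geometric_dominated_cvgc c'0 r01 rb.
rewrite (resolvent_series hA).
have hAr : (fun m => \sum_(j < m) Re (r j)) @ \oo --> Re A.
  by have := cvgc_Re hA; under eq_fun do rewrite Re_sum.
have hu : (fun m => \sum_(j < m) (- 1) ^+ j * e j) @ \oo --> F by exact: hF.
have rbr j : `|Re (r j)| <= c' * rho ^+ j by exact: le_trans (normc_Re _) (rb j).
have hM := @mertens R (fun j => Re (r j)) (fun j => (- 1) ^+ j * e j) c' rho (Re A) F r01 rbr hAr hu.
have h0 : altsum (recoef nu K0) 1 @ \oo --> Re A * F.
  rewrite (_ : altsum _ _ = fun m => \sum_(k < m) \sum_(j < k.+1) Re (r j) * ((- 1) ^+ (k - j) * e (k - j)%N)) //.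
  apply/funext => m; apply: eq_bigr => k _; rewrite recoef_ginibre0 mulr_sumr.
  apply: eq_bigr => j _; rewrite -/e.
  have -> : (-1) ^+ k = (-1) ^+ j * (-1) ^+ (k - j) :> R by rewrite -exprD subnKC// -ltnS.
  have h : ((-1) ^+ j) ^+ 2 = 1 :> R by rewrite -exprM mulnC exprM sqrrN !expr1n.
  transitivity (((-1) ^+ j) ^+ 2 * (Re (r j) * ((-1) ^+ (k - j) * e (k - j)%N))); first by ring.
  by rewrite h mul1r.
have h := generating_function Drad hphi0 (@bmker_ginibre0 R) s1 (altsum_tail_cvg0 ler01 h0).
rewrite -(void_Rintegral mD Drad hphi0).
by rewrite -(cvg_lim (@Rhausdorff R) h) (cvg_lim (@Rhausdorff R) h0).
Qed.

End ginibre_void.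

(** * Geometry of the Voronoi cell *)

Section voronoi_geometry.
Variable R : realType.
Local Notation C := R[i].
Implicit Types (p q u z : C) (psi : set C).

Lemma nbhs_complexP p (A : set C) :
  nbhs p A <-> exists2 e : R, 0 < e & forall q, normc (q - p) < e -> A q.
Proof.
split=> [/nbhs_ballP[e /= e0 eA]|[e e0 eA]].
  have eE : e = (Re e)%:C by move: e0; rewrite ltcE => /andP[/eqP h _]; apply: eqcP.
  exists (Re e) => [|q qe]; first by move: e0; rewrite eE ltcR.
  by apply: eA; rewrite /ball/= normC eE ltcR normc_distC.
apply/nbhs_ballP; exists e%:C => /=; first by rewrite ltcR.
by move=> q; rewrite /ball/= normC ltcR normc_distC => /eA.
Qed.

Lemma closer_halfplane z u : (normc z <= normc (z - u)) = (2 * Re (z * u^*) <= normc u ^+ 2).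
Proof.
rewrite -(ler_pXn2r (n := 2)) ?nnegrE ?normc_ge0//.
have -> : normc (z - u) ^+ 2 = normc z ^+ 2 - 2 * Re (z * u^*) + normc u ^+ 2.
  by rewrite !normcE2 !ReImE; ring.
by apply/idP/idP => h; lra.
Qed.

Lemma cell0P psi z : cell0 psi z <-> forall u, psi u -> 2 * Re (z * u^*) <= normc u ^+ 2.
Proof.
split=> h u /h; first by rewrite !normC lecR closer_halfplane.
by move=> hu; rewrite !normC lecR closer_halfplane.
Qed.

Lemma cell0_dist psi z : cell0 psi z <-> forall u, psi u -> normc z <= normc (z - u).
Proof. by split=> h u /h; rewrite !normC lecR. Qed.

Lemma bisector0P z p : bisector0 z p <-> 2 * Re (p * z^*) = normc z ^+ 2.
Proof.
rewrite /bisector0 /= mulrBl ReB.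
have -> : Re (z / 2 * z^*) = normc z ^+ 2 / 2.
  have half : 2^-1 = (2^-1)%:C :> C by rewrite fmorphV rmorph_nat.
  by rewrite mulrAC mulcJ half -(rmorphM (real_complex R)).
by split=> h; lra.
Qed.

Lemma closed_cell0 psi : closure (cell0 psi) `<=` cell0 psi.
Proof.
move=> p cp; apply/cell0_dist => u pu; rewrite leNgt; apply/negP => lt.
pose e := (normc p - normc (p - u)) / 2.
have e0 : 0 < e by rewrite /e; lra.
have /cp [q [/cell0_dist /(_ u pu) hq hqp]] : nbhs p [set q | normc (q - p) < e].
  by apply/nbhs_complexP; exists e.
have h1 := normcD (p - q) q; have h2 := normcD (q - p) (p - u).
move: hqp h1 h2; rewrite /= subrK addrA subrK (normc_distC p q) /e => *; lra.
Qed.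

Lemma cell0_setU1 psi z p : bisector0 z p -> cell0 psi p -> cell0 (psi `|` [set z]) p.
Proof.
move=> /bisector0P bp /cell0P cp; apply/cell0P => u [/cp//|/= ->].
by rewrite bp.
Qed.

(** Any push of [p] in the direction [z] crosses the bisector of [[0, z]] and so leaves the cell. *)
Lemma cell0_boundary psi z p : z != 0 -> bisector0 z p -> cell0 (psi `|` [set z]) p ->
  boundary (cell0 (psi `|` [set z])) p.
Proof.
move=> z0 /bisector0P bp cp; split; first exact: subset_closure.
move=> /nbhs_complexP [e e0 eA].
have nz : 0 < normc z by exact: normc_gt0.
pose c := e / (2 * normc z).
have c0 : 0 < c by rewrite divr_gt0// mulr_gt0.
have /eA /cell0P /(_ z) : normc (p + c%:C * z - p) < e.
  rewrite addrC addKr normcM normc_real gtr0_norm//.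
  have -> : c * normc z = e / 2 by rewrite /c; field; rewrite gt_eqF.
  lra.
move=> /(_ (or_intror erefl)); rewrite (mulrDl p) ReD mulrDr bp -(mulrA c%:C) mulcJ.
rewrite -(rmorphM (real_complex R)) Re_real.
have : 0 < c * normc z ^+ 2 by rewrite mulr_gt0// exprn_gt0.
move=> *; lra.
Qed.

(** A criterion without boundary: a point of the bisector in the cell of [psi] is a boundary point
    of the cell of the enlarged set; conversely that cell is closed and contained in the cell of
    [psi]. *)
Lemma neighbours0P psi z : z != 0 ->
  neighbours0 (psi `|` [set z]) z <-> exists2 p, cell0 psi p & bisector0 z p.
Proof.
move=> z0; split=> [[_ [p [bp [cp _]]]]|[p cp bp]].
  exists p => //; have /cell0P h := closed_cell0 cp.
  by apply/cell0P => u pu; apply: h; left.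
split; first by right.
by exists p; split => //; apply: cell0_boundary => //; exact: cell0_setU1.
Qed.

(** This settles the degenerate case [z = 0], where the bisector is the whole plane. For a nonzero
    point [u], the ray from 0 through [u] leaves the cell at the parameter [sup S <= 1 / 2], and the
    exit point is a boundary point. *)
Lemma boundary_cell0P psi :
  boundary (cell0 (psi `|` [set 0])) !=set0 <-> exists2 u, psi u & u != 0.
Proof.
split=> [[p [cp np]]|[u pu u0]].
  apply: contrapT => h; apply: np; apply/nbhs_complexP; exists 1 => // q _.
  apply/cell0P => u pu; suff -> : u = 0.
    by rewrite (rmorph0 (@conjc R)) mulr0 mulr0 exprn_ge0// normc_ge0.
  by case: pu => [pu|//]; apply/eqP/negPn/negP => u0; apply: h; exists u.
have nu0 : 0 < normc u by exact: normc_gt0.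
set A := cell0 _.
pose S : set R := [set t | A (t%:C * u)].
have S0 : S 0 by apply/cell0P => v _; rewrite mul0r mul0r mulr0 exprn_ge0// normc_ge0.
have Sub : ubound S (2^-1).
  move=> t /cell0P /(_ u (or_introl pu)); rewrite -(mulrA t%:C) mulcJ -(rmorphM (real_complex R)) Re_real.
  rewrite mulrA -{2}(mul1r (normc u ^+ 2)) ler_pM2r ?exprn_gt0// => h; lra.
have hS : has_sup S by split; [exists 0|exists 2^-1].
pose t := sup S.
have St : S t.
  apply/cell0P => v pv; rewrite leNgt; apply/negP => lt.
  pose a := Re (u * v^*).
  have E s : 2 * Re (s%:C * u * v^*) = s * (2 * a).
    by rewrite -(mulrA _%:C) ReM Re_real Im_real mul0r subr0 mulrCA.
  rewrite E in lt.
  have t0 : 0 <= t by apply: ub_le_sup => //; exists 2^-1.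
  have a0 : 0 < a.
    rewrite ltNge; apply/negP => a0; move: lt; rewrite ltNge => /negP; apply.
    apply: (@le_trans _ _ 0); last by rewrite exprn_ge0// normc_ge0.
    by rewrite mulr_ge0_le0//; lra.
  pose e := t - normc v ^+ 2 / (2 * a).
  have e0 : 0 < e by rewrite subr_gt0 ltr_pdivrMr// mulr_gt0.
  have [s Ss ts] := sup_adherent e0 hS.
  have /cell0P /(_ v pv) := Ss; rewrite E.
  rewrite -ler_pdivlMr ?mulr_gt0//; move: ts; rewrite -/t /e => *; lra.
exists (t%:C * u); split; first exact: subset_closure.
move=> /nbhs_complexP [e e0 eA].
pose c := e / (2 * normc u).
have c0 : 0 < c by rewrite divr_gt0// mulr_gt0.
have /eA Sc : normc ((t + c)%:C * u - t%:C * u) < e.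
  rewrite -mulrBl -(rmorphB (real_complex R)) addrC addKr normcM normc_real gtr0_norm//.
  have -> : c * normc u = e / 2 by rewrite /c; field; rewrite gt_eqF.
  lra.
have : t + c <= t by apply: ub_le_sup => //; exists 2^-1.
lra.
Qed.

Lemma neighbours0_0 psi : neighbours0 (psi `|` [set 0]) (0 : C) <-> exists2 u, psi u & u != 0.
Proof.
rewrite -boundary_cell0P; split=> [[_ [p [_ h]]]|[p h]]; first by exists p.
split; first by right.
by exists p; split => //; apply/bisector0P; rewrite (rmorph0 (@conjc R)) mulr0 normc0 expr0n mulr0.
Qed.

(** The centre [c] is in the cell of [psi] because the disc around it with 0 on its rim contains no
    point of [psi], and it is closer to [u] than to 0. The cell is star-shaped about 0, so [[0, c]]
    crosses the bisector of [[0, u]] inside it. *)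
Lemma discs_neighbours0 k (z : k.-tuple C) psi u :
  psi `&` discs z = set0 -> discs z u -> u != 0 /\ neighbours0 (psi `|` [set u]) u.
Proof.
move=> pz; case=> i; rewrite !normC ltcR => hi0; pose c := tnth z i; have hi : normc (u - c) < normc c by exact: hi0.
have u0 : u != 0.
  by apply: contraTneq hi => ->; rewrite sub0r normcN ltxx.
split => //; apply/(neighbours0P _ u0).
have hc : cell0 psi c.
  apply/cell0_dist => v pv; rewrite leNgt; apply/negP => lt.
  have : (psi `&` discs z) v by split => //; exists i; rewrite !normC ltcR normc_distC.
  by rewrite pz.
have nu0 : 0 < normc u by exact: normc_gt0.
have h1 : normc u ^+ 2 < 2 * Re (c * u^*).
  by move: hi; rewrite normc_distC ltNge closer_halfplane -ltNge.
have r0 : 0 < 2 * Re (c * u^*) by apply: lt_trans h1; rewrite exprn_gt0.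
pose t := normc u ^+ 2 / (2 * Re (c * u^*)).
have t0 : 0 <= t by rewrite divr_ge0// ?exprn_ge0 ?normc_ge0// ltW.
have t1 : t <= 1 by rewrite ler_pdivrMr// mul1r ltW.
have E v : 2 * Re (t%:C * c * v^*) = t * (2 * Re (c * v^*)).
  by rewrite -(mulrA t%:C) (ReM t%:C) [Re t%:C]/= [Im t%:C]/= mul0r subr0 mulrCA.
exists (t%:C * c).
  apply/cell0P => v pv; rewrite E; have /cell0P /(_ v pv) h := hc.
  have [n0|n0] := leP 0 (2 * Re (c * v^*)).
    by apply: le_trans h; rewrite ler_piMl.
  apply: (@le_trans _ _ 0); last by rewrite exprn_ge0// normc_ge0.
  by rewrite mulr_ge0_le0// ltW.
by apply/bisector0P; rewrite E /t divfK// gt_eqF.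
Qed.

End voronoi_geometry.

(** * Measurability *)

Section measurable_avoidance.
Variable R : realType.
Local Notation C := R[i].
Context d (Omega : measurableType d).

Definition cmf d' (X : measurableType d') (f : X -> C) :=
  measurable_fun setT (fun x => Re (f x)) /\ measurable_fun setT (fun x => Im (f x)).

Lemma measurable_fun_cmf d' (X : measurableType d') (f : X -> C) :
  measurable_fun setT f -> cmf f.
Proof. by move=> mf; split; [exact: measurable_ReD|exact: measurable_ImD]. Qed.

Lemma cmf_cst d' (X : measurableType d') (c : C) : cmf (fun _ : X => c).
Proof. by split; exact: measurable_cst. Qed.

Lemma cmfB d' (X : measurableType d') (f g : X -> C) : cmf f -> cmf g ->
  cmf (fun x => f x - g x).
Proof.
move=> [fr fi] [gr gi]; split.
  by under eq_fun do rewrite ReB; exact: measurable_funB.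
by under eq_fun do rewrite ImB; exact: measurable_funB.
Qed.

Lemma cmfM d' (X : measurableType d') (f g : X -> C) : cmf f -> cmf g ->
  cmf (fun x => f x * g x).
Proof.
move=> [fr fi] [gr gi]; split.
  by under eq_fun do rewrite ReM; apply: measurable_funB; exact: measurable_funM.
by under eq_fun do rewrite ImM; apply: measurable_funD; exact: measurable_funM.
Qed.

Lemma cmf_normc d' (X : measurableType d') (f : X -> C) : cmf f ->
  measurable_fun setT (fun x => normc (f x)).
Proof.
move=> [fr fi]; exact: (measurableT_comp (@measurable_normc R) (measurable_complexP fr fi)).
Qed.

Lemma measurable_le_set d' (X : measurableType d') (f g : X -> R) :
  measurable_fun setT f -> measurable_fun setT g -> measurable [set x | f x <= g x].
Proof. by move=> mf mg; rewrite -[X in measurable X]setTI; exact: measurable_fun_le. Qed.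

Lemma measurable_lt_set d' (X : measurableType d') (f g : X -> R) :
  measurable_fun setT f -> measurable_fun setT g -> measurable [set x | f x < g x].
Proof.
move=> mf mg; rewrite (_ : [set x | _] = ~` [set x | g x <= f x]).
  by apply: measurableC; exact: measurable_le_set.
by apply/seteqP; split => x /=; rewrite ltNge => /negP.
Qed.

Lemma normc_triangle (a b c : C) : normc (a - c) <= normc (a - b) + normc (b - c).
Proof. by have := normcD (a - b) (b - c); rewrite addrA subrK. Qed.

Definition cball (c : C) (r : R) : set C := [set v | normc (v - c) < r].

Lemma measurable_cball c r : measurable (cball c r).
Proof.
apply: (measurable_lt_set (f := fun v : C => normc (v - c)) (g := fun=> r)) => //.
apply: cmf_normc; apply: cmfB; last exact: cmf_cst.
by apply: measurable_fun_cmf; exact: measurable_id.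
Qed.

Lemma rat_dense (u : C) (e : R) : 0 < e ->
  exists q1 q2 : rat, normc (u - (ratr q1 +i* ratr q2)) < e.
Proof.
move=> e0; have h (a : R) : exists q : rat, `|a - ratr q| < e / 2.
  have lt : a - e / 2 < a + e / 2 by lra.
  have [q] := rat_in_itvoo lt; rewrite in_itv/= => /andP[h1 h2].
  by exists q; rewrite ltr_norml; apply/andP; split; lra.
have [q1 h1] := h (Re u); have [q2 h2] := h (Im u).
exists q1, q2; rewrite (le_lt_trans (normc_le_ReIm _))// ReB ImB/=; lra.
Qed.

Variable psi : Omega -> set C.
Hypothesis hpsi : point_process psi.

Lemma measurable_avoid (A : set C) : measurable A -> measurable [set w | psi w `&` A = set0].
Proof.
have [_ mc] := hpsi => mA.
rewrite (_ : [set w | _] = (fun w => counting (psi w `&` A) : \bar R) @^-1` [set 0%E]).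
  by rewrite -[X in measurable X]setTI; apply: (mc _ mA) => //; exact: emeasurable_set1.
apply/seteqP; split => w /=; rewrite /counting; first by move=> ->; rewrite asboolT// fset_set0 cardfs0.
case: asboolP => // fA [] /eqP; rewrite pnatr_eq0 => /eqP /cardfs0_eq h.
by rewrite -(fset_setK fA) h set_fset0.
Qed.

(* An open ball is avoided iff so are all the rational balls it contains. *)
Lemma measurable_avoid_cball d' (X : measurableType d') (c : X -> C) (rho : X -> R)
    (p : X -> Omega) : cmf c -> measurable_fun setT rho -> measurable_fun setT p ->
  measurable [set x | psi (p x) `&` cball (c x) (rho x) = set0].
Proof.
move=> mc mrho mp.
pose q (q1 q2 : rat) : C := ratr q1 +i* ratr q2.
pose S q1 q2 n : set X := [set x | normc (q q1 q2 - c x) + n.+1%:R^-1 <= rho x] `&`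
  p @^-1` (~` [set w | psi w `&` cball (q q1 q2) n.+1%:R^-1 = set0]).
have mS q1 q2 n : measurable (S q1 q2 n).
  apply: measurableI.
    apply: measurable_le_set => //; apply: measurable_funD => //.
    by apply: cmf_normc; apply: cmfB => //; exact: cmf_cst.
  rewrite -[X in measurable X]setTI; apply: mp => //; apply: measurableC.
  by apply: measurable_avoid; exact: measurable_cball.
rewrite (_ : [set x | _] = ~` \bigcup_q1 \bigcup_q2 \bigcup_n S q1 q2 n).
  apply: measurableC; apply: bigcupT_measurable_rat => q1.
  by apply: bigcupT_measurable_rat => q2; exact: bigcupT_measurable.
apply/seteqP; split => x /=.
  move=> e [q1 _ [q2 _ [n _ [/= h]]]]; apply.
  apply/seteqP; split => // v [pv bv]; rewrite -e; split => //.
  apply: le_lt_trans (normc_triangle v (q q1 q2) (c x)) _; apply: lt_le_trans h.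
  by rewrite addrC ltrD2l.
move=> h; apply/seteqP; split => // v [pv bv]; apply: h.
pose e := (rho x - normc (v - c x)) / 2.
have e0 : 0 < e by rewrite divr_gt0// subr_gt0.
pose n := Num.truncn e^-1.
have ne : n.+1%:R^-1 < e.
  by rewrite invf_plt ?posrE ?ltr0n// truncnS_gt.
have n0 : 0 < n.+1%:R^-1 :> R by rewrite invr_gt0 ltr0n.
have [q1 [q2 hq]] := rat_dense v n0.
exists q1 => //; exists q2 => //; exists n => //; split => /=.
  have := normc_triangle (q q1 q2) v (c x); rewrite (normc_distC _ v).
  by move: ne hq; rewrite /e /q; move: (n.+1%:R^-1) => *; lra.
by move=> E; have : (psi (p x) `&` cball (q q1 q2) n.+1%:R^-1) v by []; rewrite E.
Qed.

Lemma measurable_avoid_discs k :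
  measurable [set x : k.-tuple C * Omega | psi x.2 `&` discs x.1 = set0].
Proof.
rewrite (_ : [set x | _] = \bigcap_(i in [set: 'I_k])
    [set x : k.-tuple C * Omega | psi x.2 `&` cball (tnth x.1 i) (normc (tnth x.1 i)) = set0]).
  apply: fin_bigcap_measurable; first exact: finite_finset.
  move=> i _.
  have mt : cmf (fun x : k.-tuple C * Omega => tnth x.1 i).
    by apply: measurable_fun_cmf; apply: measurableT_comp (measurable_tnth _) _.
  apply: measurable_avoid_cball => //; exact: cmf_normc.
apply/seteqP; split => x /= h.
  move=> i _ /=; apply/seteqP; split => // v [pv bv]; rewrite -h; split => //.
  by exists i; rewrite !normC ltcR.
apply/seteqP; split => // v [pv [ i ]]; rewrite !normC ltcR => bv.
by rewrite -(h i I).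
Qed.

Lemma measurable_mem_discs k (Z : Omega -> C) : measurable_fun setT Z ->
  measurable [set x : k.-tuple C * Omega | discs x.1 (Z x.2)].
Proof.
move=> mZ.
rewrite (_ : [set x | _] = \bigcup_(i in [set: 'I_k])
    [set x : k.-tuple C * Omega | normc (Z x.2 - tnth x.1 i) < normc (tnth x.1 i)]).
  apply: fin_bigcup_measurable; first exact: finite_finset.
  move=> i _.
  have mt : cmf (fun x : k.-tuple C * Omega => tnth x.1 i).
    by apply: measurable_fun_cmf; apply: measurableT_comp (measurable_tnth _) _.
  have mz : cmf (fun x : k.-tuple C * Omega => Z x.2).
    by apply: measurable_fun_cmf; exact: measurableT_comp.
  by apply: measurable_lt_set; apply: cmf_normc => //; exact: cmfB.
apply/seteqP; split => x /=.
  by case=> i; rewrite !normC ltcR => h; exists i.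
by case=> i _ /= h; exists i; rewrite !normC ltcR.
Qed.

(* For [Z w != 0] the event says that some point of the bisector lies in the closed cell; by
   compactness this is a countable combination of conditions at rational points of the bisector.
   For [Z w = 0] it says that [psi w] has a nonzero point. *)
Lemma measurable_neighbours0 (Z : Omega -> C) : measurable_fun setT Z ->
  measurable [set w | neighbours0 (psi w `|` [set Z w]) (Z w)].
Proof.
move=> mZ; have cZ : cmf Z by exact: measurable_fun_cmf.
(* [t] parametrises the bisector of [[0, Z w]] when [Z w != 0]. *)
pose pt w (t : R) : C := Z w * (2^-1 +i* t).
have mpt t : cmf (fun w => pt w t) by apply: cmfM => //; exact: cmf_cst.
(* The bound [n] on the parameter supplies compactness; [1 / (m + 1)] is the tolerance with which
   the point of parameter [q] may fail to be in the cell. *)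
pose V n m (q : rat) : set Omega := if `|ratr q| <= n%:R :> R then
  [set w | psi w `&` cball (pt w (ratr q)) (normc (pt w (ratr q)) - m.+1%:R^-1) = set0] else set0.
have mV n m q : measurable (V n m q).
  rewrite /V; case: ifP => // _; apply: measurable_avoid_cball => //.
  by apply: measurable_funB => //; exact: cmf_normc.
pose E0 : set Omega := [set w | Z w = 0].
have mE0 : measurable E0.
  rewrite (_ : E0 = [set w | normc (Z w) <= 0]).
    by apply: measurable_le_set => //; exact: cmf_normc.
  apply/seteqP; split => w /=; rewrite /E0/=; first by move=> ->; rewrite normc0.
  by move=> h; apply: normc_eq0; apply/eqP; rewrite eq_le h normc_ge0.
have mE1 : measurable (~` [set w | psi w `&` [set~ 0] = set0]).
  apply: measurableC; apply: measurable_avoid; apply: measurableC.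
  rewrite (_ : [set 0] = [set v : C | normc v <= 0]).
    apply: measurable_le_set => //; exact: measurable_normc.
  apply/seteqP; split => v /=; first by move=> ->; rewrite normc0.
  by move=> h; apply: normc_eq0; apply/eqP; rewrite eq_le h normc_ge0.
rewrite (_ : [set w | _] = (E0 `&` ~` [set w | psi w `&` [set~ 0] = set0]) `|`
    (~` E0 `&` \bigcup_n \bigcap_m \bigcup_q V n m q)).
  apply: measurableU; first exact: measurableI.
  apply: measurableI; first exact: measurableC.
  apply: bigcupT_measurable => n; apply: bigcapT_measurable => m.
  exact: bigcupT_measurable_rat.
apply/seteqP; split => w /=.
  have [Z0|Z0] := eqVneq (Z w) 0.
    rewrite Z0 => /neighbours0_0 [u pu u0]; left; split => //= h.
    have : (psi w `&` [set~ 0]) u by split => // h0; rewrite h0 eqxx in u0.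
    by rewrite h.
  move=> /(neighbours0P _ Z0) [p cp /bisector0P bp]; right; split; first exact/eqP.
  have nZ : 0 < normc (Z w) by exact: normc_gt0.
  pose t := Im (p * (Z w)^*) / normc (Z w) ^+ 2.
  have pE : p = pt w t.
    have ZJ : (Z w)^* != 0 by apply/eqP => /(congr1 (fun z => normc z)); rewrite normc_conj normc0 => /eqP; rewrite gt_eqF.
    apply: (mulIf ZJ); rewrite /pt mulrAC mulcJ.
    have -> : (normc (Z w) ^+ 2)%:C * (2^-1 +i* t) = (normc (Z w) ^+ 2 / 2) +i* (normc (Z w) ^+ 2 * t) :> C.
      by apply: eqcP; rewrite [LHS]/= mul0r ?subr0 ?addr0.
    apply: eqcP; first by rewrite [RHS]/=; lra.
    by rewrite [RHS]/= /t [RHS]mulrCA mulfV ?mulr1// gt_eqF// exprn_gt0.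
  exists (Num.truncn (`|t| + 1)).+1 => // m _.
  (* The bound 1 keeps [q] within the range chosen for the parameter; the other bound moves the
     point by less than half the tolerance. *)
  pose e : R := Num.min 1 (m.+1%:R^-1 / (2 * normc (Z w))).
  have m0 : 0 < m.+1%:R^-1 :> R by rewrite invr_gt0 ltr0n.
  have e0 : 0 < e by rewrite lt_min ltr01/= divr_gt0// mulr_gt0.
  have lt : t < t + e by lra.
  have [q] := rat_in_itvoo lt; rewrite in_itv/= => /andP[h1 h2].
  have tq : `|ratr q - t| < e by rewrite ltr_norml; apply/andP; split; lra.
  exists q => //; rewrite /V ifT; last first.
    have tn := truncnS_gt (`|t| + 1); have e1 : e <= 1 by rewrite ge_min lexx.
    have := ler_normD (ratr q - t) t; rewrite subrK => ?.
    by apply: ltW; apply: le_lt_trans tn; lra.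
  apply/seteqP; split => // v [pv]; rewrite /cball/=.
  have dpt : 2 * normc (pt w (ratr q) - p) < m.+1%:R^-1.
    rewrite pE /pt -mulrBr normcM.
    have -> : (2^-1 +i* ratr q) - (2^-1 +i* t) = (0 +i* (ratr q - t)) :> C.
      by apply: eqcP; rewrite ?ReB ?ImB/= ?subrr.
    have -> : normc (0 +i* (ratr q - t) : C) = `|ratr q - t|.
      by rewrite /= expr0n add0r sqrtr_sqr.
    rewrite mulrA mulrC -ltr_pdivlMr ?mulr_gt0//; apply: lt_le_trans tq _.
    by rewrite ge_min lexx orbT.
  have /cell0_dist /(_ v pv) c1 := cp.
  have c2 := normc_triangle p (pt w (ratr q)) v.
  have c3 := normc_triangle (pt w (ratr q)) p 0.
  rewrite !subr0 in c3; rewrite (normc_distC p (pt w (ratr q))) in c2; rewrite (normc_distC v).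
  by move: (m.+1%:R^-1) dpt c1 c2 c3 => *; lra.
move=> [[Z0 h]|[Z0 [n _ hn]]].
  rewrite Z0; apply/neighbours0_0; apply: contrapT => h2; apply: h.
  by apply/seteqP; split => // v [pv /eqP v0]; apply: h2; exists v.
have hq m : exists q : rat, V n m q w by have [q _ hq] := hn m I; exists q.
have [q Vq] := choice hq.
have {Vq} [qn qV] : (forall m, `|ratr (q m)| <= n%:R :> R) /\
    (forall m v, psi w v -> normc (pt w (ratr (q m))) - m.+1%:R^-1 <= normc (v - pt w (ratr (q m)))).
  split=> m; have := Vq m; rewrite /V; case: ifP => // _.
  move=> E v pv; rewrite leNgt; apply/negP => lt.
  by have : (psi w `&` cball (pt w (ratr (q m))) (normc (pt w (ratr (q m))) - m.+1%:R^-1)) v by []; rewrite E.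
pose u m : R := ratr (q m).
have bu : bounded_fun u.
  by exists n%:R; split; [exact: num_real|move=> x nx m _; rewrite /= /u (le_trans (qn m))// ltW].
(* The parameters chosen for the successive tolerances are bounded by [n]; at a limit point [t] of
   them the tolerance has disappeared. *)
have [f incf cf] := bolzano_weierstrass bu.
pose t := limn (u \o f).
have /cluster_eventuallyP ct : cluster (u @ \oo) t.
  by apply/cluster_eventually_cvg; exists f.
have Z0' : Z w != 0 by exact/eqP.
apply/(neighbours0P _ Z0'); exists (pt w t); last first.
  apply/bisector0P; rewrite /pt mulrAC mulcJ ReM Re_real Im_real mul0r subr0 /=.
  by rewrite mulrCA mulfV ?mulr1.
apply/cell0_dist => v pv; apply/ler_addgt0Pr => e e0.
(* Within [e1] of [t] the point moves by at most [e / 4], which enters twice; the tolerance accounts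
   for the other [e / 2]. *)
pose e1 := e / (4 * (normc (Z w) + 1)).
have nz := normc_ge0 (Z w).
have e10 : 0 < e1 by rewrite divr_gt0// mulr_gt0//; lra.
pose N := Num.truncn (2 / e).
have [m Nm dm] := ct e1 N e10.
have me : m.+1%:R^-1 < e / 2.
  rewrite -[e / 2]invrK invf_div ltf_pV2 ?posrE ?divr_gt0// ?ltr0n//.
  by apply: lt_le_trans (truncnS_gt _) _; rewrite ler_nat ltnS.
have dpt : 2 * normc (pt w t - pt w (u m)) <= e / 2.
  rewrite /pt -mulrBr normcM.
  have -> : (2^-1 +i* t) - (2^-1 +i* u m) = (0 +i* (t - u m)) :> C.
    by apply: eqcP; rewrite ?ReB ?ImB/= ?subrr.
  have -> : normc (0 +i* (t - u m) : C) = `|t - u m|.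
    by rewrite /= expr0n add0r sqrtr_sqr.
  have : normc (Z w) * `|t - u m| <= (normc (Z w) + 1) * e1.
    by apply: ler_pM => //; lra.
  have -> : (normc (Z w) + 1) * e1 = e / 4 by rewrite /e1; field; rewrite gt_eqF//; lra.
  lra.
have c1 := qV m v pv.
have c2 := normc_triangle (pt w t) (pt w (u m)) 0.
have c3 := normc_triangle v (pt w t) (pt w (u m)).
rewrite !subr0 in c2; rewrite (normc_distC v (pt w t)) in c3.
rewrite -/(u m) in c1.
by move: (m.+1%:R^-1) me dpt c1 c2 c3 => *; lra.
Qed.

End measurable_avoidance.

Lemma xsectionP T1 T2 (A : set (T1 * T2)) x y : xsection A x y <-> A (x, y).
Proof. by rewrite /xsection/= inE. Qed.

Lemma ysectionP T1 T2 (A : set (T1 * T2)) x y : ysection A y x <-> A (x, y).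
Proof. by rewrite /ysection/= inE. Qed.

(** * The second moment method *)

Section second_moment.
Context d1 d2 (X : measurableType d1) (Omega : measurableType d2) (R : realType).
Variables (m : {sigma_finite_measure set X -> \bar R}) (P : probability Omega R).
Variables (B : set (X * Omega)) (mB : measurable B).

Let Y w := m (ysection B w).
Let h z := P (xsection B z).
Let hr z : R := fine (h z).

Let mY : measurable_fun setT Y.
Proof. exact: (measurable_fun_ysection m mB). Qed.

Let mh : measurable_fun setT h.
Proof. exact: (measurable_fun_xsection P mB). Qed.

Let hrE z : h z = (hr z)%:E.
Proof. by rewrite /hr fineK// fin_num_measure//; exact: measurable_xsection. Qed.

Let hr01 z : 0 <= hr z <= 1.
Proof.
rewrite -!lee_fin -hrE measure_ge0/=.
by apply: probability_le1; exact: measurable_xsection.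
Qed.

Let mhr : measurable_fun setT hr.
Proof. by apply: measurableT_comp => //; exact: measurable_fun_fine. Qed.

Let msq : measurable_fun setT (fun z => (Num.sqrt (hr z))%:E).
Proof.
apply/measurable_EFinP.
exact: (measurableT_comp (continuous_measurable_fun (@sqrt_continuous R)) mhr).
Qed.

Lemma integral_section (A : set (X * Omega)) : measurable A ->
  (\int[m]_z P (xsection A z) = \int[P]_w m (ysection A w))%E.
Proof.
move=> mA; have := indic_fubini_tonelli m P mA.
by rewrite indic_fubini_tonelli_FE// indic_fubini_tonelli_GE.
Qed.

Let pair_bound z z' : (P (xsection B z' `&` xsection B z) <= (Num.sqrt (hr z) * Num.sqrt (hr z'))%:E)%E.
Proof.
have mx t : measurable (xsection B t) by exact: measurable_xsection.
pose q := fine (P (xsection B z' `&` xsection B z)).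
have qE : P (xsection B z' `&` xsection B z) = q%:E.
  by rewrite /q fineK// fin_num_measure//; exact: measurableI.
have q0 : 0 <= q by rewrite -lee_fin -qE.
have q1 : q <= hr z' by rewrite -lee_fin -qE -hrE; apply: le_measure; rewrite ?inE//; exact: measurableI.
have q2 : q <= hr z by rewrite -lee_fin -qE -hrE; apply: le_measure; rewrite ?inE//; exact: measurableI.
rewrite qE lee_fin -sqrtrM; last by have /andP[] := hr01 z.
by rewrite -(ger0_norm q0) -sqrtr_sqr ler_wsqrtr// expr2 ler_pM.
Qed.

(** [Y w * Y w] is the measure of the pairs of points that are both good for [w]; exchanging
    integrals gives the probability that the sections at both points occur. *)
Lemma integral_section_sqr :
  (\int[P]_w (Y w * Y w) <=
   (\int[m]_z (Num.sqrt (hr z))%:E) * (\int[m]_z (Num.sqrt (hr z))%:E))%E.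
Proof.
set b := (\int[m]_z (Num.sqrt (hr z))%:E)%E.
have b0 : (0 <= b)%E by apply: integral_ge0 => z _; rewrite lee_fin sqrtr_ge0.
pose f (x : X * Omega) : \bar R := ((\1_B x)%:E * Y x.2)%E.
have mf : measurable_fun setT f.
  apply: emeasurable_funM; last exact: (measurableT_comp mY measurable_snd).
  by apply/measurable_EFinP; exact: measurable_indic.
have f0 x : (0 <= f x)%E by rewrite mule_ge0// lee_fin.
have YE w : (\int[m]_z (\1_B (z, w))%:E = Y w)%E.
  exact: (congr1 (fun g => g w) (indic_fubini_tonelli_GE m mB)).
have -> : (\int[P]_w (Y w * Y w) = \int[P]_w \int[m]_z f (z, w))%E.
  apply: eq_integral => w _; rewrite -{1}YE -ge0_integralZr//.
  apply/measurable_EFinP; apply: (measurableT_comp (measurable_indic mB)).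
  exact: pair2_measurable.
rewrite -(fubini_tonelli f mf f0).
have step z : (\int[P]_w f (z, w) <= (Num.sqrt (hr z))%:E * b)%E.
  (* For fixed [z], [B'] keeps only the outcomes in the section at [z]; its own sections are the
     pairwise intersections. *)
  pose B' := B `&` (setT `*` xsection B z).
  have mB' : measurable B'.
    by apply: measurableI => //; apply: measurableX => //; exact: measurable_xsection.
  have hB' z' w : B' (z', w) <-> B (z', w) /\ B (z, w).
    split=> [[h1 [_ h2]]|[h1 h2]]; split => //; first exact: (xsectionP B z w).1 h2.
    by split => //; exact: (xsectionP B z w).2 h2.
  have -> : (\int[P]_w f (z, w) = \int[P]_w m (ysection B' w))%E.
    apply: eq_integral => w _; rewrite /f indicE /=.
    have [zw|zw] := boolP ((z, w) \in B).
      rewrite mul1e /Y; congr (m _); apply/seteqP; split => z'.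
        by move=> /ysectionP zB; apply/ysectionP/hB'; split => //; move: zw; rewrite inE.
      by move=> /ysectionP/hB'[zB _]; apply/ysectionP.
    rewrite mul0e (_ : ysection B' w = set0) ?measure0//.
    apply/seteqP; split => // z' /ysectionP/hB'[_].
    by move: zw; rewrite notin_setE.
  rewrite -integral_section//.
  rewrite /b -ge0_integralZl//.
  apply: ge0_le_integral => //.
  - exact: (measurable_fun_xsection P mB').
  - by apply: emeasurable_funM => //; exact: measurable_cst.
  move=> z' _; rewrite -EFinM; apply: le_trans (pair_bound z z').
  rewrite (_ : xsection B' z' = xsection B z' `&` xsection B z)//.
  apply/seteqP; split => w.
    by move=> /xsectionP/hB'[bw zw]; split; apply/xsectionP.
  by move=> [/xsectionP h1 /xsectionP h2]; apply/xsectionP/hB'.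
apply: (@le_trans _ _ (\int[m]_z ((Num.sqrt (hr z))%:E * b))%E).
  apply: ge0_le_integral => //.
  - by move=> z _; apply: integral_ge0 => w _; exact: f0.
  - exact: measurable_fun_fubini_tonelli_F.
  - by apply: emeasurable_funM => //; exact: measurable_cst.
rewrite ge0_integralZr// => z _; by rewrite lee_fin sqrtr_ge0.
Qed.

(** Cauchy-Schwarz is used in the linearised form [2 c Y <= c^2 Y^2 + 1] on [N], which makes sense
    for [Y] with infinite values. *)
Lemma second_moment (N : set Omega) : measurable N ->
  (forall z w, B (z, w) -> N w) ->
  (((\int[m]_z (hr z)%:E) / (\int[m]_z (Num.sqrt (hr z))%:E)) ^+ 2 <= P N)%E.
Proof.
move=> mN BN.
set a := (\int[m]_z (hr z)%:E)%E; set b := (\int[m]_z (Num.sqrt (hr z))%:E)%E.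
have a0 : (0 <= a)%E by apply: integral_ge0 => z _; rewrite lee_fin; have /andP[] := hr01 z.
have b0 : (0 <= b)%E by apply: integral_ge0 => z _; rewrite lee_fin sqrtr_ge0.
have ab : (a <= b)%E.
  apply: ge0_le_integral => //.
  - by move=> z _; rewrite lee_fin; have /andP[] := hr01 z.
  - exact/measurable_EFinP.
  move=> z _; rewrite lee_fin; have /andP[h0 h1] := hr01 z.
  rewrite -{1}(ger0_norm h0) -sqrtr_sqr ler_wsqrtr// expr2.
  by rewrite ler_piMl.
(* The quotient is 0 when [a = 0], which by [ab] includes [b = 0], and when [b = +oo], whose inverse
   is 0. *)
have [az|an0] := eqVneq a 0%E; first by rewrite az mul0e expeS mul0e measure_ge0.
have [by_|bny] := eqVneq b +oo%E; first by rewrite by_ invey mule0 expeS mul0e measure_ge0.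
have bfin : b \is a fin_num by rewrite ge0_fin_numE// ltey.
have afin : a \is a fin_num by rewrite ge0_fin_numE// (le_lt_trans ab)// ltey.
pose x := fine a; pose y := fine b.
have xE : a = x%:E by rewrite fineK.
have yE : b = y%:E by rewrite fineK.
have x0 : 0 < x by rewrite -lte_fin -xE lt0e an0.
have xy : x <= y by rewrite -lee_fin -xE -yE.
have y0 : 0 < y by exact: lt_le_trans xy.
(* The maximiser of [2 c x - c^2 y^2], with maximum [(x / y)^2]. *)
pose c := x / y ^+ 2.
have c0 : 0 < c by rewrite divr_gt0// exprn_gt0.
have aY : (\int[P]_w Y w = a)%E.
  by rewrite -integral_section//; apply: eq_integral => z _; rewrite -hrE.
(* AM-GM: [2 c Y <= (c Y)^2 + 1] wherever [Y] does not vanish. *)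
have key : (\int[P]_w ((2 * c)%:E * Y w) <=
    \int[P]_w ((c ^+ 2)%:E * (Y w * Y w) + (\1_N w)%:E))%E.
  apply: ge0_le_integral => //.
  - by move=> w _; rewrite mule_ge0// lee_fin mulr_ge0// ltW.
  - by apply: emeasurable_funM => //; exact: measurable_cst.
  - apply: emeasurable_funD.
      by apply: emeasurable_funM; [exact: measurable_cst|exact: emeasurable_funM].
    by apply/measurable_EFinP; exact: measurable_indic.
  move=> w _; rewrite indicE.
  have [wN|wN] := boolP (w \in N); last first.
    rewrite (_ : Y w = 0%E) ?mule0 ?adde0//.
    rewrite /Y (_ : ysection B w = set0) ?measure0//.
    apply/seteqP; split => // z /ysectionP/BN.
    by move: wN; rewrite notin_setE.
  have : (0 <= Y w)%E by exact: measure_ge0.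
  case: (Y w) => [t t0|t0|//].
    rewrite -!EFinM -EFinD lee_fin.
    have := sqr_ge0 (c * t - 1); rewrite !expr2 /= => ?; lra.
  have c2 : (0 < (c ^+ 2)%:E)%E by rewrite lte_fin exprn_gt0.
  by rewrite mulyy (gt0_muley c2) addye// leey.
have Y0 w : (0 <= Y w)%E by exact: measure_ge0.
have mY2 : measurable_fun setT (fun w => Y w * Y w)%E by exact: emeasurable_funM.
have m1 : measurable_fun setT (fun w => (\1_N w)%:E : \bar R).
  by apply/measurable_EFinP; exact: measurable_indic.
have c20 : (0 <= (c ^+ 2)%:E)%E by rewrite lee_fin sqr_ge0.
have cc0 : (0 <= (2 * c)%:E)%E by rewrite lee_fin mulr_ge0// ltW.
have e1 := ge0_integralZl P measurableT mY (fun w _ => Y0 w) cc0.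
have e2 := ge0_integralZl P measurableT mY2 (fun w _ => mule_ge0 (Y0 w) (Y0 w)) c20.
have mc2 : measurable_fun setT (fun w => (c ^+ 2)%:E * (Y w * Y w))%E.
  by apply: emeasurable_funM mY2; exact: measurable_cst.
have i0 w : (0 <= (\1_N w : R)%:E)%E by rewrite lee_fin.
have e3 := ge0_integralD P measurableT (fun w _ => mule_ge0 c20 (mule_ge0 (Y0 w) (Y0 w))) mc2
  (fun w _ => i0 w) m1.
move: key; rewrite e1 e3 e2 integral_indic// setIT.
rewrite aY => key.
have S := integral_section_sqr; rewrite -/b in S.
pose p := fine (P N).
have pE : P N = p%:E by rewrite /p fineK// fin_num_measure.
have : ((2 * c)%:E * a <= (c ^+ 2)%:E * (b * b) + P N)%E.
  apply: (le_trans key); rewrite leeD2r// lee_pmul2l//.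
  by rewrite lte_fin exprn_gt0.
rewrite xE yE pE -!EFinM -EFinD lee_fin => fin.
rewrite inver gt_eqF// -EFinM -EFin_expe lee_fin expr2.
have cE : 2 * c * x - c ^+ 2 * (y * y) = x / y * (x / y).
  by rewrite /c; field; rewrite gt_eqF.
lra.
Qed.

End second_moment.

(** * The lower bound *)

Section discs.
Variable R : realType.
Local Notation C := R[i].
Local Notation mu := (@lebesgue_complex R).

Lemma lebesgue_complex_bounded (D : set C) (rad : R) : measurable D ->
  (forall z, D z -> normc z <= rad) -> (mu D < +oo)%E.
Proof.
move=> mD Drad.
pose I : set (measurableTypeR R) := `[- rad, rad]%classic.
have mI : measurable I by exact: measurable_itv.
have Ioo : (@lebesgue_measure R I < +oo)%E.
  by rewrite lebesgue_measure_itv; case: ifP => _; rewrite ?ltry// -EFinD ltry.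
pose pm := prod_measure (@lebesgue_measure R) (@lebesgue_measure R).
have -> : mu D = pm (@complex_of_plane R @^-1` D) by [].
apply: (@le_lt_trans _ _ (pm (I `*` I))).
  apply: (le_measure pm); rewrite ?inE.
  - by rewrite -[X in measurable X]setTI; exact: measurable_complex_of_plane.
  - exact: measurableX.
  move=> [x y] /= /Drad h; split; rewrite /I/= in_itv/= -ler_norml (le_trans _ h)//.
    exact: (normc_Re (x +i* y)).
  exact: (normc_Im (x +i* y)).
rewrite [pm _]product_measure1E//.
by rewrite lte_mul_pinfty// ge0_fin_numE.
Qed.

Lemma discs_bounded k (z : k.-tuple C) v : discs z v -> normc v <= \sum_i 2 * normc (tnth z i).
Proof.
case=> i; rewrite !normC ltcR => h.
have h2 := normcD (v - tnth z i) (tnth z i); rewrite subrK in h2.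
rewrite (bigD1 i)//= -[leLHS]addr0; apply: lerD; first by lra.
by apply: sumr_ge0 => j _; rewrite mulr_ge0// normc_ge0.
Qed.

Lemma measurable_discs k (z : k.-tuple C) : measurable (discs z).
Proof.
rewrite (_ : discs z = \bigcup_(i in [set: 'I_k]) cball (tnth z i) (normc (tnth z i))).
  by apply: fin_bigcup_measurable => [|i _]; [exact: finite_finset|exact: measurable_cball].
apply/seteqP; split => v /=.
  by case=> i; rewrite !normC ltcR => h; exists i.
by case=> i _ h; exists i; rewrite !normC ltcR.
Qed.

End discs.

Section hole_probability.
Variable R : realType.
Local Notation C := R[i].
Local Notation K := (@ginibre_kernel R).
Context d (Omega : measurableType d) (P : probability Omega R).
Variables (phi0 : Omega -> set C) (Z : Omega -> C).
Hypothesis hphi0 : determinantal P phi0 (@ginibre_kernel0 R).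
Hypothesis mZ : measurable_fun setT Z.
Local Notation phi := (fun w => phi0 w `|` [set Z w]).
Hypothesis hphi : determinantal P phi K.
Variables (k : nat) (alpha : k.-tuple C -> nat -> R).
Hypothesis halpha : forall z, eigenvalue_sequence K (discs z) (alpha z).

Definition ginibre_empty : set (k.-tuple C * Omega) := [set x | phi x.2 `&` discs x.1 = set0].

(* The last condition discards the [z] for which 1 may be an eigenvalue; there [Hfun] vanishes while
   the first two conditions could still have positive probability. *)
Definition hole_event : set (k.-tuple C * Omega) :=
  [set x | [/\ phi0 x.2 `&` discs x.1 = set0, discs x.1 (Z x.2) &
    P (xsection ginibre_empty x.1) != 0%E]].

Lemma measurable_ginibre_empty : measurable ginibre_empty.
Proof. by apply: measurable_avoid_discs; case: hphi. Qed.

Lemma measurable_hole_event : measurable hole_event.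
Proof.
have m1 : measurable [set x : k.-tuple C * Omega | phi0 x.2 `&` discs x.1 = set0].
  exact: (measurable_avoid_discs hphi0.1).
have m2 : measurable [set x : k.-tuple C * Omega | discs x.1 (Z x.2)].
  exact: measurable_mem_discs.
have m3 : measurable [set z : k.-tuple C | P (xsection ginibre_empty z) != 0%E].
  have m := measurable_fun_xsection P measurable_ginibre_empty.
  rewrite (_ : [set z | _] = ~` ((P \o xsection ginibre_empty) @^-1` [set 0%E])).
    apply: measurableC; rewrite -[X in measurable X]setTI.
    exact: (m measurableT _ (emeasurable_set1 0%E)).
  by apply/seteqP; split => z /=; [move/eqP|move=> h; apply/eqP].
rewrite (_ : hole_event = [set x : k.-tuple C * Omega | phi0 x.2 `&` discs x.1 = set0] `&`
  [set x | discs x.1 (Z x.2)] `&`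
  ([set z : k.-tuple C | P (xsection ginibre_empty z) != 0%E] `*` setT)).
  by apply: measurableI; [exact: measurableI|exact: measurableX].
by apply/seteqP; split => x /= => [[h1 h2 h3]|[[h1 h2] [h3 _]]].
Qed.

(** [phi] misses the discs exactly when [phi0] does and [Z] lies outside them, so the section is a
    difference of nested events unless [P B = 0], where both sides vanish. *)
Lemma Hfun_hole_event z : Hfun alpha z = fine (P (xsection hole_event z)).
Proof.
have mD := measurable_discs z; have Drad := @discs_bounded R k z.
have moo := lebesgue_complex_bounded mD Drad.
have [hF hR] := ginibre_void_probability hphi hphi0 mD moo Drad (halpha z).
pose A := [set w | phi0 w `&` discs z = set0].
pose B := [set w | phi w `&` discs z = set0].
have BE : xsection ginibre_empty z = B.
  by apply/seteqP; split => w; [move=> /xsectionP|move=> h; apply/xsectionP].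
have mB : measurable B by rewrite -BE; apply: measurable_xsection; exact: measurable_ginibre_empty.
have mA : measurable A by apply: measurable_avoid mD; case: hphi0.
have BA : B `<=` A.
  move=> w /= h; apply/seteqP; split => // v [pv dv]; rewrite -h; split => //; by left.
rewrite /Hfun hF; have [P0|P0] := eqVneq (P B) 0%E.
  rewrite -/B P0 mulr0 (_ : xsection hole_event z = set0) ?measure0//.
  by apply/seteqP; split => // w /xsectionP[_ _ /=]; rewrite BE P0 eqxx.
have F0 : fine (P B) != 0.
  by apply: contraNneq P0 => h; rewrite -[P B]fineK ?h// fin_num_measure.
rewrite mulrBl mul1r hR// -/A -/B.
have -> : xsection hole_event z = A `\` B.
  apply/seteqP; split => w.
    move=> /xsectionP[/= h1 h2 _]; split => // h.
    suff : set0 (Z w) by [].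
    by rewrite -h; split => //; right.
  move=> [h1 h2]; apply/xsectionP; split => //=; last by rewrite BE.
  apply: contrapT => h; apply: h2; apply/seteqP; split => // v [[pv|/= ->] dv]; last by apply: h.
  by rewrite -h1.
rewrite measureD//; last by rewrite ltey_eq fin_num_measure.
by rewrite setIidr// fineB// fin_num_measure.
Qed.

Lemma hole_event_neighbours0 z w : hole_event (z, w) -> neighbours0 (phi w) (Z w).
Proof. by move=> [/= h1 h2 _]; have [] := discs_neighbours0 h1 h2. Qed.

End hole_probability.
Local Close Scope complex_scope.
Unset Implicit Arguments.
Set Strict Implicit.
Local Open Scope ereal_scope.

Theorem theorem5 (R : realType) (d : measure_display) (Omega : measurableType d)
    (P : probability Omega R) (phi0 : Omega -> set R[i]) (Z : {RV P >-> R[i]})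
    (hphi0 : determinantal P phi0 (@ginibre_kernel0 R))
    (hZ : standard_complex_gaussian Z)
    (hdisj : {ae P, forall w, phi0 w `&` [set Z w] = set0})
    (hphi : determinantal P (fun w => phi0 w `|` [set Z w])
      (@ginibre_kernel R))
    (k : nat) (hk : (0 < k)%N)
    (alpha : k.-tuple R[i] -> nat -> R)
    (halpha : forall z : k.-tuple R[i],
      eigenvalue_sequence (@ginibre_kernel R) (discs z) (alpha z)) :
  P [set w | neighbours0 (phi0 w `|` [set Z w]) (Z w)] >=
  ((\int[power_measure lebesgue_complex k]_z (Hfun alpha z)%:E) /
   (\int[power_measure lebesgue_complex k]_z (Num.sqrt (Hfun alpha z))%:E)) ^+ 2.
Proof.
have mZ : measurable_fun setT Z by exact: measurable_funP.
have mB : measurable (@hole_event R d Omega P phi0 Z k).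
  exact: measurable_hole_event.
have mN := measurable_neighbours0 hphi0.1 mZ.
have := second_moment (power_measure lebesgue_complex k) P mB mN
  (@hole_event_neighbours0 _ _ _ P phi0 Z k).
have HE := Hfun_hole_event hphi0 hphi halpha.
rewrite (eq_integral (fun z => (Hfun alpha z)%:E)) => [|z _]; last by rewrite HE.
rewrite [X in (_ / X) ^+ 2](eq_integral (fun z => (Num.sqrt (Hfun alpha z))%:E)) => [//|z _].
by rewrite HE.
Qed.
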